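(* Let $\mathbb{K}$ be an algebraically closed field of odd characteristic $p>0$, let $W$ be a three-dimensional vector space over $\mathbb{K}$, and let $G\subset \operatorname{GL}(W)$ be a finite group that acts by upper triangular matrices (with respect to some fixed basis of $W$) and is generated by pseudoreflections. Let $H$ be the subgroup of $G$ consisting of all elements acting by unipotent matrices. If $H$ is abelian, then the ring of invariants $\mathbb{K}[W]^G$ is polynomial if and only if $H$ is generated by pseudoreflections or $H$ does not contain transvections.
   Context: A linear transformation $A\in\operatorname{GL}(W)$ of finite order, $\dim W=n$, is a pseudoreflection if $\dim\ker(A-E)=n-1$, where $E$ is the identity (for convenience the identity is sometimes also counted as a pseudoreflection; this does not affect the notion of being generated by pseudoreflections; the trivial group is regarded as generated by pseudoreflections). A (non-identity) pseudoreflection is called a homology if it is diagonalizable, and a transvection otherwise. $\mathbb{K}[W]\cong\mathbb{K}[x_1,\dots,x_n]$ is the ring of regular (polynomial) functions on $W$; $G$ acts on it by $(g\cdot f)(x)=f(g^{-1}x)$, and $\mathbb{K}[W]^G=\{f\in\mathbb{K}[W] : g\cdot f=f \text{ for all } g\in G\}$. The ring $\mathbb{K}[W]^G$ is called polynomial if it is a free commutative $\mathbb{K}$-algebra, i.e. isomorphic as a $\mathbb{K}$-algebra to a polynomial ring over $\mathbb{K}$ in finitely many variables. *)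

(* Defs.v *)
From mathcomp Require Export all_boot all_order all_algebra all_fingroup.
From mathcomp Require Export mpoly.

Set Implicit Arguments.
Unset Strict Implicit.
Unset Printing Implicit Defensive.

Import GRing.Theory.
Local Open Scope ring_scope.

Section LinearMaps.

Variables (K : fieldType) (W : vectType K).
Implicit Type f : 'End(W).

(* Finite order is not required here: it is automatic for the elements of a
   finite group. The identity is not a pseudoreflection. *)
Definition pseudoreflection f : bool :=
  \dim (lker (f - \1)%VF) == (\dim {:W}).-1.

Definition diagonalizable_end f : Prop :=
  exists2 b : (\dim {:W}).-tuple W, basis_of {:W} b
    & forall v, v \in b -> exists a : K, f v = a *: v.

Definition transvection f : Prop :=
  pseudoreflection f /\ ~ diagonalizable_end f.

Definition unipotent f : Prop :=
  exists k : nat, forall w, iter k (f - \1)%VF w = 0.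

(* The (i, j) entry of the matrix of f in the basis e is the i-th coordinate
   of f e_j (linear maps act on column vectors). *)
Definition upper_triangular n (e : n.-tuple W) f : Prop :=
  forall i j : 'I_n, (j < i)%N -> coord e i (f e`_j) = 0.

End LinearMaps.

(* A finite subgroup of GL(W) is given as the image of a faithful linear
   action rho of a finite group G; invertibility of rho g follows. *)
Definition faithful_linear_action (K : fieldType) (W : vectType K)
    (gT : finGroupType) (G : {group gT}) (rho : gT -> 'End(W)) : Prop :=
  [/\ rho 1%g = \1%VF,
      {in G &, forall x y, rho (x * y)%g = (rho x \o rho y)%VF}
    & {in G &, injective rho}].

Definition generated_by_pseudoreflections (K : fieldType) (W : vectType K)
    (gT : finGroupType) (G : {group gT}) (rho : gT -> 'End(W)) : Prop :=
  <<[set g in G | pseudoreflection (rho g)]>>%g = G.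

Section Invariants.

(* K[W] is identified with {mpoly K[n]} by the coordinates of a basis e of W.
   As K is infinite, a polynomial is determined by its function on W, so that
   invariance can be tested on values. *)
Variables (K : closedFieldType) (W : vectType K) (n : nat) (e : n.-tuple W).

Definition regular_fun (f : {mpoly K[n]}) (w : W) : K :=
  f.@[fun i => coord e i w].

Variables (gT : finGroupType) (G : {group gT}) (rho : gT -> 'End(W)).

Definition invariant (f : {mpoly K[n]}) : Prop :=
  forall g, g \in G ->
  forall w, regular_fun f (rho g^-1%g w) = regular_fun f w.

(* phi is an isomorphism of K-algebras from K[y_1, ..., y_m] onto K[W]^G. *)
Definition polynomial_invariants : Prop :=
  exists (m : nat) (phi : {lrmorphism {mpoly K[m]} -> {mpoly K[n]}}),
    injective phi /\ (forall f, invariant f <-> exists q, phi q = f).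

End Invariants.

(* Main.v *)
(* By Schur-Zassenhaus G = H T with T of order prime to p, diagonal in a suitable basis
   compatible with the flag. Elements of H have entries a, b, c above the diagonal, and H
   is abelian iff a(h) c(h') = a(h') c(h), so either a = 0, or c = 0, or c = l a with l <> 0.
   If c = 0 the invariants of H are generated by the orbit product of X0, X1 and X2. If
   a = 0 they are generated by two additive forms and X2. In both cases the generators are
   eigenvectors of T, which acts on them by reflections, so the invariants of G are
   polynomial.
   If c = l a with l <> 0, then T is generated by diag (1, -1, 1). When H has no
   transvections the invariants are generated by X2, the quadric X1^2 - 2 l X0 X2 and the
   orbit product L of X0. When H has some, its transvections are the elements with a = 0
   and do not generate H; if the invariants were polynomial, L would involve some generator
   linearly, so that the Jacobian of the generators on X0 = 0 would be divisible by the
   product of the forms a(h) X1 + b(h) X2 with a(h) <> 0; this product has larger degree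
   in X1 than the Jacobian of three explicit invariants. *)
From HB Require Import structures.
From mathcomp Require Import all_solvable ring zify.
Require Import Defs.

Set Implicit Arguments.
Unset Strict Implicit.
Unset Printing Implicit Defensive.

Import GRing.Theory.
Local Open Scope ring_scope.

(** * Substitution and division of multivariate polynomials *)

(** Generators are found by division: an invariant vanishing on a coordinate hyperplane is divisible
    by an orbit product, so only restrictions to that hyperplane have to be understood, and the same
    restriction gives algebraic independence. For [a = 0] the obstacle is that the generators must
    be eigenvectors of [T]. A reflection in [T] that moves [X0] or [X1] splits [H] into translations
    of [X0] and translations of [X1]. Otherwise [T] only scales [X2], which multiplies the
    translation vectors by the values of [t2]. Lines over the prime field need not be stable under
    this, so [H] is built up along lines over the finite ring spanned additively by these values.
    For [c = l a] the group [T] is so small because conjugation must preserve this relation, which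
    forces [t0 t2 = t1 ^+ 2]. In the negative part the forms coming from [L] number [(x - 1) y],
    where [x] is the number of values of [a] and [y] the order of its kernel, and they compete with
    a Jacobian of degree [x]; odd characteristic makes [x] and [y] at least 3, which is enough. *)

Section Mpoly.

Variables (n : nat) (R : comNzRingType).
Implicit Types (p q d : {mpoly R[n]}) (i j : 'I_n).

Lemma mpoly_ring_ind (P : {mpoly R[n]} -> Prop) :
  (forall c, P c%:MP) -> (forall i, P 'X_i) ->
  (forall p q, P p -> P q -> P (p + q)) ->
  (forall p q, P p -> P q -> P (p * q)) -> forall p, P p.
Proof.
move=> PC PX PD PM; have PXn i k : P ('X_i ^+ k).
  by elim: k => [|k IH]; [rewrite expr0 -mpolyC1 | rewrite exprS; apply: PM].
have PXm (m : 'X_{1..n}) : P 'X_[m].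
  rewrite mpolyXE_id; apply: (big_ind P) => //.
  by rewrite -mpolyC1.
move=> p; rewrite (mpolyE p); apply: (big_ind P) => //.
  by rewrite -mpolyC0.
by move=> m _; rewrite -mul_mpolyC; apply: PM.
Qed.

Lemma mpoly_rmorph_ext (S : nzRingType) (f g : {rmorphism {mpoly R[n]} -> S}) :
  (forall c, f c%:MP = g c%:MP) -> (forall i, f 'X_i = g 'X_i) -> f =1 g.
Proof.
move=> eqC eqX; elim/mpoly_ring_ind => // p q Ep Eq.
  by rewrite !rmorphD Ep Eq.
by rewrite !rmorphM Ep Eq.
Qed.

Lemma comp_mpolyX_tnth k (s : n.-tuple {mpoly R[k]}) i : 'X_i \mPo s = tnth s i.
Proof. by rewrite comp_mpolyXU (tnth_nth 0). Qed.

Lemma comp_mpolyA k l (s : n.-tuple {mpoly R[k]}) (t : k.-tuple {mpoly R[l]}) p :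
  (p \mPo s) \mPo t = p \mPo [tuple tnth s i \mPo t | i < n].
Proof.
pose f : {rmorphism {mpoly R[n]} -> {mpoly R[l]}} := comp_mpoly t \o comp_mpoly s.
apply: (@mpoly_rmorph_ext _ f (comp_mpoly [tuple tnth s i \mPo t | i < n])).
  by move=> c /=; rewrite !comp_mpolyC.
by move=> i /=; rewrite !comp_mpolyX_tnth tnth_mktuple.
Qed.

Lemma comp_mpoly_ext k (s t : n.-tuple {mpoly R[k]}) p :
  (forall i, tnth s i = tnth t i) -> p \mPo s = p \mPo t.
Proof. by move=> st; congr (p \mPo _); apply/eq_from_tnth. Qed.

Lemma comp_mpoly_var (s : n.-tuple {mpoly R[n]}) p :
  (forall i, tnth s i = 'X_i) -> p \mPo s = p.
Proof.
move=> sX; rewrite -[RHS]comp_mpoly_id; apply: comp_mpoly_ext => i.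
by rewrite tnth_mktuple.
Qed.

Definition subst i d p := p \mPo [tuple if j == i then d else 'X_j | j < n].

HB.instance Definition _ i d := GRing.RMorphism.copy (subst i d)
  (comp_mpoly [tuple if j == i then d else 'X_j | j < n]).

Lemma substC i d c : subst i d c%:MP = c%:MP.
Proof. exact: comp_mpolyC. Qed.

Lemma substX i d j : subst i d 'X_j = if j == i then d else 'X_j.
Proof. by rewrite /subst comp_mpolyX_tnth tnth_mktuple. Qed.

(** The equation [subst i 0 p = p] encodes throughout that [p] does not involve [X_i]. *)
Lemma subst_free i d p : subst i 0 p = p -> subst i d p = p.
Proof.
move=> fp; rewrite -{1}fp.
pose f : {rmorphism {mpoly R[n]} -> {mpoly R[n]}} := subst i d \o subst i 0.
rewrite -[RHS]fp; apply: (@mpoly_rmorph_ext _ f (subst i 0)) => [c|j] /=.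
  by rewrite !substC.
by rewrite !substX; case: ifP => [_|ji]; rewrite ?rmorph0 ?substX ?ji.
Qed.

Lemma subst_dvd i d p : exists q, p - subst i d p = ('X_i - d) * q.
Proof.
elim/mpoly_ring_ind: p => [c|j|p q [p' Ep] [q' Eq]|p q [p' Ep] [q' Eq]].
- by exists 0; rewrite substC subrr mulr0.
- rewrite substX; case: eqP => [->|_]; [exists 1; rewrite mulr1|exists 0]=> //.
  by rewrite subrr mulr0.
- by exists (p' + q'); rewrite rmorphD opprD addrACA Ep Eq mulrDr.
- exists (p' * q + subst i d p * q'); rewrite rmorphM mulrDr mulrA -Ep.
  rewrite mulrCA -Eq mulrBl mulrBr addrA subrK //.
Qed.

Lemma subst_eq0_dvd i d p : subst i d p = 0 -> exists q, p = ('X_i - d) * q.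
Proof. by move=> p0; have [q] := subst_dvd i d p; rewrite p0 subr0; exists q. Qed.

End Mpoly.

Section MpolyDomain.

Variables (n : nat) (R : idomainType).
Implicit Types (p q d : {mpoly R[n]}) (i j : 'I_n).

(** The factor theorem, one root at a time: [d] remains a root after the other factors are split
    off, since [X_i - e] becomes the nonzero [d - e] at [X_i = d]. *)
Lemma prod_subst_eq0_dvd i (ds : seq {mpoly R[n]}) p :
  uniq ds -> {in ds, forall d, subst i 0 d = d} ->
  {in ds, forall d, subst i d p = 0} ->
  exists q, p = (\prod_(d <- ds) ('X_i - d)) * q.
Proof.
elim: ds p => [|d ds IH] p /=; first by exists p; rewrite big_nil mul1r.
case/andP=> dds uds fds rds.
have [|e eds|e eds|q Ep] := IH p; rewrite ?fds ?rds ?inE ?eds ?orbT //.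
have sd e : e \in ds -> subst i d e = e.
  by move=> eds; apply/subst_free/fds; rewrite inE eds orbT.
have /eqP := rds d (mem_head _ _); rewrite Ep rmorphM rmorph_prod /=.
rewrite mulf_eq0 => /orP[|/eqP/subst_eq0_dvd[r ->]].
  rewrite prodf_seq_eq0 => /hasP[e eds] /=.
  rewrite rmorphB /= substX eqxx sd // subr_eq0 => /eqP dE.
  by rewrite dE eds in dds.
by exists r; rewrite big_cons mulrCA mulrA.
Qed.

(** [msize] is the total degree plus one, and 0 for the zero polynomial; bounds of the form [_.+1]
    treat both alike. *)
Lemma msizeM_deg p q a b :
  (msize p <= a.+1)%N -> (msize q <= b.+1)%N -> (msize (p * q) <= (a + b).+1)%N.
Proof.
have [->|p0] := eqVneq p 0; first by rewrite mul0r mmeasure0.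
have [->|q0] := eqVneq q 0; first by rewrite mulr0 mmeasure0.
by move=> pa qb; rewrite msizeM // -ltnS -addSn -addnS prednK ?leq_add //;
   rewrite addn_gt0 lt0n mmeasure_poly_eq0 p0.
Qed.

Lemma msizeXn_deg p a k : (msize p <= a.+1)%N -> (msize (p ^+ k) <= (a * k).+1)%N.
Proof.
move=> pa; elim: k => [|k IH]; first by rewrite expr0 msize1.
by rewrite exprS mulnS; apply: msizeM_deg.
Qed.

Lemma msize_prod_deg (I : Type) (r : seq I) (F : I -> {mpoly R[n]}) (a : I -> nat) :
  (forall x, msize (F x) <= (a x).+1)%N ->
  (msize (\prod_(x <- r) F x) <= (\sum_(x <- r) a x).+1)%N.
Proof.
by move=> Fa; elim/big_rec2: _ => [|x b p _ pb]; [rewrite msize1|apply: msizeM_deg].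
Qed.

Lemma msize_sum_le (I : eqType) (r : seq I) (F : I -> {mpoly R[n]}) b :
  {in r, forall x, msize (F x) <= b}%N -> (msize (\sum_(x <- r) F x) <= b)%N.
Proof.
move=> Fb; rewrite big_seq; elim/big_rec: _ => [|x p xr pb].
  by rewrite mmeasure0.
by apply: leq_trans (mmeasureD_le _ _ _) _; rewrite geq_max Fb.
Qed.

End MpolyDomain.

Section MpolyDomain2.

Variables (n : nat) (R : idomainType).
Implicit Types (p q d : {mpoly R[n]}) (i j : 'I_n).

Lemma msize_comp_le k (s : n.-tuple {mpoly R[k]}) p :
  (forall i, msize (tnth s i) <= 2)%N -> (msize (p \mPo s) <= msize p)%N.
Proof.
move=> s2; rewrite comp_mpolyEX; apply: msize_sum_le => m mp.
apply: leq_trans (msizeZ_le _ _) _; rewrite comp_mpolyX.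
apply: leq_trans (msize_mdeg_lt mp).
rewrite mdegE; apply: (@msize_prod_deg _ _ _ _ _ (fun i => m i)) => i.
by have := msizeXn_deg (m i) (s2 i); rewrite mul1n.
Qed.

(** Descent on the degree of a relation [p]: through [h] it is divisible by [X_i], and the nonzero
    factor [tnth s i] cancels from its image. In the uses, [h] sets to 0 a variable whose orbit
    product is [tnth s i]. *)
Lemma comp_mpoly_inj (S : idomainType) (h : {rmorphism {mpoly R[n]} -> S})
    i (s : n.-tuple {mpoly R[n]}) :
  tnth s i != 0 ->
  (forall p, h (p \mPo s) = 0 -> subst i 0 p = 0) ->
  forall p, p \mPo s = 0 -> p = 0.
Proof.
move=> s0 hs p; have [m] := ubnP (msize p).
elim: m p => // m IH p; rewrite ltnS => pm p0; apply/eqP/negPn/negP => np0.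
have /subst_eq0_dvd[q Ep] : subst i 0 p = 0 by apply: hs; rewrite p0 rmorph0.
rewrite subr0 in Ep.
have q0 : q != 0 by apply: contraNneq np0 => q0; rewrite Ep q0 mulr0.
case/negP: (q0); apply/eqP/IH.
  move: pm; rewrite Ep msizeM //; first by rewrite msizeX mdeg1 !addSn add0n.
  by rewrite -(mmeasure_poly_eq0 mdeg) msizeX.
move/eqP: p0; rewrite Ep rmorphM /= comp_mpolyX_tnth mulf_eq0 (negPf s0).
by move/eqP.
Qed.

(** The quotient [g] has smaller degree than [f], because the divisor is not constant and the
    remainder does not exceed the degree of [f]; so the division can be repeated on [g]. *)
Lemma generation_by_division (S : {mpoly R[n]} -> Prop) k
    (s : k.-tuple {mpoly R[n]}) (L0 : {mpoly R[k]}) :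
  (1 < msize (L0 \mPo s))%N ->
  (forall f, S f -> exists2 p : {mpoly R[k]}, (msize (p \mPo s) <= msize f)%N
     & exists2 g, S g & f = p \mPo s + (L0 \mPo s) * g) ->
  forall f, S f -> exists p : {mpoly R[k]}, f = p \mPo s.
Proof.
move=> L1 div f; have [m] := ubnP (msize f).
elim: m f => // m IH f; rewrite ltnS => fm /[dup] Sf /div[p ps [g Sg Ef]].
have [g0|g0] := eqVneq g 0; first by exists p; rewrite Ef g0 mulr0 addr0.
have L0' : L0 \mPo s != 0 by rewrite -(mmeasure_poly_eq0 mdeg) -lt0n ltnW.
have gm : (msize g < m)%N.
  apply: leq_trans fm.
  have : (msize ((L0 \mPo s) * g) <= msize f)%N.
    have -> : (L0 \mPo s) * g = f - (p \mPo s) by rewrite Ef [X in X - _]addrC addrK.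
    apply: leq_trans (mmeasureD_le _ _ _) _.
    by rewrite mmeasureN geq_max leqnn.
  apply: leq_trans; rewrite msizeM //.
  by case: (msize _) L1 => [|[|l]] // _; rewrite !addSn /= ltnS leq_addl.
have [q Eg] := IH _ gm Sg.
by exists (p + L0 * q); rewrite Ef rmorphD rmorphM /= Eg.
Qed.

End MpolyDomain2.

Definition polynomial_subring (K : fieldType) n (S : {mpoly K[n]} -> Prop) : Prop :=
  exists (m : nat) (phi : {lrmorphism {mpoly K[m]} -> {mpoly K[n]}}),
    injective phi /\ (forall f, S f <-> exists q, phi q = f).

(** * Invariants of a diagonal action on a polynomial ring *)

Section Weights.

Variables (K : fieldType) (n : nat).
Implicit Types (p : {mpoly K[n]}) (m : 'X_{1..n}).

Lemma mcoeff_sumX p (c : 'X_{1..n} -> K) (g : 'X_{1..n} -> 'X_{1..n}) m :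
  injective g ->
  (\sum_(m' <- msupp p) p@_m' *: (c m' *: 'X_[K, g m']))@_(g m) = p@_m * c m.
Proof.
move=> inj_g; rewrite raddf_sum /=.
under eq_bigr do rewrite !mcoeffZ mcoeffX (inj_eq inj_g).
rewrite [in RHS](mpolyE p) raddf_sum /= mulr_suml; apply: eq_bigr => m' _.
rewrite mcoeffZ mcoeffX -mulrA; congr (_ * _).
by case: eqP => [->|_]; rewrite ?mulr1 ?mul1r ?mulr0 ?mul0r.
Qed.

Lemma comp_mpoly_scaleX (w : 'I_n -> K) p m :
  (p \mPo [tuple w i *: 'X_i | i < n])@_m = p@_m * \prod_i w i ^+ m i.
Proof.
rewrite comp_mpolyEX -(@mcoeff_sumX p (fun m => \prod_i w i ^+ m i) id) //.
congr mcoeff; apply: eq_bigr => m' _; congr (_ *: _).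
rewrite comp_mpolyX mpolyXE_id -scaler_prod; apply: eq_bigr => i _.
by rewrite tnth_mktuple exprZn.
Qed.

Definition mnm_scale (k : 'I_n -> nat) m : 'X_{1..n} := [multinom (k i * m i)%N | i < n].

Lemma comp_mpoly_Xpow (k : 'I_n -> nat) p :
  p \mPo [tuple 'X_i ^+ k i | i < n]
  = \sum_(m <- msupp p) p@_m *: (1 *: 'X_[K, mnm_scale k m]).
Proof.
rewrite comp_mpolyEX; apply: eq_bigr => m _; rewrite scale1r; congr (_ *: _).
rewrite comp_mpolyX mpolyXE_id; apply: eq_bigr => i _.
by rewrite tnth_mktuple mnmE exprM.
Qed.

Lemma comp_mpoly_Xpow_inj (k : 'I_n -> nat) p :
  (forall i, 0 < k i)%N -> p \mPo [tuple 'X_i ^+ k i | i < n] = 0 -> p = 0.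
Proof.
move=> k0 p0; apply/mpolyP => m.
have inj_k : injective (mnm_scale k).
  move=> m1 m2 /mnmP eqm; apply/mnmP => i; have /eqP := eqm i.
  by rewrite !mnmE eqn_pmul2l // => /eqP.
have := mcoeff_sumX p (fun=> 1) m inj_k.
by rewrite -comp_mpoly_Xpow p0 mcoeff0 mulr1 => <-; rewrite mcoeff0.
Qed.

(* The hypothesis on reflections makes f invariant exactly when every monomial of p has
   its i-th exponent divisible by the order k i of the weights w t i: the new generators
   are the powers s_i ^ (k i). *)
Lemma polynomial_subring_weights (S SH : {mpoly K[n]} -> Prop)
    (s : n.-tuple {mpoly K[n]}) (I : finType) (T : {set I})
    (act : I -> {rmorphism {mpoly K[n]} -> {mpoly K[n]}}) (w : I -> 'I_n -> K) N :
  (forall f, SH f <-> exists p : {mpoly K[n]}, f = p \mPo s) ->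
  (forall p, p \mPo s = 0 -> p = 0) ->
  (forall f, S f <-> SH f /\ {in T, forall t, act t f = f}) ->
  {in T, forall t c, act t c%:MP = c%:MP} ->
  {in T, forall t i, act t (tnth s i) = w t i *: tnth s i} ->
  {in T, forall t i j, w t i != 1 -> w t j != 1 -> i = j} ->
  (0 < N)%N -> {in T, forall t i, w t i ^+ N = 1} ->
  polynomial_subring S.
Proof.
move=> SHE inj_s SE actC acts refl N0 wN.
pose good i k := (0 < k)%N && [forall (t | t \in T), w t i ^+ k == 1].
have exk i : exists k, good i k.
  by exists N; rewrite /good N0; apply/forall_inP => t tT; rewrite wN.
pose k i := ex_minn (exk i).
have k0 i : (0 < k i)%N by rewrite /k; case: ex_minnP => m /andP[].
have wk t i : t \in T -> w t i ^+ k i = 1.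
  by rewrite /k; case: ex_minnP => m /andP[_ /forall_inP wm] _ /wm/eqP.
have kdiv i e : {in T, forall t, w t i ^+ e = 1} -> (k i %| e)%N.
  move=> wm; rewrite /dvdn; case: posnP => // r0.
  have := ltn_pmod e (k0 i); rewrite {2}/k; case: ex_minnP => l gl min_l.
  rewrite ltnNge min_l // /good r0; apply/forall_inP => t tT.
  have := wm t tT; rewrite {1}(divn_eq e (k i)) exprD mulnC exprM wk // expr1n.
  by rewrite mul1r => ->.
(* By independence of [s], invariance passes to the parameters, where [t] scales [X_i] by
   [w t i]. *)
have inj_act t f : t \in T -> f \mPo s = act t (f \mPo s) ->
    f \mPo [tuple w t i *: 'X_i | i < n] = f.
  move=> tT Ef; apply/eqP; rewrite -subr_eq0; apply/eqP/inj_s.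
  rewrite rmorphB /= Ef comp_mpolyA; apply/eqP; rewrite subr_eq0; apply/eqP.
  pose g : {rmorphism {mpoly K[n]} -> {mpoly K[n]}} := act t \o comp_mpoly s.
  apply: (@mpoly_rmorph_ext _ _ _ (comp_mpoly _) g) => [c|i] /=.
    by rewrite !comp_mpolyC actC.
  by rewrite !comp_mpolyX_tnth acts // !tnth_mktuple comp_mpolyZ comp_mpolyX_tnth.
pose s' := [tuple tnth s i ^+ k i | i < n].
have s'E p : p \mPo s' = (p \mPo [tuple 'X_i ^+ k i | i < n]) \mPo s.
  rewrite comp_mpolyA; apply: comp_mpoly_ext => i.
  by rewrite !tnth_mktuple rmorphXn /= comp_mpolyX_tnth.
exists n, (comp_mpoly s'); split.
  move=> p q /eqP; rewrite -subr_eq0 -rmorphB /= s'E => /eqP/inj_s.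
  by move/(comp_mpoly_Xpow_inj k0)/eqP; rewrite subr_eq0 => /eqP.
move=> f; split; last first.
  case=> p <-; apply/SE; split.
    by apply/SHE; rewrite /= s'E; eexists.
  move=> t tT; pose g : {rmorphism {mpoly K[n]} -> {mpoly K[n]}} := act t \o comp_mpoly s'.
  apply: (@mpoly_rmorph_ext _ _ _ g (comp_mpoly s')) => [c|i] /=.
    by rewrite !comp_mpolyC actC.
  by rewrite !comp_mpolyX_tnth tnth_mktuple rmorphXn /= acts // exprZn wk // scale1r.
move/SE=> [/SHE[p ->] inv].
(* The product of these factors over all [i] is 1, and at most one weight of [t] differs from 1, so
   each factor is 1. *)
have wp t m : t \in T -> m \in msupp p -> forall i, w t i ^+ m i = 1.
  move=> tT; rewrite mcoeff_msupp => pm i.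
  have /(congr1 (mcoeff m)) := inj_act t p tT (esym (inv t tT)).
  rewrite comp_mpoly_scaleX -[RHS]mulr1 => /(mulfI pm).
  have [->|wi] := eqVneq (w t i) 1; first by rewrite expr1n.
  rewrite (bigD1 i) //= big1 ?mulr1 // => j ji.
  have [->|wj] := eqVneq (w t j) 1; first by rewrite expr1n.
  by rewrite (refl t tT _ _ wj wi) eqxx in ji.
pose q := \sum_(m <- msupp p) p@_m *: 'X_[K, [multinom (m i %/ k i)%N | i < n]].
exists q; rewrite /= s'E; congr (_ \mPo _); rewrite /q raddf_sum /= [RHS]mpolyE.
rewrite !big_seq; apply: eq_bigr => m mp; rewrite comp_mpolyZ; congr (_ *: _).
rewrite comp_mpolyX mpolyXE_id; apply: eq_bigr => i _.
by rewrite tnth_mktuple mnmE -exprM mulnC divnK // kdiv // => t tT; apply: wp.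
Qed.

End Weights.

(** * Groups of translations *)

(** A finite additive subgroup, as a list without repetition so that it can index products and count
    roots. *)
Definition additive_seq (V : zmodType) (s : seq V) : Prop :=
  [/\ uniq s, 0 \in s & {in s &, forall x y, x - y \in s}].

Lemma additive_seqN (V : zmodType) (s : seq V) :
  additive_seq s -> {in s, forall x, - x \in s}.
Proof. by case=> _ s0 sB x xs; rewrite -sub0r sB. Qed.

Lemma perm_additive_seq (V : zmodType) (s : seq V) x :
  additive_seq s -> x \in s -> perm_eq [seq y - x | y <- s] s.
Proof.
case=> us s0 sB xs; apply: uniq_perm => //.
  by rewrite map_inj_uniq // => y z /addIr.
have ux : uniq [seq y - x | y <- s] by rewrite map_inj_uniq // => y z /addIr.
have [||] // := uniq_min_size ux (s2 := s).
  by move=> _ /mapP[y ys ->]; apply: sB.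
by rewrite size_map.
Qed.

Section Translations.

Variables (n : nat) (K : fieldType) (i : 'I_n) (ds : seq {mpoly K[n]}).
Hypothesis add_ds : additive_seq ds.
Hypothesis free_ds : {in ds, forall d, subst i 0 d = d}.
Implicit Types p f : {mpoly K[n]}.

Definition orbit_prod := \prod_(d <- ds) ('X_i - d).

Lemma subst_shift_comp d e f : subst i 0 d = d ->
  subst i e (subst i ('X_i + d) f) = subst i (e + d) f.
Proof.
move=> fd.
pose g : {rmorphism {mpoly K[n]} -> {mpoly K[n]}} := subst i e \o subst i ('X_i + d).
apply: (@mpoly_rmorph_ext _ _ _ g (subst i (e + d))) => [c|j] /=.
  by rewrite !substC.
rewrite !substX; case: eqP => [_|/eqP ji].
  by rewrite rmorphD /= substX eqxx (subst_free _ fd).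
by rewrite substX (negPf ji).
Qed.

Lemma subst_idem d f : subst i d (subst i 0 f) = subst i 0 f.
Proof.
pose g : {rmorphism {mpoly K[n]} -> {mpoly K[n]}} := subst i d \o subst i 0.
apply: (@mpoly_rmorph_ext _ _ _ g (subst i 0)) => [c|j] /=.
  by rewrite !substC.
rewrite substX; case: eqP => [_|/eqP ji]; first by rewrite rmorph0.
by rewrite substX (negPf ji).
Qed.

Lemma orbit_prod_shift d : d \in ds -> subst i ('X_i + d) orbit_prod = orbit_prod.
Proof.
move=> dd; rewrite rmorph_prod /=.
rewrite -[RHS](perm_big _ (perm_additive_seq add_ds dd)) big_map.
apply: eq_big_seq => e ed; rewrite rmorphB /= substX eqxx (subst_free _ (free_ds ed)).
by rewrite opprB addrA.
Qed.

Lemma orbit_prod_subst0 : subst i 0 orbit_prod = 0.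
Proof.
case: add_ds => _ d0 _; rewrite rmorph_prod /= (big_rem 0) //=.
by rewrite subr0 substX eqxx mul0r.
Qed.

Lemma orbit_prod_neq0 : orbit_prod != 0.
Proof.
rewrite prodf_seq_neq0; apply/allP => d dd /=; apply/eqP => Xd.
(* If [X_i = d] with [d] free of [X_i], then substituting 1 gives [d = 1] and substituting 0 gives
   [d = 0]. *)
have := congr1 (subst i 1) Xd.
rewrite rmorphB /= substX eqxx (subst_free _ (free_ds dd)) rmorph0.
have := congr1 (subst i 0) Xd.
rewrite rmorphB /= substX eqxx free_ds // rmorph0 sub0r => /eqP.
by rewrite oppr_eq0 => /eqP->; rewrite subr0 => /eqP; rewrite oner_eq0.
Qed.

Lemma msize_orbit_prod : (1 < msize orbit_prod)%N.
Proof.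
rewrite ltnNge; apply/negP => /msize1_polyC E1; have := orbit_prod_subst0.
by rewrite E1 substC -E1 => /eqP; rewrite (negPf orbit_prod_neq0).
Qed.

Lemma subst_orbit_prod_inj p : subst i orbit_prod p = 0 -> p = 0.
Proof.
apply: (@comp_mpoly_inj _ _ _ (subst i 0) i) => [|q].
  by rewrite tnth_mktuple eqxx orbit_prod_neq0.
rewrite -/(subst i orbit_prod q) => q0; rewrite -[RHS]q0.
pose g : {rmorphism {mpoly K[n]} -> {mpoly K[n]}} := subst i 0 \o subst i orbit_prod.
apply: (@mpoly_rmorph_ext _ _ _ (subst i 0) g) => [c|j] /=.
  by rewrite !substC.
rewrite !substX; case: eqP => [_|/eqP ji]; first by rewrite orbit_prod_subst0.
by rewrite substX (negPf ji).
Qed.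

(** An invariant [f] takes the same value at [X_i = d] as at [X_i = 0], so [f - subst i 0 f] is
    [orbit_prod] times a quotient, which is again invariant. *)
Lemma translation_invariants f :
  {in ds, forall d, subst i ('X_i + d) f = f} <-> exists p, f = subst i orbit_prod p.
Proof.
split; last first.
  case=> p -> d dd.
  pose g : {rmorphism {mpoly K[n]} -> {mpoly K[n]}} :=
    subst i ('X_i + d) \o subst i orbit_prod.
  apply: (@mpoly_rmorph_ext _ _ _ g (subst i orbit_prod)) => [c|j] /=.
    by rewrite !substC.
  rewrite !substX; case: eqP => [_|/eqP ji]; first by rewrite orbit_prod_shift.
  by rewrite substX (negPf ji).
pose S f := {in ds, forall d, subst i ('X_i + d) f = f}.
move: f; apply: (@generation_by_division _ _ S _ _ 'X_i).
  by rewrite comp_mpolyX_tnth tnth_mktuple eqxx msize_orbit_prod.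
move=> f Sf; exists (subst i 0 f); rewrite -/(subst i orbit_prod _) subst_idem.
  apply: msize_comp_le => j; rewrite tnth_mktuple.
  by case: ifP; rewrite ?mmeasure0 // msizeX mdeg1.
have [|||g Eg] := @prod_subst_eq0_dvd _ _ i ds (f - subst i 0 f).
- by case: add_ds.
- exact: free_ds.
- move=> d dd; rewrite rmorphB /= subst_idem -{1}[d]add0r.
  by rewrite -(subst_shift_comp _ _ (free_ds dd)) (Sf d dd) subrr.
exists g; last first.
  by rewrite comp_mpolyX_tnth tnth_mktuple eqxx -Eg addrC subrK.
move=> d dd; apply: (mulfI orbit_prod_neq0).
have Ed : subst i ('X_i + d) (orbit_prod * g) = orbit_prod * g.
  by rewrite -Eg rmorphB /= (Sf d dd) subst_idem.
by rewrite -[RHS]Ed rmorphM /= (orbit_prod_shift dd).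
Qed.

End Translations.

Definition i0 : 'I_3 := @Ordinal 3 0 isT.
Definition i1 : 'I_3 := @Ordinal 3 1 isT.
Definition i2 : 'I_3 := @Ordinal 3 2 isT.

Lemma ord3P (P : 'I_3 -> Prop) : P i0 -> P i1 -> P i2 -> forall i, P i.
Proof.
move=> P0 P1 P2 [[|[|[|//]]] lt_i].
- by rewrite (_ : Ordinal lt_i = i0) //; apply: val_inj.
- by rewrite (_ : Ordinal lt_i = i1) //; apply: val_inj.
- by rewrite (_ : Ordinal lt_i = i2) //; apply: val_inj.
Qed.

Lemma big_ord3 (V : Type) (idx : V) (op : Monoid.law idx) (F : 'I_3 -> V) :
  \big[op/idx]_(i < 3) F i = op (op (F i0) (F i1)) (F i2).
Proof.
rewrite !big_ord_recl big_ord0 Monoid.mulm1 Monoid.mulmA.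
have e0 : ord0 = i0 by apply: val_inj.
have e1 : lift ord0 ord0 = i1 by apply: val_inj.
have e2 : lift ord0 (lift ord0 ord0) = i2 by apply: val_inj.
by rewrite e2 e1 e0.
Qed.

Notation X0 := ('X_i0 : {mpoly _[3]}).
Notation X1 := ('X_i1 : {mpoly _[3]}).
Notation X2 := ('X_i2 : {mpoly _[3]}).

Section Comp3.

Variable K : comNzRingType.
Implicit Types (p : {mpoly K[3]}).

Lemma comp3X n (u v w : {mpoly K[n]}) :
  ((X0 \mPo [tuple u; v; w] = u) * (X1 \mPo [tuple u; v; w] = v)
   * (X2 \mPo [tuple u; v; w] = w))%type.
Proof. by split; [split|]; rewrite comp_mpolyXU. Qed.

Lemma comp3A n k p (u v w : {mpoly K[n]}) (t : n.-tuple {mpoly K[k]}) :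
  (p \mPo [tuple u; v; w]) \mPo t = p \mPo [tuple u \mPo t; v \mPo t; w \mPo t].
Proof.
rewrite comp_mpolyA; apply: comp_mpoly_ext => i; rewrite tnth_mktuple.
by elim/ord3P: i; rewrite !(tnth_nth 0).
Qed.

Lemma comp3_id p : p \mPo [tuple X0; X1; X2] = p.
Proof. by apply: comp_mpoly_var; elim/ord3P; rewrite (tnth_nth 0). Qed.

Lemma subst_comp3 p d :
  ((subst i0 d p = p \mPo [tuple d; X1; X2])
   * (subst i1 d p = p \mPo [tuple X0; d; X2]))%type.
Proof.
split; apply: comp_mpoly_ext; elim/ord3P; rewrite tnth_mktuple (tnth_nth 0) //=.
Qed.

Lemma comp_mpolyM n p q (s : 3.-tuple {mpoly K[n]}) :
  (p * q) \mPo s = (p \mPo s) * (q \mPo s).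
Proof. exact: rmorphM. Qed.

Lemma comp_mpoly_exp n p k (s : 3.-tuple {mpoly K[n]}) :
  (p ^+ k) \mPo s = (p \mPo s) ^+ k.
Proof. exact: rmorphXn. Qed.

Definition comp3E := (comp3X, comp_mpolyB, comp_mpolyD, comp_mpolyN, comp_mpolyM,
  comp_mpoly_exp, comp_mpolyZ, comp_mpolyC).

End Comp3.

(** * Additive polynomials *)

Section AdditivePoly.

Variables (A : idomainType) (s : seq A).
Hypothesis add_s : additive_seq s.

(* [E (Y + u) - E Y - E u] has degree less than [size s] and vanishes on [s]. *)
Lemma prod_additive (y u : A) :
  \prod_(d <- s) (y + u - d) = \prod_(d <- s) (y - d) + \prod_(d <- s) (u - d).
Proof.
pose E := \prod_(d <- s) ('X - d%:P).
pose F := \prod_(d <- [seq d - u | d <- s]) ('X - d%:P).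
have hE x : E.[x] = \prod_(d <- s) (x - d).
  by rewrite horner_prod; apply: eq_bigr => d _; rewrite !hornerE.
have hF x : F.[x] = \prod_(d <- s) (x + u - d).
  rewrite horner_prod big_map; apply: eq_bigr => d _.
  by rewrite !hornerE opprB addrA.
have sE : size E = (size s).+1 by rewrite size_prod_XsubC.
have sF : size F = (size s).+1 by rewrite size_prod_XsubC size_map.
pose G := F - E - (E.[u])%:P.
suff G0 : G = 0.
  have := congr1 (horner^~ y) G0; rewrite !hornerE hF !hE => /eqP.
  by rewrite subr_eq0 subr_eq [X in _ == X]addrC => /eqP ->.
have s1 : (0 < size s)%N by case: add_s; case: (s).
apply/eqP/negPn/negP => nG0.
have : (size s < size G)%N.
  apply: max_poly_roots => //; last by case: add_s.
  apply/allP => d ds; rewrite /root !hornerE.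
  have E0 : E.[d] = 0 by apply/eqP; rewrite -/(root _ _) root_prod_XsubC.
  rewrite E0 subr0 subr_eq0 hF hE.
  rewrite -[X in _ == X](perm_big _ (perm_additive_seq add_s ds)) big_map.
  by apply/eqP/eq_bigr => e _; rewrite opprB [RHS]addrCA addrA.
apply/negP; rewrite -leqNgt; apply: leq_trans (size_polyD _ _) _.
rewrite size_polyN geq_max (leq_trans (size_polyC_leq1 _) s1) andbT.
(* [E] and [F] are monic of the same degree [size s], so their leading terms cancel. *)
apply/leq_sizeP => j; rewrite leq_eqVlt coefB => /orP[/eqP <-|sj].
  have /monicP := monic_prod_XsubC s xpredT id.
  have /monicP := monic_prod_XsubC [seq d - u | d <- s] xpredT id.
  by rewrite /lead_coef -/E -/F sE sF /= => -> ->; rewrite subrr.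
by rewrite !nth_default ?sE ?sF ?subrr.
Qed.

Lemma prod_additiveN (y : A) : \prod_(d <- s) (y + d) = \prod_(d <- s) (y - d).
Proof.
have [us s0 sB] := add_s; rewrite [RHS](perm_big [seq - d | d <- s]) /=.
  by rewrite big_map; under [RHS]eq_bigr do rewrite opprK.
apply: uniq_perm => //; first by rewrite map_inj_uniq //; apply: oppr_inj.
move=> x; have -> : (x \in [seq - d | d <- s]) = (- x \in s).
  by rewrite -{1}[x]opprK mem_map //; apply: oppr_inj.
apply/idP/idP => [|/(additive_seqN add_s)]; first exact: additive_seqN.
by rewrite opprK.
Qed.

End AdditivePoly.

(** * Groups of translations along [X2], compatibly with a scaling of [X2] *)

Section HyperplaneGroup.

Variable K : fieldType.
Variables (Om k0 : seq K).
Hypothesis add_k0 : additive_seq k0.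
Hypothesis Om_neq0 : {in Om, forall w, w != 0}.
Hypothesis Om_k0 : {in Om & k0, forall w c, w * c \in k0}.
Hypothesis one_k0 : 1 \in k0.
Hypothesis k0_ind : forall P : K -> Prop, P 0 ->
  (forall x y, P x -> P y -> P (x - y)) -> {in Om, forall w, P w} ->
  {in k0, forall c, P c}.

Notation trans b c := [tuple X0 + b *: X2; X1 + c *: X2; X2].

Lemma perm_Om_k0 w : w \in Om -> perm_eq [seq w * c | c <- k0] k0.
Proof.
move=> wO; case: add_k0 => uk _ _.
have uw : uniq [seq w * c | c <- k0].
  by rewrite map_inj_uniq // => x y; apply/mulfI/Om_neq0.
apply: uniq_perm => //; have [||] // := uniq_min_size uw (s2 := k0).
  by move=> _ /mapP[c ck ->]; apply: Om_k0.
by rewrite size_map.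
Qed.

(** Fermat's argument: multiplication by [w] permutes the nonzero elements of [k0]; compare their
    products. *)
Lemma Om_expr_size w : w \in Om -> w ^+ size k0 = w.
Proof.
move=> wO; case: (add_k0) => uk z0 _.
have P0 : \prod_(c <- k0 | c != 0) c != 0.
  by rewrite prodf_seq_neq0; apply/allP => c _; apply/implyP.
have := perm_big (op := *%R) (x := 1) _ (perm_Om_k0 wO) (P := fun c => c != 0) (F := id).
rewrite big_map; under eq_bigl => c do rewrite mulf_eq0 (negPf (Om_neq0 wO)) /=.
rewrite big_split /= big_const_seq iter_mulr_1.
rewrite -[RHS]mul1r => /(mulIf P0).
have <- : (count (fun c => c != 0%R) k0).+1 = size k0.
  by rewrite -(count_predC (pred1 0%R) k0) count_uniq_mem // z0.
by rewrite exprS => ->; rewrite mulr1.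
Qed.

(* Translating F1 by b, c in X0, X1 changes it by al b c *: X2 ^+ q with al additive. The
   first two generators of the invariants keep this form when a line k0 h of translations
   is added: a multiple of one generator is subtracted from the other so that h fixes it,
   and the first is replaced by the product of its translates. *)
Definition chain_gen (F1 : {mpoly K[3]}) q (al : K -> K -> K) :=
  [/\ (0 < q)%N, {in Om, forall w, w ^+ q = w},
      forall b c, F1 \mPo trans b c = F1 + al b c *: X2 ^+ q,
      (forall b c b' c', al (b - b') (c - c') = al b c - al b' c')
      /\ {in Om, forall w b c, al (w * b) (w * c) = w * al b c}
    & {in Om, forall w, F1 \mPo [tuple X0; X1; w *: X2] = F1}].

Definition trans_inv (hs : seq (K * K)) (f : {mpoly K[3]}) :=
  {in hs, forall h, {in k0, forall c, f \mPo trans (c * h.1) (c * h.2) = f}}.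

Definition chain_ring hs (F1 F2 : {mpoly K[3]}) :=
  (forall p, p \mPo [tuple F1; F2; X2] = 0 -> p = 0) /\
  (forall f, trans_inv hs f <-> exists p : {mpoly K[3]}, f = p \mPo [tuple F1; F2; X2]).

(** The factor [X2 ^+ (q2 - q1)] brings both increments to the same power of [X2]. Scaling by [w]
    fixes it because [w ^+ q1 = w = w ^+ q2]. *)
Lemma chain_gen_sub F1 F2 q1 q2 al1 al2 k :
  chain_gen F1 q1 al1 -> chain_gen F2 q2 al2 -> (q1 <= q2)%N ->
  chain_gen (F2 - (k *: X2 ^+ (q2 - q1)) * F1) q2 (fun b c => al2 b c - k * al1 b c).
Proof.
move=> [q1_gt0 w1 T1 [A1 L1] D1] [q2_gt0 w2 T2 [A2 L2] D2] q12; split=> //.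
- move=> b c; rewrite !comp3E T1 T2 scalerBl mulrDr opprD addrACA; congr (_ + (_ - _)).
  by rewrite -scalerAl -scalerAr -exprD subnK // scalerA.
- split=> [b c b' c'|w wO b c].
    by rewrite A1 A2; ring.
  by rewrite L1 // L2 // mulrBr mulrCA.
- move=> w wO; rewrite !comp3E (D1 _ wO) (D2 _ wO) exprZn scalerA.
  suff -> : w ^+ (q2 - q1) = 1 by rewrite mulr1.
  have := w2 _ wO; rewrite -{1}(subnK q12) exprD w1 // -[RHS]mul1r.
  exact/mulIf/Om_neq0.
Qed.

Lemma chain_ring_sub hs F1 F2 k e :
  chain_ring hs F1 F2 -> chain_ring hs F1 (F2 - (k *: X2 ^+ e) * F1).
Proof.
case=> inj gen.
pose t := [tuple X0; X1 - (k *: X2 ^+ e) * X0; X2] : 3.-tuple {mpoly K[3]}.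
pose t' := [tuple X0; X1 + (k *: X2 ^+ e) * X0; X2] : 3.-tuple {mpoly K[3]}.
have tt' p : (p \mPo t') \mPo t = p.
  by rewrite comp3A !comp3E subrK comp3_id.
have t't p : (p \mPo t) \mPo t' = p.
  by rewrite comp3A !comp3E addrK comp3_id.
have tE p : p \mPo [tuple F1; F2 - (k *: X2 ^+ e) * F1; X2]
           = (p \mPo t) \mPo [tuple F1; F2; X2].
  by rewrite comp3A !comp3E.
split=> [p|f].
  by rewrite tE => /inj pt; rewrite -(t't p) pt rmorph0.
rewrite gen; split=> [] [p ->].
  by exists (p \mPo t'); rewrite tE tt'.
by exists (p \mPo t); rewrite tE.
Qed.

Lemma chain_ring_swap hs F1 F2 : chain_ring hs F1 F2 -> chain_ring hs F2 F1.
Proof.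
case=> inj gen; pose t := [tuple X1; X0; X2] : 3.-tuple {mpoly K[3]}.
have tt p : (p \mPo t) \mPo t = p by rewrite comp3A !comp3E comp3_id.
have tE p : p \mPo [tuple F2; F1; X2] = (p \mPo t) \mPo [tuple F1; F2; X2].
  by rewrite comp3A !comp3E.
split=> [p|f].
  by rewrite tE => /inj pt; rewrite -(tt p) pt rmorph0.
rewrite gen; split=> [] [p ->]; exists (p \mPo t); rewrite tE ?tt //.
Qed.

Definition k0_prod (y : {mpoly K[3]}) q d := \prod_(c <- k0) (y - (c * d) *: X2 ^+ q).

Lemma additive_seq_map (V V' : zmodType) (g : V -> V') (s : seq V) :
  injective g -> {morph g : x y / x - y} -> additive_seq s ->
  additive_seq (map g s).
Proof.
move=> inj_g gB [us s0 sB]; split.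
- by rewrite map_inj_uniq.
- by apply/mapP; exists 0; rewrite ?s0 // -[X in g X](subrr 0) gB subrr.
- by move=> _ _ /mapP[x xs ->] /mapP[y ys ->]; rewrite -gB map_f ?sB.
Qed.

Lemma X2_exp_neq0 q : X2 ^+ q != 0 :> {mpoly K[3]}.
Proof. by rewrite expf_neq0 // -(mmeasure_poly_eq0 mdeg) msizeX. Qed.

Lemma additive_k0_X q d : d != 0 ->
  additive_seq [seq (c * d) *: X2 ^+ q : {mpoly K[3]} | c <- k0].
Proof.
move=> d0; apply: additive_seq_map => // [c c'|c c'].
  move/eqP; rewrite -subr_eq0 -scalerBl scaler_eq0 (negPf (X2_exp_neq0 q)) orbF.
  by rewrite subr_eq0 => /eqP/(mulIf d0).
by rewrite mulrBl scalerBl.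
Qed.

(** The product is an additive polynomial applied to [F1], so its increment is that polynomial
    applied to the increment of [F1]; its degree [size k0] multiplies [q]. *)
Lemma chain_gen_prod F1 q al d :
  d != 0 -> chain_gen F1 q al ->
  chain_gen (k0_prod F1 q d) (q * size k0)
            (fun b c => \prod_(x <- k0) (al b c - x * d)).
Proof.
move=> d0 [q_gt0 wq T1 [A1 L1] D1].
have s0 : (0 < size k0)%N by case: add_k0; case: (k0).
have add_kd : additive_seq [seq c * d | c <- k0].
  apply: additive_seq_map => // [c c' /(mulIf d0)//|c c'].
  by rewrite mulrBl.
split.
- by rewrite muln_gt0 q_gt0.
- by move=> w wO; rewrite exprM wq // Om_expr_size.
- move=> b c; rewrite rmorph_prod /=.
  under eq_bigr do rewrite !comp3E T1.
  have := prod_additive (additive_k0_X q d0) F1 (al b c *: X2 ^+ q).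
  rewrite !big_map => ->; congr (_ + _).
  under eq_bigr do rewrite -scalerBl.
  rewrite scaler_prod; congr (_ *: _).
  by rewrite big_const_seq count_predT iter_mulr_1 exprM.
- split=> [b c b' c'|w wO b c].
    have := prod_additive add_kd (al b c - al b' c') (al b' c').
    rewrite subrK !big_map A1 => ->; by rewrite addrK.
  rewrite L1 // -(perm_big _ (perm_Om_k0 wO)) big_map.
  under eq_bigr do rewrite -mulrA -mulrBr.
  rewrite big_split /= big_const_seq count_predT iter_mulr_1 Om_expr_size //.
- move=> w wO; rewrite rmorph_prod /=.
  under eq_bigr do rewrite !comp3E (D1 _ wO) exprZn (wq _ wO) scalerA mulrAC [_ * w]mulrC.
  by rewrite /k0_prod -[RHS](perm_big _ (perm_Om_k0 wO)) big_map.
Qed.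

(** Homogeneity is postulated for [Om] alone; additivity of [al] extends it to the span. *)
Lemma chain_gen_k0 F1 q al : chain_gen F1 q al ->
  {in k0, forall c b b', al (c * b) (c * b') = c * al b b'}.
Proof.
case=> _ _ _ [A1 L1] _ c ck b b'; move: c ck.
apply: (@k0_ind (fun c => al (c * b) (c * b') = c * al b b')) => [|x y Px Py|w wO].
- by rewrite !mul0r; have := A1 0 0 0 0; rewrite subrr [RHS]subrr.
- by rewrite !mulrBl A1 Px Py.
- exact: L1.
Qed.

(** On polynomials in [F1, F2, X2] the translation along [c h] only adds [(c * d) *: X2 ^+ q1] to
    the first parameter, as [al2] vanishes on [h]; [translation_invariants] then applies to the
    parameters. *)
Lemma chain_ring_prod hs h F1 F2 q1 q2 al1 al2 :
  chain_gen F1 q1 al1 -> chain_gen F2 q2 al2 -> chain_ring hs F1 F2 ->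
  al1 h.1 h.2 != 0 -> al2 h.1 h.2 = 0 ->
  chain_ring (h :: hs) (k0_prod F1 q1 (al1 h.1 h.2)) F2.
Proof.
move=> g1 g2 [inj gen] d0 al20; set d := al1 h.1 h.2 in d0 *.
pose ds := [seq (c * d) *: X2 ^+ q1 : {mpoly K[3]} | c <- k0].
have add_ds : additive_seq ds by apply: additive_k0_X.
have free_ds : {in ds, forall e, subst i0 0 e = e}.
  by move=> _ /mapP[c _ ->]; rewrite !subst_comp3 !comp3E.
pose E := orbit_prod i0 ds.
have sE p : p \mPo [tuple k0_prod F1 q1 d; F2; X2] = subst i0 E p \mPo [tuple F1; F2; X2].
  rewrite subst_comp3 comp3A !comp3E /E /orbit_prod rmorph_prod /= big_map.
  by under eq_bigr do rewrite !comp3E.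
have hE p : {in k0, forall c,
    (p \mPo [tuple F1; F2; X2]) \mPo trans (c * h.1) (c * h.2)
    = subst i0 (X0 + (c * d) *: X2 ^+ q1) p \mPo [tuple F1; F2; X2]}.
  move=> c ck; rewrite subst_comp3 !comp3A !comp3E.
  have [_ _ -> _ _] := g1; have [_ _ -> _ _] := g2.
  by rewrite (chain_gen_k0 g1 ck) (chain_gen_k0 g2 ck) al20 mulr0 scale0r addr0.
split=> [p|f].
  by rewrite sE => /inj; apply: subst_orbit_prod_inj.
split=> [inv|[p ->]].
  have /gen[p Ep] : trans_inv hs f.
    by move=> h' hh; apply: inv; rewrite inE hh orbT.
  have /(translation_invariants add_ds free_ds)[r Er] :
      {in ds, forall e, subst i0 (X0 + e) p = p}.
    move=> _ /mapP[c ck ->]; apply/eqP; rewrite -subr_eq0; apply/eqP/inj.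
    by rewrite comp_mpolyB -hE // -Ep inv ?subrr ?mem_head.
  by exists r; rewrite sE -Er.
have inv_hs : trans_inv hs (p \mPo [tuple k0_prod F1 q1 d; F2; X2]).
  by apply/gen; eexists; apply: sE.
move=> h'; rewrite inE => /orP[/eqP -> c ck|]; last exact: inv_hs.
rewrite sE (hE _ _ ck); congr comp_mpoly.
have inv_p : {in ds, forall e, subst i0 (X0 + e) (subst i0 E p) = subst i0 E p}.
  by apply/(translation_invariants add_ds free_ds); exists p.
exact/inv_p/map_f.
Qed.

Lemma chain_exists hs : exists F1 F2 q1 q2 al1 al2,
  [/\ chain_gen F1 q1 al1, chain_gen F2 q2 al2 & chain_ring hs F1 F2].
Proof.
elim: hs => [|h hs [F1 [F2 [q1 [q2 [al1 [al2 [g1 g2 gen]]]]]]]].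
  exists X0, X1, 1%N, 1%N, (fun b c => b), (fun b c => c); split.
  - by split=> // [b c|w _]; rewrite ?comp3E.
  - by split=> // [b c|w _]; rewrite ?comp3E.
  - split=> [p|f]; first by rewrite comp3_id.
    by split=> // _; exists f; rewrite comp3_id.
(* With both increments zero the line fixes both generators; with one nonzero, that generator is
   replaced by its product; with both nonzero, the generator of larger exponent is first corrected
   by a multiple of the other. *)
have [d10|d1] := eqVneq (al1 h.1 h.2) 0; have [d20|d2] := eqVneq (al2 h.1 h.2) 0.
- exists F1, F2, q1, q2, al1, al2; split=> //; case: gen => inj gen; split=> // f.
  split=> [inv|/gen inv].
    by apply/gen => h' hh; apply: inv; rewrite inE hh orbT.
  move=> h'; rewrite inE => /orP[/eqP -> c ck|]; last exact: inv.
  case/gen: inv => p ->; rewrite comp3A !comp3E.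
  have [_ _ -> _ _] := g1; have [_ _ -> _ _] := g2.
  rewrite (chain_gen_k0 g1 ck) (chain_gen_k0 g2 ck) d10 d20 mulr0.
  by rewrite !scale0r !addr0.
- do 6 eexists; split; last first.
  + by apply: (chain_ring_prod g2 g1) => //; apply: chain_ring_swap.
  + exact: g1.
  + exact: chain_gen_prod d2 g2.
- do 6 eexists; split; last first.
  + exact: (chain_ring_prod g1 g2).
  + exact: g2.
  + exact: chain_gen_prod d1 g1.
wlog q12 : F1 F2 q1 q2 al1 al2 g1 g2 gen d1 d2 / (q1 <= q2)%N.
  have [q12|/ltnW q21] := leqP q1 q2; first by move=> W; apply: (W F1 F2 q1 q2 al1 al2).
  by move=> W; apply: (W F2 F1 q2 q1 al2 al1) => //; apply: chain_ring_swap.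
have g2' := chain_gen_sub (al2 h.1 h.2 / al1 h.1 h.2) g1 g2 q12.
do 6 eexists; split; last first.
- apply: (chain_ring_prod g1 g2') => //; last by rewrite divfK ?subrr.
  exact: chain_ring_sub.
- exact: g2'.
- exact: chain_gen_prod d1 g1.
Qed.

Lemma hyperplane_group_invariants (V : seq (K * K)) :
  {in V & k0, forall v c, (c * v.1, c * v.2) \in V} ->
  exists F1 F2 : {mpoly K[3]},
  [/\ {in Om, forall w, F1 \mPo [tuple X0; X1; w *: X2] = F1
                     /\ F2 \mPo [tuple X0; X1; w *: X2] = F2},
      forall p, p \mPo [tuple F1; F2; X2] = 0 -> p = 0
    & forall f, {in V, forall v, f \mPo trans v.1 v.2 = f} <->
        exists p : {mpoly K[3]}, f = p \mPo [tuple F1; F2; X2]].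
Proof.
move=> kV; have [F1 [F2 [q1 [q2 [al1 [al2 [g1 g2 [inj gen]]]]]]]] := chain_exists V.
exists F1, F2; split=> // [w wO|f].
  by have [_ _ _ _ D1] := g1; have [_ _ _ _ D2] := g2; rewrite (D1 _ wO) (D2 _ wO).
rewrite -gen; split=> [inv v vV c ck|inv v vV].
  exact: (inv (c * v.1, c * v.2) (kV _ _ vV ck)).
by have := inv v vV 1 one_k0; rewrite !mul1r.
Qed.

End HyperplaneGroup.

(** * Triangular groups in coordinates *)

Notation unip a b c := [tuple X0 + (a *: X1 + b *: X2); X1 + c *: X2; X2].
Notation diag3 x y z := [tuple x *: X0; y *: X1; z *: X2].

Lemma additive_seq_group (V : zmodType) (gT : finGroupType) (H : {group gT})
    (g : gT -> V) : {in H &, {morph g : x y / (x * y)%g >-> x + y}} ->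
  {in H &, injective g} -> additive_seq [seq g h | h <- enum H].
Proof.
move=> gM inj_g.
have g1 : g 1%g = 0.
  by apply: (addrI (g 1%g)); rewrite -gM // mulg1 addr0.
have gV x : x \in H -> g x^-1%g = - g x.
  by move=> xH; apply: (addrI (g x)); rewrite -gM ?groupV // mulgV g1 subrr.
split.
- by rewrite map_inj_in_uniq ?enum_uniq // => x y; rewrite !mem_enum; apply: inj_g.
- by apply/mapP; exists 1%g; rewrite ?mem_enum.
- move=> _ _ /mapP[x xH ->] /mapP[y yH ->]; rewrite !mem_enum in xH yH.
  by rewrite -gV // -gM ?groupV // map_f // mem_enum groupM ?groupV.
Qed.

Lemma big_enum_seq (V : Type) (idx : V) (op : Monoid.com_law idx) (U : Type)
    (gT : finGroupType) (H : {group gT}) (g : gT -> U) (F : U -> V) :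
  \big[op/idx]_(d <- [seq g h | h <- enum H]) F d = \big[op/idx]_(h in H) F (g h).
Proof. by rewrite big_map big_enum. Qed.

(* A polynomial f is composed with the linear substitution given by the matrix of a group
   element: [[1, a, b], [0, 1, c], [0, 0, 1]] for h in H, diag (t0, t1, t2) for x in T. *)
Section Triangular.

Variables (K : fieldType) (gT : finGroupType) (H T : {group gT}).
Variables (a b c t0 t1 t2 : gT -> K).

Definition coord_inv (f : {mpoly K[3]}) :=
  {in H, forall h, f \mPo unip (a h) (b h) (c h) = f} /\
  {in T, forall x, f \mPo diag3 (t0 x) (t1 x) (t2 x) = f}.

Definition coord_refl x := [|| (t1 x == 1) && (t2 x == 1),
  (t0 x == 1) && (t2 x == 1) | (t0 x == 1) && (t1 x == 1)].

(** The rules [aJ], [bJ], [cJ] compare the entries of [h x] and of [x (h ^ x)], which avoids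
    inverting diagonal entries. The identity counts as a [coord_refl] in [genT]. *)
Record triangular_data : Prop := TriangularData {
  aM : {in H &, {morph a : x y / (x * y)%g >-> x + y}};
  cM : {in H &, {morph c : x y / (x * y)%g >-> x + y}};
  bM : {in H &, forall x y, b (x * y)%g = b x + b y + a x * c y};
  abc_inj : {in H &, forall x y, a x = a y -> b x = b y -> c x = c y -> x = y};
  t0M : {in T &, {morph t0 : x y / (x * y)%g >-> x * y}};
  t1M : {in T &, {morph t1 : x y / (x * y)%g >-> x * y}};
  t2M : {in T &, {morph t2 : x y / (x * y)%g >-> x * y}};
  t_neq0 : {in T, forall x, [/\ t0 x != 0, t1 x != 0 & t2 x != 0]};
  nHT : T \subset 'N(H)%g;
  aJ : {in T & H, forall x h, t0 x * a (h ^ x)%g = t1 x * a h};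
  bJ : {in T & H, forall x h, t0 x * b (h ^ x)%g = t2 x * b h};
  cJ : {in T & H, forall x h, t1 x * c (h ^ x)%g = t2 x * c h};
  genT : <<[set x in T | coord_refl x]>>%g = T
}.

Hypothesis D : triangular_data.

Lemma t0_1 : t0 1%g = 1.
Proof.
have [n0 _ _] := t_neq0 D (group1 T).
by apply: (mulfI n0); rewrite -(t0M D) // mulg1 mulr1.
Qed.

Lemma t1_1 : t1 1%g = 1.
Proof.
have [_ n0 _] := t_neq0 D (group1 T).
by apply: (mulfI n0); rewrite -(t1M D) // mulg1 mulr1.
Qed.

Lemma t2_1 : t2 1%g = 1.
Proof.
have [_ _ n0] := t_neq0 D (group1 T).
by apply: (mulfI n0); rewrite -(t2M D) // mulg1 mulr1.
Qed.

Lemma genT_ind (P : gT -> Prop) : P 1%g ->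
  (forall x y, x \in T -> y \in T -> P x -> P y -> P (x * y)%g) ->
  (forall x, x \in T -> coord_refl x -> P x) -> {in T, forall x, P x}.
Proof.
move=> P1 PM Pr x; rewrite -{1}(genT D) => /gen_prodgP[n [s sT ->]].
suff [] : (\prod_(i < n) s i)%g \in T /\ P (\prod_(i < n) s i)%g by [].
apply: (big_ind (fun y => y \in T /\ P y)) => [|y z [yT Py] [zT Pz]|i _].
- by rewrite group1.
- by rewrite groupM //; split=> //; apply: PM.
- by move: (sT i); rewrite inE => /andP[siT ri]; split=> //; apply: Pr.
Qed.

(** Testing only on reflections, which generate [T], leaves at most one weight different from 1, as
    [polynomial_subring_weights] requires. *)
Lemma coord_invP f : coord_inv f <->
  {in H, forall h, f \mPo unip (a h) (b h) (c h) = f} /\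
  {in [set x in T | coord_refl x],
     forall x, f \mPo diag3 (t0 x) (t1 x) (t2 x) = f}.
Proof.
split=> [[invH invT]|[invH invT]]; split=> //.
  by move=> x; rewrite inE => /andP[xT _]; apply: invT.
apply: genT_ind => [|x y xT yT Ex Ey|x xT rx].
- by rewrite t0_1 t1_1 t2_1 !scale1r comp3_id.
- rewrite (t0M D xT yT) (t1M D xT yT) (t2M D xT yT) -{2}Ey -{2}Ex comp3A !comp3E.
  by rewrite !scalerA.
- by apply: invT; rewrite inE xT.
Qed.

Definition orbitX0 := \prod_(h in H) (X0 + (a h *: X1 + b h *: X2)) : {mpoly K[3]}.

Lemma orbitX0_unip k : k \in H ->
  orbitX0 \mPo unip (a k) (b k) (c k) = orbitX0.
Proof.
move=> kH; rewrite /orbitX0 rmorph_prod /=.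
rewrite [RHS](reindex_inj (mulIg k)) /=; apply: eq_big => [h|h hH].
  by rewrite groupMr.
rewrite !comp3E (aM D hH kH) (bM D hH kH) scalerDr !scalerDl scalerA.
ring.
Qed.

(** By the conjugation rules, [x] sends the factor of [h] to [t0 x] times the factor of [h ^ x]. *)
Lemma orbitX0_diag x : x \in T ->
  orbitX0 \mPo diag3 (t0 x) (t1 x) (t2 x) = t0 x ^+ #|H| *: orbitX0.
Proof.
move=> xT; rewrite /orbitX0 rmorph_prod /=.
rewrite -prodr_const -scaler_prod [RHS](reindex_inj (conjg_inj x)) /=.
apply: eq_big => [h|h hH].
  by rewrite memJ_norm // (subsetP (nHT D)).
rewrite !comp3E !scalerDr !scalerA (aJ D) // (bJ D) //.
by rewrite [t1 x * _]mulrC [t2 x * _]mulrC.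
Qed.

Lemma t_exp x : x \in T -> [/\ t0 x ^+ #|T| = 1, t1 x ^+ #|T| = 1 & t2 x ^+ #|T| = 1].
Proof.
move=> xT; have xn n (t : gT -> K) : t 1%g = 1 -> {in T &, {morph t : x y / (x * y)%g >-> x * y}} ->
    t x ^+ n = t (x ^+ n)%g.
  move=> t_1 tM; elim: n => [|n IH]; first by rewrite expr0 expg0.
  by rewrite exprS expgS IH tM ?groupX.
have m0 := t0M D; have m1 := t1M D; have m2 := t2M D.
by split; [rewrite (xn _ _ t0_1 m0)|rewrite (xn _ _ t1_1 m1)|rewrite (xn _ _ t2_1 m2)];
   rewrite expg_cardG // ?t0_1 ?t1_1 ?t2_1.
Qed.

End Triangular.

(** * The cases [c = 0] and [a = 0] *)

Section PolynomialCases.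

Variables (K : fieldType) (gT : finGroupType) (H T : {group gT}).
Variables (a b c t0 t1 t2 : gT -> K).
Hypothesis D : triangular_data H T a b c t0 t1 t2.
Notation coord_inv := (coord_inv H T a b c t0 t1 t2).
Notation L := (orbitX0 H a b).

Lemma row_inj : {in H &, forall x y, a x *: X1 + b x *: X2 = a y *: X1 + b y *: X2 :> {mpoly K[3]} ->
  a x = a y /\ b x = b y}.
Proof.
move=> x y xH yH E; split.
  by have := congr1 (mcoeff U_(i1)) E; rewrite !mcoeffD !mcoeffZ !mcoeffXU /=
    !mulr1 !mulr0 !addr0.
by have := congr1 (mcoeff U_(i2)) E; rewrite !mcoeffD !mcoeffZ !mcoeffXU /=
    !mulr1 !mulr0 !add0r.
Qed.

Definition coord_weights (u v w : gT -> K) x (i : 'I_3) : K :=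
  tnth [tuple u x; v x; w x] i.

(** Passes from [H] to the whole group: [T] acts on the polynomial ring in [F1, F2, F3] by the
    weights [u, v, w], and its reflections must still be reflections there. *)
Lemma polynomial_from_H (F1 F2 F3 : {mpoly K[3]}) (u v w : gT -> K) :
  (forall f, {in H, forall h, f \mPo unip (a h) (b h) (c h) = f} <->
     exists p : {mpoly K[3]}, f = p \mPo [tuple F1; F2; F3]) ->
  (forall p, p \mPo [tuple F1; F2; F3] = 0 -> p = 0) ->
  {in T, forall x, [/\ F1 \mPo diag3 (t0 x) (t1 x) (t2 x) = u x *: F1,
    F2 \mPo diag3 (t0 x) (t1 x) (t2 x) = v x *: F2
    & F3 \mPo diag3 (t0 x) (t1 x) (t2 x) = w x *: F3]} ->
  {in T, forall x, coord_refl t0 t1 t2 x -> [|| (v x == 1) && (w x == 1),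
    (u x == 1) && (w x == 1) | (u x == 1) && (v x == 1)]} ->
  {in T, forall x, [/\ u x ^+ #|T| = 1, v x ^+ #|T| = 1 & w x ^+ #|T| = 1]} ->
  polynomial_subring coord_inv.
Proof.
move=> HE inj eig refl ord.
apply: (@polynomial_subring_weights _ _ _ _ _ _ [set x in T | coord_refl t0 t1 t2 x]
  (fun x => comp_mpoly (diag3 (t0 x) (t1 x) (t2 x))) (coord_weights u v w) #|T|
  HE inj (coord_invP D)).
- by move=> x _ k /=; rewrite comp_mpolyC.
- move=> x; rewrite inE => /andP[xT _]; have [E1 E2 E3] := eig x xT.
  by elim/ord3P; rewrite /coord_weights !(tnth_nth 0).
- move=> x; rewrite inE => /andP[xT rx]; have r := refl x xT rx.
  by move=> i j; move: r; elim/ord3P: i; elim/ord3P: j; rewrite /coord_weights !(tnth_nth 0) //= => r n1 n2;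
    move: r; rewrite (negPf n1) (negPf n2) ?andbF.
- exact: cardG_gt0.
- move=> x; rewrite inE => /andP[xT rx]; have [E1 E2 E3] := ord x xT.
  by elim/ord3P; rewrite /coord_weights !(tnth_nth 0).
Qed.

Lemma free_lin u v : subst i0 0 (u *: X1 + v *: X2) = u *: X1 + v *: X2 :> {mpoly K[3]}.
Proof. by rewrite subst_comp3 !comp3E. Qed.

Lemma polynomial_c0 : {in H, forall h, c h = 0} -> polynomial_subring coord_inv.
Proof.
move=> c0.
pose g h : {mpoly K[3]} := a h *: X1 + b h *: X2.
have gM : {in H &, {morph g : x y / (x * y)%g >-> x + y}}.
  move=> x y xH yH; rewrite /g (aM D) // (bM D) // (c0 y yH) mulr0 addr0 !scalerDl.
  by rewrite addrACA.
have inj_g : {in H &, injective g}.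
  move=> x y xH yH /row_inj [] // ax bx; apply: (abc_inj D) => //.
  by rewrite !c0.
have add_ds := additive_seq_group gM inj_g; set ds := map _ _ in add_ds.
have free_ds : {in ds, forall d, subst i0 0 d = d}.
  by move=> _ /mapP[h _ ->]; apply: free_lin.
have LE : orbit_prod i0 ds = L.
  by rewrite /orbit_prod -(prod_additiveN add_ds) big_enum_seq.
have gE f h : h \in H -> f \mPo unip (a h) (b h) (c h) = subst i0 (X0 + g h) f.
  by move=> hH; rewrite subst_comp3 c0 // scale0r addr0.
apply: (@polynomial_from_H L X1 X2 (fun x => t0 x ^+ #|H|) t1 t2).
- move=> f; transitivity ({in ds, forall d, subst i0 (X0 + d) f = f}).
    split=> [inv _ /mapP[h hH ->]|inv h hH].
      by rewrite mem_enum in hH; rewrite -gE // inv.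
    by rewrite gE // inv // map_f ?mem_enum.
  rewrite translation_invariants // LE.
  by split=> [] [p ->]; exists p; rewrite subst_comp3.
- by move=> p; have := @subst_orbit_prod_inj _ _ _ _ add_ds free_ds p; rewrite LE subst_comp3.
- by move=> x xT; rewrite (orbitX0_diag D xT) !comp3E.
- move=> x xT /or3P[] /andP[/eqP-> /eqP->]; rewrite ?expr1n ?eqxx ?orbT //.
- move=> x xT; have [e0 e1 e2] := t_exp D xT.
  by rewrite -exprM mulnC exprM e0 expr1n.
Qed.

Definition row_a0 (f : {mpoly K[3]}) :=
  {in H, forall h, f \mPo [tuple X0 + b h *: X2; X1 + c h *: X2; X2] = f}.

Lemma unip_a0 : {in H, forall h, a h = 0} -> forall f, {in H, forall h,
    f \mPo unip (a h) (b h) (c h) = f} <-> row_a0 f.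
Proof.
move=> a0 f; split=> inv h hH; have := inv h hH; by rewrite a0 // scale0r add0r.
Qed.

(** The second hypothesis makes [H] the product of the subgroups [c = 0] and [b = 0], which
    translate [X0] and [X1] separately; the result on translations is used once for each
    variable. *)
Lemma polynomial_a0_split : {in H, forall h, a h = 0} ->
  {in H, forall h, exists2 h1, h1 \in H & b h1 = b h /\ c h1 = 0} ->
  polynomial_subring coord_inv.
Proof.
move=> a0 split_b.
have bMa : {in H &, {morph b : x y / (x * y)%g >-> x + y}}.
  by move=> x y xH yH; rewrite (bM D) // a0 // mul0r addr0.
have sub_group (u : gT -> K) : {in H &, {morph u : x y / (x * y)%g >-> x + y}} ->
    group_set [set h in H | u h == 0].
  move=> uM; apply/group_setP; split=> [|x y].
    rewrite inE group1 /=; apply/eqP/(addrI (u 1%g)).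
    by rewrite -uM // mulg1 addr0.
  rewrite !inE => /andP[xH /eqP ux] /andP[yH /eqP uy].
  by rewrite groupM //= uM // ux uy addr0.
pose H1 := Group (sub_group c (cM D)); pose H2 := Group (sub_group b bMa).
pose g1 h : {mpoly K[3]} := b h *: X2; pose g2 h : {mpoly K[3]} := c h *: X2.
have X2n0 : X2 != 0 :> {mpoly K[3]} by rewrite -(mmeasure_poly_eq0 mdeg) msizeX.
have sX2 (k l : K) : k *: X2 = l *: X2 :> {mpoly K[3]} -> k = l.
  move/eqP; rewrite -subr_eq0 -scalerBl scaler_eq0 (negPf X2n0) orbF subr_eq0.
  by move/eqP.
have add1 : additive_seq [seq g1 h | h <- enum H1].
  apply: additive_seq_group => x y; rewrite !inE => /andP[xH /eqP cx] /andP[yH /eqP cy].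
    by rewrite /g1 bMa // scalerDl.
  by move/sX2 => bxy; apply: (abc_inj D) => //; rewrite ?a0 // cx cy.
have add2 : additive_seq [seq g2 h | h <- enum H2].
  apply: additive_seq_group => x y; rewrite !inE => /andP[xH /eqP bx] /andP[yH /eqP by_].
    by rewrite /g2 (cM D) // scalerDl.
  by move/sX2 => cxy; apply: (abc_inj D) => //; rewrite ?a0 // bx by_.
set ds1 := map _ _ in add1; set ds2 := map _ _ in add2.
have free1 : {in ds1, forall d, subst i0 0 d = d}.
  by move=> _ /mapP[h _ ->]; rewrite subst_comp3 !comp3E.
have free2 : {in ds2, forall d, subst i1 0 d = d}.
  by move=> _ /mapP[h _ ->]; rewrite subst_comp3 !comp3E.
pose E1 := orbit_prod i0 ds1; pose E2 := orbit_prod i1 ds2.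
have E2free : E2 \mPo [tuple E1; X1; X2] = E2.
  rewrite /E2 /orbit_prod rmorph_prod /= !big_enum_seq; apply: eq_bigr => h _.
  by rewrite !comp3E.
have E1free d : E1 \mPo [tuple X0; d; X2] = E1.
  rewrite /E1 /orbit_prod rmorph_prod /= !big_enum_seq; apply: eq_bigr => h _.
  by rewrite !comp3E.
have sE p : p \mPo [tuple E1; E2; X2] = subst i0 E1 (subst i1 E2 p).
  by rewrite !subst_comp3 comp3A !comp3E E2free.
have HE f : row_a0 f <-> {in ds1, forall d, subst i0 (X0 + d) f = f} /\
                         {in ds2, forall d, subst i1 (X1 + d) f = f}.
  split=> [inv|[inv1 inv2] h hH].
    split=> _ /mapP[h hH ->]; move: hH; rewrite mem_enum inE => /andP[hH /eqP u0];
      by have := inv h hH; rewrite u0 scale0r addr0 subst_comp3.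
  have [h1 h1H [bh1 ch1]] := split_b h hH.
  have [h2 h2H hE] : exists2 h2, h2 \in H & h = (h1 * h2)%g.
    by exists (h1^-1 * h)%g; rewrite ?groupM ?groupV // mulKVg.
  have bh2 : b h2 = 0 by apply: (addrI (b h1)); rewrite -bMa // -hE addr0.
  have ch2 : c h2 = c h by rewrite hE (cM D) // ch1 add0r.
  have I1 : subst i0 (X0 + g1 h1) f = f.
    by apply/inv1/map_f; rewrite mem_enum inE h1H ch1 eqxx.
  have I2 : subst i1 (X1 + g2 h2) f = f.
    by apply/inv2/map_f; rewrite mem_enum inE h2H bh2 eqxx.
  rewrite -{2}I1 -{2}I2 !subst_comp3 comp3A !comp3E /g1 /g2 bh1 ch2.
  by [].
have m1 x h : x \in T -> (h ^ x \in H)%g = (h \in H).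
  by move=> xT; rewrite memJ_norm // (subsetP (nHT D)).
apply: (@polynomial_from_H E1 E2 X2 (fun x => t0 x ^+ #|H1|) (fun x => t1 x ^+ #|H2|) t2).
- move=> f; rewrite unip_a0 // HE; split=> [[inv1 inv2]|[p ->]].
    have [p Ep] := (translation_invariants add1 free1 f).1 inv1.
    (* Translations of [X1] fix [E1], so invariance of [f] passes to the parameter polynomial [p] by
       independence. *)
    have [|q Eq] := (translation_invariants add2 free2 p).1.
      move=> d dd; apply/eqP; rewrite -subr_eq0; apply/eqP.
      apply: (subst_orbit_prod_inj add1 free1); rewrite rmorphB /= -Ep.
      rewrite -[X in _ - X](inv2 d dd) Ep !subst_comp3 !comp3A !comp3E E1free.
      have [h _ ->] := mapP dd; rewrite !comp3E.
      by rewrite subrr.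
    by exists q; rewrite sE -Eq.
  rewrite sE; split.
    by apply/(translation_invariants add1 free1); eexists.
  move=> d dd; have -> : subst i0 E1 (subst i1 E2 p) = subst i1 E2 (subst i0 E1 p).
    by rewrite !subst_comp3 !comp3A !comp3E E2free E1free.
  by apply: (translation_invariants add2 free2 _).2 => //; eexists.
- move=> p; rewrite sE => /(subst_orbit_prod_inj add1 free1).
  exact: subst_orbit_prod_inj.
- move=> x xT; have [n0 n1 n2] := t_neq0 D xT; rewrite !comp3E; split=> //.
    rewrite /E1 /orbit_prod rmorph_prod /= !big_enum_seq -prodr_const -scaler_prod.
    rewrite [RHS](reindex_inj (conjg_inj x)) /=; apply: eq_big => [h|h].
      rewrite !inE m1 //; case hH: (h \in H) => //=.
      by rewrite -[RHS](mulrI_eq0 _ (lregP n1)) (cJ D) // mulrI_eq0 //; apply/lregP.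
    by rewrite inE => /andP[hH _]; rewrite !comp3E scalerBr /g1 !scalerA (bJ D) // mulrC.
  rewrite /E2 /orbit_prod rmorph_prod /= !big_enum_seq -prodr_const -scaler_prod.
  rewrite [RHS](reindex_inj (conjg_inj x)) /=; apply: eq_big => [h|h].
    rewrite !inE m1 //; case hH: (h \in H) => //=.
    by rewrite -[RHS](mulrI_eq0 _ (lregP n0)) (bJ D) // mulrI_eq0 //; apply/lregP.
  by rewrite inE => /andP[hH _]; rewrite !comp3E scalerBr /g2 !scalerA (cJ D) // mulrC.
- move=> x xT /or3P[] /andP[/eqP-> /eqP->]; rewrite ?expr1n ?eqxx ?orbT //.
- move=> x xT; have [e0 e1 e2] := t_exp D xT.
  by rewrite -!exprM ![(_ * #|T|)%N]mulnC !exprM e0 e1 !expr1n.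
Qed.

End PolynomialCases.

(** * The finite ring spanned by the values of a character *)

Section AdditiveSpan.

Variables (K : fieldType) (p : nat) (gT : finGroupType) (T : {group gT}) (u : gT -> K).
Hypothesis charK : p \in [pchar K].
Hypothesis uM : {in T &, {morph u : x y / (x * y)%g >-> x * y}}.
Hypothesis u1 : u 1%g = 1.

Let p_gt0 : (0 < p)%N. Proof. exact/prime_gt0/(pcharf_prime charK). Qed.

Definition comb (f : {ffun gT -> 'I_p}) := \sum_(x in T) u x *+ f x.

(** In characteristic [p] coefficients below [p] suffice, so the span is a finite list. *)
Definition additive_span : seq K := undup [seq comb f | f <- enum {ffun gT -> 'I_p}].

Lemma spanP k : reflect (exists f, k = comb f) (k \in additive_span).
Proof.
rewrite mem_undup; apply: (iffP mapP) => [[f _ ->]|[f ->]]; exists f => //.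
by rewrite mem_enum.
Qed.

Lemma mulrn_modp (k : K) m : k *+ (m %% p) = k *+ m.
Proof. by rewrite -mulr_natr (GRing.natr_mod_pchar charK) mulr_natr. Qed.

Lemma additive_span_seq : additive_seq additive_span.
Proof.
split; first exact: undup_uniq.
  apply/spanP; exists [ffun=> Ordinal p_gt0]; rewrite /comb big1 // => x _.
  by rewrite ffunE.
move=> _ _ /spanP[f ->] /spanP[g ->]; apply/spanP.
(* [p - g x] represents the opposite of [g x] modulo [p]. *)
exists [ffun x => Ordinal (ltn_pmod (f x + (p - g x)) p_gt0)].
rewrite /comb -sumrB; apply: eq_bigr => x _; rewrite ffunE /= mulrn_modp.
rewrite mulrnDr; congr (_ + _); apply: (addIr (u x *+ g x)).
rewrite addNr -mulrnDr subnK ?(ltnW (ltn_ord _)) //.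
by rewrite -mulr_natr (pcharf0 charK) mulr0.
Qed.

Lemma additive_span_ind (P : K -> Prop) : P 0 ->
  (forall x y, P x -> P y -> P (x - y)) -> {in [seq u x | x <- enum T], forall w, P w} ->
  {in additive_span, forall k, P k}.
Proof.
move=> P0 PB Pu _ /spanP[f ->].
have PD x y : P x -> P y -> P (x + y).
  by move=> Px Py; rewrite -[y]opprK -[- y]sub0r; do 2?apply: (PB) => //.
apply: (big_ind P) => // x xT; elim: (nat_of_ord _) => [|n IH]; first by rewrite mulr0n.
by rewrite mulrS; apply: PD => //; apply: Pu; rewrite map_f ?mem_enum.
Qed.

Lemma additive_span_mul :
  {in [seq u x | x <- enum T] & additive_span, forall w k, w * k \in additive_span}.
Proof.
move=> _ _ /mapP[y yT ->] /spanP[f ->]; rewrite mem_enum in yT.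
apply/spanP; exists [ffun x => f (y^-1 * x)%g]; rewrite /comb mulr_sumr.
rewrite [RHS](reindex_inj (mulgI y)) /=; apply: eq_big => [x|x xT].
  by rewrite groupMl.
by rewrite ffunE mulKg uM // mulrnAr.
Qed.

Lemma additive_span1 : 1 \in additive_span.
Proof.
apply/spanP; exists [ffun x => Ordinal (ltn_pmod (x == 1%g) p_gt0)].
rewrite /comb (bigD1 1%g) //= big1 ?addr0 => [|x /andP[_ /negPf x1]].
  by rewrite ffunE /= eqxx mulrn_modp u1.
by rewrite ffunE /= x1 mod0n.
Qed.

End AdditiveSpan.

Section PolynomialCases.

Variables (K : fieldType) (p : nat) (gT : finGroupType) (H T : {group gT}).
Variables (a b c t0 t1 t2 : gT -> K).
Hypothesis charK : p \in [pchar K].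
Hypothesis D : triangular_data H T a b c t0 t1 t2.
Notation coord_inv := (coord_inv H T a b c t0 t1 t2).
Notation L := (orbitX0 H a b).

(** Here conjugation by [x] multiplies [(b, c)] by [t2 x], so the set [V] of translation vectors is
    stable under the span of the values of [t2]. *)
Lemma polynomial_a0_nonsplit : {in H, forall h, a h = 0} ->
  {in T, forall x, t0 x = 1 /\ t1 x = 1} -> polynomial_subring coord_inv.
Proof.
move=> a0 t01.
have bMa : {in H &, {morph b : x y / (x * y)%g >-> x + y}}.
  by move=> x y xH yH; rewrite (bM D) // a0 // mul0r addr0.
pose V := [seq (b h, c h) | h <- enum H].
pose Om := [seq t2 x | x <- enum T]; pose k0 := additive_span p T t2.
have [||||||F1 [F2 [F12 inj HE]]] := @hyperplane_group_invariants K Om k0 _ _ _ _ _ V.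
- exact: additive_span_seq.
- by move=> _ /mapP[x xT ->]; rewrite mem_enum in xT; have [_ _] := t_neq0 D xT.
- by have := additive_span_mul (p := p) (t2M D).
- by have := additive_span1 T charK (t2_1 D).
- exact: additive_span_ind.
- move=> v k vV kk; move: k kk v vV.
  apply: (@additive_span_ind K p gT T t2
    (fun k => forall v, v \in V -> (k * v.1, k * v.2) \in V)).
  + move=> _ /mapP[h hH ->] /=; rewrite !mul0r; apply/mapP; exists 1%g.
      by rewrite mem_enum.
    have E0 (u : gT -> K) : {in H &, {morph u : x y / (x * y)%g >-> x + y}} -> u 1%g = 0.
      by move=> uM; apply: (addrI (u 1%g)); rewrite -uM // mulg1 addr0.
    by rewrite !E0 //; apply: (cM D).
  + move=> x y Px Py v vV; have /mapP[h hH [bh ch]] := Px v vV.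
    have /mapP[k kH [bk ck]] := Py v vV; rewrite !mem_enum in hH kH.
    apply/mapP; exists (h * k^-1)%g; first by rewrite mem_enum groupM ?groupV.
    rewrite !mulrBl bh ch bk ck; congr (_, _).
      by apply: (addIr (b k)); rewrite subrK -bMa ?groupM ?groupV // mulgKV.
    by apply: (addIr (c k)); rewrite subrK -(cM D) ?groupM ?groupV // mulgKV.
  + move=> _ /mapP[x xT ->] _ /mapP[h hH ->] /=; rewrite !mem_enum in xT hH.
    apply/mapP; exists (h ^ x)%g.
      by rewrite mem_enum memJ_norm // (subsetP (nHT D)).
    have [t0x t1x] := t01 x xT.
    by rewrite -(bJ D) // -(cJ D) // t0x t1x !mul1r.
apply: (@polynomial_from_H _ _ _ _ _ _ _ _ _ _ D F1 F2 X2 (fun=> 1) (fun=> 1) t2).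
- move=> f; rewrite unip_a0 // -HE; split=> [inv _ /mapP[h hH ->] /=|inv h hH].
    by apply: inv; rewrite -mem_enum.
  by apply: (inv (b h, c h)); rewrite map_f // mem_enum.
- exact: inj.
- move=> x xT; have [t0x t1x] := t01 x xT; rewrite t0x t1x !scale1r !comp3E.
  by have [] := F12 (t2 x); rewrite // map_f // mem_enum.
- by move=> x _ _; rewrite !eqxx !orbT.
- by move=> x xT; have [e0 e1 e2] := t_exp D xT; rewrite !expr1n.
Qed.

End PolynomialCases.

Lemma mdeg3 (m : 'X_{1..3}) : mdeg m = (m i0 + m i1 + m i2)%N.
Proof. by rewrite mdegE big_ord3. Qed.

Lemma mpolyX3 (R : nzRingType) (m : 'X_{1..3}) :
  'X_[R, m] = 'X_i0 ^+ m i0 * 'X_i1 ^+ m i1 * 'X_i2 ^+ m i2.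
Proof. by rewrite mpolyXE_id big_ord3. Qed.

(** * The case [c = l a]: the quadric, the orbit product and the absence of transvections *)

Section QuadricCase.

Variables (K : fieldType) (gT : finGroupType) (H T : {group gT}).
Variables (a b c t0 t1 t2 : gT -> K) (l : K) (tau : gT).
Hypothesis D : triangular_data H T a b c t0 t1 t2.
Hypothesis two_neq0 : 2%:R != 0 :> K.
Hypothesis l_neq0 : l != 0.
Hypothesis cE : {in H, forall h, c h = l * a h}.
Hypothesis tE : {in T, forall x, [/\ t0 x = 1, t1 x ^+ 2 = 1 & t2 x = 1]}.
Hypothesis tauT : tau \in T.
Hypothesis t1tau : t1 tau = -1.
Notation coord_inv := (coord_inv H T a b c t0 t1 t2).
Notation L := (orbitX0 H a b).

(** The coefficient [2 l] makes the terms in [X1 X2] produced by [h] cancel when [c = l a], so that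
    [H] moves the quadric only by multiples of [X2 ^+ 2]. *)
Definition quadric : {mpoly K[3]} := X1 ^+ 2 - (2%:R * l) *: (X0 * X2).

Lemma row_inj_quadric : {in H &, injective (fun h => a h *: X1 + b h *: X2 : {mpoly K[3]})}.
Proof.
move=> x y xH yH /(row_inj xH yH)[ax bx]; apply: (abc_inj D) => //.
by rewrite !cE // ax.
Qed.

Lemma orbitX0_inv : coord_inv L.
Proof.
split=> [h hH|x xT]; first exact: (orbitX0_unip D hH).
by rewrite (orbitX0_diag D xT); have [-> _ _] := tE xT; rewrite expr1n scale1r.
Qed.

Lemma orbitX0_subst0 : subst i0 0 L = 0.
Proof.
rewrite rmorph_prod /= (bigD1 1%g) //= subst_comp3 !comp3E.
have E0 (u : gT -> K) : {in H &, {morph u : x y / (x * y)%g >-> x + y}} -> u 1%g = 0.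
  by move=> uM; apply: (addrI (u 1%g)); rewrite -uM // mulg1 addr0.
have a1 := E0 a (aM D).
have b1 : b 1%g = 0.
  by apply: (addrI (b 1%g)); have := bM D (group1 H) (group1 H); rewrite mulg1 a1 mul0r !addr0.
by rewrite a1 b1 !scale0r !addr0 mul0r.
Qed.

Lemma orbitX0_neq0 : L != 0.
Proof.
apply/prodf_neq0 => h hH; apply/eqP => /(congr1 (mcoeff U_(i0))).
rewrite !mcoeffD !mcoeffZ !mcoeffXU /= !mulr0 !addr0 mcoeff0 => /eqP.
by rewrite oner_eq0.
Qed.

Lemma msize_orbitX0 : (1 < msize L)%N.
Proof.
rewrite ltnNge; apply/negP => /msize1_polyC E1; have := orbitX0_subst0.
by rewrite E1 substC -E1 => /eqP; rewrite (negPf orbitX0_neq0).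
Qed.

(* An invariant vanishing on X0 = 0 vanishes on the translates of this plane. *)
Lemma orbitX0_dvd f : coord_inv f -> subst i0 0 f = 0 ->
  exists2 g, coord_inv g & f = L * g.
Proof.
move=> inv f0; pose row h : {mpoly K[3]} := a h *: X1 + b h *: X2.
have [|||g Eg] := @prod_subst_eq0_dvd _ _ i0 [seq - row h | h <- enum H] f.
- rewrite map_inj_in_uniq ?enum_uniq // => x y; rewrite !mem_enum => xH yH /oppr_inj.
  exact: row_inj_quadric.
- by move=> _ /mapP[h _ ->]; rewrite rmorphN /= free_lin.
- move=> _ /mapP[h hH ->]; rewrite mem_enum in hH.
  rewrite subst_comp3 -(proj1 inv h hH) comp3A !comp3E addNr.
  have -> : f \mPo [tuple 0; X1 + c h *: X2; X2]
     = subst i0 0 f \mPo [tuple X0; X1 + c h *: X2; X2].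
    by rewrite subst_comp3 comp3A !comp3E raddf0.
  by rewrite f0 raddf0.
have Ef : f = L * g.
  rewrite {1}Eg big_enum_seq; congr (_ * _); apply: eq_bigr => h _.
  by rewrite opprK.
exists g => //; have [LH LT] := orbitX0_inv; have [fH fT] := inv.
split=> [h hH|x xT]; apply: (mulfI orbitX0_neq0).
  by rewrite -{1}(LH h hH) -comp_mpolyM -Ef fH.
by rewrite -{1}(LT x xT) -comp_mpolyM -Ef fT.
Qed.

Lemma coord_invB f g : coord_inv f -> coord_inv g -> coord_inv (f - g).
Proof.
move=> [fH fT] [gH gT']; split=> x xX; rewrite comp_mpolyB.
  by rewrite fH ?gH.
by rewrite fT ?gT'.
Qed.

Lemma quadric_unip h : h \in H ->
  quadric \mPo unip (a h) (b h) (c h) = quadric - (l * (2%:R * b h - a h * c h)) *: X2 ^+ 2.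
Proof.
move=> hH; rewrite /quadric !comp3E (cE hH) -!mul_mpolyC.
rewrite !(mpolyCM, mpolyCB, mpolyC_nat); ring.
Qed.

Lemma quadric_diag x : x \in T -> quadric \mPo diag3 (t0 x) (t1 x) (t2 x) = quadric.
Proof.
move=> xT; have [-> t1x ->] := tE xT.
by rewrite /quadric !comp3E !scale1r -scalerAl -scalerAr scalerA -!expr2 t1x scale1r.
Qed.

Lemma quadric_subst0 : subst i0 0 quadric = X1 ^+ 2.
Proof. by rewrite subst_comp3 /quadric !comp3E mul0r scaler0 subr0. Qed.

Lemma comp_hom_coord_inv (s : 3.-tuple {mpoly K[3]}) p :
  (forall i, coord_inv (tnth s i)) -> coord_inv (p \mPo s).
Proof.
move=> sI; split=> x xX; rewrite comp_mpolyA; apply: comp_mpoly_ext => i;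
  rewrite tnth_mktuple; have [sH sT] := sI i; [exact: sH | exact: sT].
Qed.

Lemma X2_inv : coord_inv X2.
Proof.
split=> [h hH|x xT]; rewrite !comp3E //.
by have [_ _ ->] := tE xT; rewrite scale1r.
Qed.

(** By [quadric_unip] this makes [H] fix the quadric; it will be derived from the absence of
    transvections. *)
Hypothesis bE : {in H, forall h, 2%:R * b h = a h * c h}.

Lemma quadric_inv : coord_inv quadric.
Proof.
split=> [h hH|x xT]; last exact: quadric_diag.
by rewrite quadric_unip // bE // subrr mulr0 scale0r subr0.
Qed.

Let s := [tuple L; quadric; X2] : 3.-tuple {mpoly K[3]}.

Lemma comp_generators_inv p : coord_inv (p \mPo s).
Proof.
apply: comp_hom_coord_inv; elim/ord3P; rewrite (tnth_nth 0) /=.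
- exact: orbitX0_inv.
- exact: quadric_inv.
- exact: X2_inv.
Qed.

Lemma msize_quadric : (msize quadric <= 3)%N.
Proof.
have X1m i : (msize ('X_i : {mpoly K[3]}) <= 2)%N by rewrite msizeX mdeg1.
apply: leq_trans (mmeasureD_le _ _ _) _; rewrite mmeasureN geq_max.
rewrite (msizeXn_deg 2 (X1m i1)) /=; apply: leq_trans (msizeZ_le _ _) _.
exact: (msizeM_deg (X1m i0) (X1m i2)).
Qed.

(** [tau] changes only the sign of [X1] and commutes with setting [X0 = 0], so the restriction of an
    invariant is even in [X1]. *)
Lemma subst0_even f m : coord_inv f -> m \in msupp (subst i0 0 f) ->
  m i0 = 0%N /\ ~~ odd (m i1).
Proof.
move=> inv; set h := subst i0 0 f; rewrite mcoeff_msupp => hm.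
have scale (w : 'I_3 -> K) : h \mPo diag3 (w i0) (w i1) (w i2) = h ->
    \prod_i w i ^+ m i = 1.
  move=> Eh; have := comp_mpoly_scaleX w h m.
  have -> : h \mPo [tuple w i *: 'X_i | i < 3] = h.
    rewrite -[RHS]Eh; apply: comp_mpoly_ext.
    by elim/ord3P; rewrite tnth_mktuple (tnth_nth 0).
  by rewrite -[LHS]mulr1 => /(mulfI hm).
have h0 : h \mPo diag3 0 1 1 = h.
  by rewrite /h subst_comp3 comp3A !comp3E !scale1r raddf0.
have h1 : h \mPo diag3 1 (-1) 1 = h.
  have [E0 _ E2] := tE tauT; have := proj2 inv tau tauT.
  rewrite E0 t1tau E2 => Ef; rewrite /h -{2}Ef !subst_comp3 !comp3A !comp3E.
  by rewrite scaler0 raddf0.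
split.
  have := scale (fun i => if i == i0 then 0 else 1) h0.
  rewrite (bigD1 i0) //= big1 ?mulr1 => [|i /negPf->]; last by rewrite expr1n.
  by rewrite expr0n; case: (m i0) => //= k /eqP; rewrite eq_sym oner_eq0.
have := scale (fun i => if i == i1 then -1 else 1) h1.
rewrite (bigD1 i1) //= big1 ?mulr1 => [|i /negPf->]; last by rewrite expr1n.
rewrite -signr_odd; case: (odd _) => //= /eqP; rewrite expr1 -subr_eq0 -opprD.
by rewrite oppr_eq0 -[1 + 1]/(2%:R) (negPf two_neq0).
Qed.

(** On [X0 = 0] the generators become [0], [X1 ^+ 2] and [X2]. By parity the last two give the
    restriction of any invariant, and [L] divides what is left. *)
Lemma polynomial_quadric : polynomial_subring coord_inv.
Proof.
exists 3%N, (comp_mpoly s); split.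
  move=> p q /eqP; rewrite -subr_eq0 -rmorphB /= => /eqP sp.
  apply/eqP; rewrite -subr_eq0; apply/eqP; move: {p q}(p - q) sp.
  apply: (@comp_mpoly_inj _ _ _ (subst i0 0) i0); first exact: orbitX0_neq0.
  move=> p; rewrite /= subst_comp3 /s comp3A -!subst_comp3 orbitX0_subst0 quadric_subst0.
  have -> : subst i0 0 X2 = X2 :> {mpoly K[3]} by rewrite subst_comp3 !comp3E.
  move=> p0; pose k (i : 'I_3) := if i == i1 then 2%N else 1%N.
  apply: (@comp_mpoly_Xpow_inj _ _ k); first by move=> i; rewrite /k; case: ifP.
  rewrite -[RHS]p0 subst_comp3 comp3A; apply: comp_mpoly_ext.
  by elim/ord3P; rewrite (tnth_nth 0) /= ?raddf0 // !comp_mpolyX_tnth tnth_mktuple.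
move=> f; split; last by case=> q <-; apply: comp_generators_inv.
move=> inv; suff [q ->] : exists q : {mpoly K[3]}, f = q \mPo s by exists q.
move: f inv; apply: (@generation_by_division _ _ _ _ _ X0).
  by rewrite comp3E msize_orbitX0.
move=> f inv; set h := subst i0 0 f.
pose q := \sum_(m <- msupp h) h@_m *: ('X_i1 ^+ (m i1)./2 * 'X_i2 ^+ m i2) : {mpoly K[3]}.
have qE : q \mPo s = \sum_(m <- msupp h) h@_m *: (quadric ^+ (m i1)./2 * X2 ^+ m i2).
  by rewrite raddf_sum /=; apply: eq_bigr => m _; rewrite !comp3E.
exists q.
  rewrite qE; apply: msize_sum_le => m mh; apply: leq_trans (msizeZ_le _ _) _.
  have hf : (msize h <= msize f)%N.
    apply: msize_comp_le => i; rewrite tnth_mktuple.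
    by case: ifP; rewrite ?mmeasure0 // msizeX mdeg1.
  apply: leq_trans hf; apply: leq_trans (msize_mdeg_lt mh).
  have [m0 m1] := subst0_even inv mh.
  have X2m : (msize ('X_i2 : {mpoly K[3]}) <= 2)%N by rewrite msizeX mdeg1.
  apply: leq_trans (msizeM_deg (msizeXn_deg _ msize_quadric) (msizeXn_deg _ X2m)) _.
  by rewrite ltnS mdeg3 m0 mul1n mul2n even_halfK.
have [g Ig Eg] : exists2 g, coord_inv g & f - (q \mPo s) = L * g.
  apply: orbitX0_dvd; first by apply: coord_invB; [exact: inv | exact: comp_generators_inv].
  rewrite rmorphB /= qE rmorph_sum /= -/h [X in X - _](mpolyE h) -sumrB big_seq.
  apply: big1 => m mh; have [m0 m1] := subst0_even inv mh.
  rewrite subst_comp3 comp_mpolyZ -subst_comp3 rmorphM !rmorphXn /= quadric_subst0.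
  rewrite substX -exprM mul2n even_halfK //=.
  by rewrite mpolyX3 m0 expr0 mul1r subrr.
by exists g => //; rewrite comp3E -Eg addrC subrK.
Qed.

End QuadricCase.

(** * Jacobians *)

Section Derivatives.

Variables (R : comNzRingType).

Lemma mderiv_X n (i j : 'I_n) : ('X_i)^`M(j) = (i == j)%:R :> {mpoly R[n]}.
Proof.
rewrite mderivX mnm1E; case: eqP => [->|_]; last by rewrite scale0r.
have -> : (U_(j) - U_(j))%MM = 0%MM :> 'X_{1..n}.
  by apply/mnmP => k; rewrite mnmBE subnn mnm0E.
by rewrite mpolyX0 scale1r.
Qed.

Lemma mderiv_comp m n (s : m.-tuple {mpoly R[n]}) p j :
  (p \mPo s)^`M(j) = \sum_i (p^`M(i) \mPo s) * (tnth s i)^`M(j).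
Proof.
elim/mpoly_ring_ind: p => [c|i|p q Ep Eq|p q Ep Eq].
- rewrite comp_mpolyC mderivC big1 // => i _.
  by rewrite mderivC comp_mpoly0 mul0r.
- rewrite comp_mpolyX_tnth (bigD1 i) //= mderiv_X eqxx comp_mpoly1 mul1r.
  rewrite big1 ?addr0 // => k /negPf ki.
  by rewrite mderiv_X eq_sym ki comp_mpoly0 mul0r.
- rewrite comp_mpolyD mderivD Ep Eq -big_split; apply: eq_bigr => i _.
  by rewrite mderivD comp_mpolyD mulrDl.
- rewrite rmorphM /= mderivM Ep Eq mulr_suml mulr_sumr -big_split /=.
  apply: eq_bigr => i _; rewrite mderivM comp_mpolyD !rmorphM /=; ring.
Qed.

Definition jacobian n (s : n.-tuple {mpoly R[n]}) : 'M[{mpoly R[n]}]_n :=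
  \matrix_(i, j) (tnth s i)^`M(j).

Lemma jacobian_comp n (s t : n.-tuple {mpoly R[n]}) :
  jacobian [tuple tnth t i \mPo s | i < n]
  = map_mx (comp_mpoly s) (jacobian t) *m jacobian s.
Proof.
apply/matrixP => i j; rewrite !mxE tnth_mktuple mderiv_comp.
by apply: eq_bigr => k _; rewrite !mxE.
Qed.

End Derivatives.

(** * Bounding the number of generators *)

Section Counting.

Variables (K : fieldType) (m n : nat) (phi : {lrmorphism {mpoly K[m]} -> {mpoly K[n]}}).
Hypothesis inj_phi : injective phi.

(* There are N^m monomials with exponents less than N in m variables; their images lie
   in a space of dimension at most (c N)^n with c independent of N. *)
Lemma mpoly_inj_leq : (m <= n)%N.
Proof.
rewrite leqNgt; apply/negP => nm.
pose d := \max_(i < m) msize (phi 'X_i).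
have dP i : (msize (phi 'X_i) <= d.+1)%N by rewrite ltnW // ltnS /d (leq_bigmax i).
(* The images of the monomials with exponents below [N] have size at most [M <= N * C]. So [m > n]
   would give [N ^ n.+1 <= N ^ m <= (N * C) ^ n], against [C ^ n < N]. *)
pose C := (d * m).+1; pose N := (C ^ n).+1; pose M := (d * (m * N)).+1.
pose I := {ffun 'I_m -> 'I_N}; pose J : finType := 'X_{1..n < M}.
pose X (u : I) : {mpoly K[m]} := 'X_[ [multinom (u i : nat) | i < m] ].
have sX u : (msize (phi (X u)) <= M)%N.
  rewrite /X mpolyXE_id rmorph_prod /=.
  apply: leq_trans (msize_prod_deg (a := fun i : 'I_m => (d * u i)%N) _ _) _ => [i|].
    by rewrite rmorphXn mnmE; apply: (msizeXn_deg _ (dP i)).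
  rewrite ltnS -big_distrr /= leq_mul2l; apply/orP; right.
  have : (\sum_(i < m) u i <= \sum_(i < m) N)%N.
    by apply: leq_sum => i _; apply: ltnW.
  by rewrite sum_nat_const card_ord.
have cardI : #|I| = (N ^ m)%N by rewrite card_ffun !card_ord.
have cardJ : (#|J| <= M ^ n)%N.
  have f_lt (v : J) (i : 'I_n) : (v i < M)%N.
    by apply: leq_ltn_trans (bmdeg v); rewrite mdegE (bigD1 i) //= leq_addr.
  pose f (v : J) : {ffun 'I_n -> 'I_M} := [ffun i => Ordinal (f_lt v i)].
  have inj_f : injective f.
    move=> v w /ffunP Efvw; apply/val_inj/mnmP => i.
    by have := congr1 val (Efvw i); rewrite !ffunE.
  by have := leq_card f inj_f; rewrite card_ffun !card_ord.
pose A : 'M[K]_(#|I|, #|J|) := \matrix_(u, v) (phi (X (enum_val u)))@_(enum_val v : J).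
have leIJ : (#|I| <= #|J|)%N.
  rewrite leqNgt; apply/negP => ltJI.
  (* With more rows than columns [A] has a nonzero left kernel vector, which is a linear relation
     between the images of distinct monomials. *)
  have : kermx A != 0.
    rewrite -mxrank_eq0 mxrank_ker subn_eq0 -ltnNge.
    exact: leq_ltn_trans (rank_leq_col A) ltJI.
  case/rowV0Pn => x /sub_kermxP xA x0; case/negP: x0; apply/eqP.
  pose q := \sum_u x 0 u *: X (enum_val u).
  have phi_q : phi q = 0.
    apply/mpolyP => v; rewrite mcoeff0.
    have [vM|Mv] := ltnP (mdeg v) M.
      have := congr1 (fun B : 'M_(1, _) => B 0 (enum_rank (BMultinom vM : J))) xA.
      rewrite !mxE => <-; rewrite raddf_sum /= raddf_sum /=; apply: eq_bigr => u _.
      by rewrite linearZ /= mcoeffZ mxE enum_rankK.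
    apply: memN_msupp_eq0; apply: msize_mdeg_ge; apply: leq_trans Mv.
    rewrite raddf_sum /=; apply: msize_sum_le => u _.
    by rewrite linearZ /=; apply: leq_trans (msizeZ_le _ _) (sX _).
  have q0 : q = 0 by apply: inj_phi; rewrite phi_q rmorph0.
  apply/rowP => u; rewrite mxE.
  have := congr1 (mcoeff [multinom (enum_val u i : nat) | i < m]) q0.
  rewrite mcoeff0 raddf_sum /= (bigD1 u) //= big1 ?addr0 => [|w wu].
    by rewrite mcoeffZ mcoeffX eqxx mulr1.
  rewrite mcoeffZ mcoeffX; case: eqP => [|_]; last by rewrite mulr0.
  move/mnmP => E; case/eqP: wu; apply/enum_val_inj/ffunP => i; apply: val_inj.
  by have := E i; rewrite !mnmE.
have MN : (M <= N * C)%N.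
  rewrite /M /C mulnS; have -> : (d * (m * N) = N * (d * m))%N by rewrite mulnA mulnC.
  by rewrite -add1n leq_add2r.
have : (N ^ m <= (N * C) ^ n)%N.
  rewrite -cardI (leq_trans leIJ) // (leq_trans cardJ) //.
  by elim: (n) => // k IH; rewrite !expnS leq_mul.
rewrite expnMn leqNgt => /negP; apply.
apply: (@leq_trans (N ^ n.+1)); last by rewrite leq_pexp2l.
by rewrite expnS mulnC ltn_pmul2r ?expn_gt0.
Qed.

End Counting.

Notation origin := [tuple 0; 0; 0].

Lemma comp_origin (R : comNzRingType) n (p : {mpoly R[3]}) :
  p \mPo origin = (p@_0)%:MP :> {mpoly R[n]}.
Proof.
rewrite comp_mpolyEX (mpolyE p) raddf_sum /= rmorph_sum /= -mpolyE.
apply: eq_bigr => m _; rewrite mcoeffZ mcoeffX comp_mpolyX -mul_mpolyC rmorphM /=.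
congr (_ * _); have [->|m0] := eqVneq m 0%MM.
  by rewrite big1 // => i _; rewrite mnm0E expr0.
have [i mi] : exists i, m i != 0%N.
  apply/existsP; apply: contraNT m0; rewrite negb_exists => /forallP m0.
  by apply/eqP/mnmP => i; rewrite mnm0E; apply/eqP/negbNE/m0.
rewrite (bigD1 i) //=; have -> : tnth (origin : 3.-tuple {mpoly R[n]}) i = 0.
  by elim/ord3P: (i); rewrite (tnth_nth 0).
by rewrite expr0n (negPf mi) mul0r.
Qed.

(** As [m <= 3], the images of the variables can be padded with zeros to three; subtracting their
    constant terms leaves the generated ring unchanged. *)
Lemma polynomial_subring_generators (K : fieldType) (S : {mpoly K[3]} -> Prop) :
  (forall c, S c%:MP) -> (forall f g, S f -> S g -> S (f - g)) ->
  polynomial_subring S ->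
  exists s : 3.-tuple {mpoly K[3]},
    [/\ forall i, S (tnth s i), forall i, (tnth s i)@_0 = 0
      & forall f, S f -> exists p : {mpoly K[3]}, f = p \mPo s].
Proof.
move=> SC SB [m [phi [inj_phi SE]]]; have m3 := mpoly_inj_leq inj_phi.
pose s0 (i : 'I_3) : {mpoly K[3]} := oapp (fun j => phi 'X_j) 0 (insub (i : nat) : option 'I_m).
have S0 i : S (s0 i).
  rewrite /s0; case: insub => [j|] /=; first by apply/SE; eexists.
  by rewrite -(mpolyC0 3 K).
exists [tuple s0 i - ((s0 i)@_0)%:MP | i < 3]; split=> [i|i|f /SE[q <-]].
- by rewrite tnth_mktuple; apply: SB.
- by rewrite tnth_mktuple mcoeffB mcoeffC eqxx mulr1 subrr.
pose t := [tuple ('X_(widen_ord m3 j) + ((s0 (widen_ord m3 j))@_0)%:MP : {mpoly K[3]}) | j < m].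
exists (q \mPo t); rewrite comp_mpolyA.
apply: (@mpoly_rmorph_ext _ _ _ phi (comp_mpoly _)) => [c|j] /=.
  by rewrite comp_mpolyC -alg_mpolyC -[in RHS]alg_mpolyC linearZ /= rmorph1.
rewrite comp_mpolyX_tnth !tnth_mktuple comp_mpolyD comp_mpolyX_tnth tnth_mktuple.
rewrite comp_mpolyC subrK /s0 insubT /=; first exact: ltn_ord.
by move=> lt_j; congr (phi 'X_ _); apply: val_inj.
Qed.

(** Each [X1 - d *: X2] is prime and vanishes at the origin, where [u] does not; so it divides [f].
    Repetitions in [ds] are allowed. *)
Lemma prime_cancel (K : fieldType) (ds : seq K) (u f w : {mpoly K[3]}) :
  u@_0 != 0 -> u * f = (\prod_(d <- ds) (X1 - d *: X2)) * w ->
  exists w', f = (\prod_(d <- ds) (X1 - d *: X2)) * w'.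
Proof.
move=> u0; elim: ds f w => [|d ds IH] f w; first by exists f; rewrite big_nil mul1r.
rewrite big_cons -mulrA => E.
have X12 : X1 - d *: X2 != 0 :> {mpoly K[3]}.
  apply/eqP => /(congr1 (mcoeff U_(i1))).
  by rewrite mcoeffB mcoeffZ !mcoeffXU mcoeff0 /= mulr0 subr0 => /eqP; rewrite oner_eq0.
have /subst_eq0_dvd[f1 Ef] : subst i1 (d *: X2) f = 0.
  have /eqP := congr1 (subst i1 (d *: X2)) E.
  have sd : subst i1 (d *: X2) (X1 - d *: X2) = 0 :> {mpoly K[3]}.
    by rewrite subst_comp3 !comp3E subrr.
  rewrite !rmorphM /= sd mul0r mulf_eq0 => /orP[|/eqP //].
  move/eqP/(congr1 (comp_mpoly [tuple 0; 0; 0] : _ -> {mpoly K[3]})).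
  rewrite subst_comp3 comp3A !comp3E scaler0 comp_origin raddf0 => /eqP.
  by rewrite mpolyC_eq0 (negPf u0).
have [w' Ew] : exists w', f1 = (\prod_(d <- ds) (X1 - d *: X2)) * w'.
  by apply: (IH f1 w); apply: (mulfI X12); rewrite mulrCA -Ef E.
by exists w'; rewrite Ef Ew mulrA.
Qed.

(** Differentiating [e (X + x) = e X + e x] at 0 shows that the derivative has the same value at
    every [x]; this value is nonzero because 0 is a simple root. *)
Lemma additive_deriv (K : closedFieldType) (s : seq K) : additive_seq s ->
  exists2 k, k != 0 & (\prod_(d <- s) ('X - d%:P))^`() = k%:P.
Proof.
move=> add_s; set e := \prod_(d <- s) _.
have add_sP : additive_seq [seq d%:P | d <- s].
  by apply: additive_seq_map add_s => [c d /polyC_inj|c d]; rewrite ?polyCB.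
have ex x : e^`().[x] = e^`().[0].
  have := prod_additive add_sP 'X x%:P; rewrite !big_map -/e.
  have -> : \prod_(d <- s) ('X + x%:P - d%:P) = e \Po ('X + x%:P).
    by rewrite rmorph_prod /=; apply: eq_bigr => d _; rewrite comp_polyB comp_polyX comp_polyC.
  under eq_bigr do rewrite -polyCB.
  rewrite -rmorph_prod /= => /(congr1 (fun q => q^`().[0])).
  rewrite deriv_comp derivD derivC addr0 derivD derivX derivC addr0 mulr1.
  by rewrite horner_comp !hornerE.
exists (e^`().[0]).
  have [us s0 _] := add_s; rewrite /e (big_rem 0) //= subr0 derivM derivX mul1r.
  rewrite hornerD hornerM hornerX mul0r addr0 horner_prod prodf_seq_neq0; apply/allP => d /=.
  by rewrite mem_rem_uniq // inE => /andP[d0 _]; rewrite hornerXsubC sub0r oppr_eq0.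
apply/eqP; rewrite -subr_eq0; apply/negPn/negP => /closed_nonrootP[x].
by rewrite /root !hornerE ex subrr eqxx.
Qed.

Lemma deriv_rmorph (R A : comNzRingType) n (rho : {rmorphism {mpoly R[n]} -> {poly A}}) f :
  (forall k, (rho k%:MP)^`() = 0) ->
  (rho f)^`() = \sum_i rho f^`M(i) * (rho 'X_i)^`().
Proof.
move=> rhoC; elim/mpoly_ring_ind: f => [k|i|f g Ef Eg|f g Ef Eg].
- by rewrite rhoC big1 // => i _; rewrite mderivC rmorph0 mul0r.
- rewrite (bigD1 i) //= mderiv_X eqxx rmorph1 mul1r big1 ?addr0 // => j /negPf ji.
  by rewrite mderiv_X eq_sym ji rmorph0 mul0r.
- rewrite rmorphD derivD Ef Eg -big_split; apply: eq_bigr => i _ /=.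
  by rewrite mderivD rmorphD mulrDl.
- rewrite rmorphM derivM Ef Eg mulr_suml mulr_sumr -big_split; apply: eq_bigr => i _ /=.
  rewrite mderivM rmorphD !rmorphM; ring.
Qed.

Lemma det3_antitriangular (R : comNzRingType) (M : 'M[R]_3) :
  M i0 i0 = 0 -> M i0 i1 = 0 -> M i1 i0 = 0 ->
  \det M = - (M i0 i2 * M i1 i1 * M i2 i0).
Proof.
move=> M00 M01 M10.
have : \det (xcol i0 i2 M) = M i0 i2 * M i1 i1 * M i2 i0.
  rewrite det_trig.
    by rewrite big_ord3 !mxE tpermL tpermR tpermD.
  apply/is_trig_mxP => i j; elim/ord3P: i; elim/ord3P: j => //= _;
    by rewrite mxE ?tpermR ?tpermD.
rewrite xcolE det_mulmx det_perm odd_tperm /= expr1 mulrN1 => <-.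
by rewrite opprK.
Qed.

Section Evaluations.

Variable K : fieldType.

(** Restriction to [X0 = 0], dehomogenized by [X2 = 1]. *)
Definition eval_line : {rmorphism {mpoly K[3]} -> {poly K}} :=
  mmap (@polyC K) (tnth [tuple 0; 'X; 1]).

(** The outer variable keeps [X0], so that the derivative at 0 computes the partial derivative in
    [X0] along the line. *)
Definition eval_plane : {rmorphism {mpoly K[3]} -> {poly {poly K}}} :=
  mmap (@polyC {poly K} \o @polyC K) (tnth [tuple 'X; 'X%:P; 1]).

Lemma eval_lineE : ((forall k, eval_line k%:MP = k%:P) *
  (eval_line X0 = 0) * (eval_line X1 = 'X) * (eval_line X2 = 1))%type.
Proof.
by split; [split; [split|]|] => [k|||]; rewrite /eval_line /= ?mmapC // mmapX mmap1U (tnth_nth 0).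
Qed.

Lemma eval_planeE : ((forall k, eval_plane k%:MP = k%:P%:P) *
  (eval_plane X0 = 'X) * (eval_plane X1 = 'X%:P) * (eval_plane X2 = 1))%type.
Proof.
by split; [split; [split|]|] => [k|||]; rewrite /eval_plane /= ?mmapC // mmapX mmap1U (tnth_nth 0).
Qed.

Lemma eval_lineZ k f : eval_line (k *: f) = k *: eval_line f.
Proof. by rewrite -mul_mpolyC rmorphM /= eval_lineE mul_polyC. Qed.

Lemma eval_planeZ k f : eval_plane (k *: f) = k%:P *: eval_plane f.
Proof. by rewrite -mul_mpolyC rmorphM /= eval_planeE mul_polyC. Qed.

Lemma eval_plane0 f : (eval_plane f).[0] = eval_line f.
Proof.
pose g : {rmorphism {mpoly K[3]} -> {poly K}} := horner_eval 0 \o eval_plane.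
have gE h : g h = (eval_plane h).[0] by [].
apply: (@mpoly_rmorph_ext _ _ _ g eval_line) => [k|].
  by rewrite gE !eval_planeE eval_lineE hornerC.
by elim/ord3P; rewrite gE !eval_planeE !eval_lineE !hornerE.
Qed.

Lemma eval_line_subst0 f : eval_line (subst i0 0 f) = eval_line f.
Proof.
pose g : {rmorphism {mpoly K[3]} -> {poly K}} := eval_line \o subst i0 0.
apply: (@mpoly_rmorph_ext _ _ _ g eval_line) => [k|] /=; first by rewrite substC.
by elim/ord3P; rewrite substX //= rmorph0 eval_lineE.
Qed.

Lemma eval_line_mderiv1 f : eval_line f^`M(i1) = (eval_line f)^`().
Proof.
rewrite deriv_rmorph => [|k]; last by rewrite eval_lineE derivC.
by rewrite big_ord3 /= !eval_lineE deriv0 derivX derivC !mulr0 mulr1 add0r addr0.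
Qed.

Lemma eval_line_mderiv0 f : eval_line f^`M(i0) = (eval_plane f)^`().[0].
Proof.
rewrite deriv_rmorph => [|k]; last by rewrite eval_planeE derivC.
by rewrite big_ord3 /= !eval_planeE !derivC derivX !mulr0 mulr1 !addr0 eval_plane0.
Qed.

End Evaluations.

(** To be applied to the number [x] of values of [a], the order [y] of its kernel and the number [w]
    of [h] with [a h] nonzero: [w = (x - 1) y >= 3 (x - 1) > x]. *)
Lemma size_bound x y w : (2 < y)%N -> (2 < x)%N -> (y + w = x * y)%N -> (w <= x)%N -> False.
Proof.
move=> y3 x3 E le.
have h1 : (3 * y <= x * y)%N by rewrite leq_mul2r x3 orbT.
have h2 : (x * 3 <= x * y)%N by rewrite leq_mul2l y3 orbT.
lia.
Qed.

(** * The case [c = l a] with a transvection *)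

Section NonPolynomial.

Variables (K : closedFieldType) (p : nat) (gT : finGroupType) (H T : {group gT}).
Variables (a b c t0 t1 t2 : gT -> K) (l : K) (tau z h0 : gT).
Hypothesis D : triangular_data H T a b c t0 t1 t2.
Hypothesis charK : p \in [pchar K].
Hypothesis pH : (p.-group H)%g.
Hypothesis two_neq0 : 2%:R != 0 :> K.
Hypothesis l_neq0 : l != 0.
Hypothesis cE : {in H, forall h, c h = l * a h}.
Hypothesis tE : {in T, forall x, [/\ t0 x = 1, t1 x ^+ 2 = 1 & t2 x = 1]}.
Hypothesis tauT : tau \in T.
Hypothesis t1tau : t1 tau = -1.
Hypothesis zH : z \in H.
Hypothesis az : a z = 0.
Hypothesis bz : b z != 0.
Hypothesis h0H : h0 \in H.
Hypothesis ah0 : a h0 != 0.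
Notation coord_inv := (coord_inv H T a b c t0 t1 t2).
Notation L := (orbitX0 H a b).

Lemma ker_a_group_set : group_set [set h in H | a h == 0].
Proof.
apply/group_setP; split=> [|x y].
  rewrite inE group1 /=; apply/eqP/(addrI (a 1%g)).
  by rewrite -(aM D) // mulg1 addr0.
rewrite !inE => /andP[xH /eqP ux] /andP[yH /eqP uy].
by rewrite groupM //= (aM D) // ux uy addr0.
Qed.
Let B := Group ker_a_group_set.

Lemma memB h : (h \in B) = (h \in H) && (a h == 0).
Proof. by rewrite inE. Qed.

Lemma bMB : {in B &, {morph b : x y / (x * y)%g >-> x + y}}.
Proof.
move=> x y; rewrite !memB => /andP[xH /eqP ax] /andP[yH _].
by rewrite (bM D) // ax mul0r addr0.
Qed.

Lemma bB_inj : {in B &, injective b}.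
Proof.
move=> x y; rewrite !memB => /andP[xH /eqP ax] /andP[yH /eqP ay] bxy.
by apply: (abc_inj D) => //; rewrite ?cE // ax ay.
Qed.

Definition Bs := [seq b k | k <- enum B].
(** Every value of [a] is attained [#|B|] times, hence [undup]. *)
Definition As := undup [seq a h | h <- enum H].

Lemma memAs x : reflect (exists2 h, h \in H & x = a h) (x \in As).
Proof.
rewrite mem_undup; apply: (iffP mapP) => [] [h hH ->]; exists h => //.
  by rewrite mem_enum in hH.
by rewrite mem_enum.
Qed.

Lemma aV h : h \in H -> a h^-1%g = - a h.
Proof.
move=> hH; apply: (addrI (a h)); rewrite -(aM D) ?groupV // mulgV subrr.
by apply: (addrI (a 1%g)); rewrite -(aM D) // mulg1 addr0.
Qed.

Lemma add_As : additive_seq As.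
Proof.
split; first exact: undup_uniq.
  by apply/memAs; exists z.
move=> _ _ /memAs[x xH ->] /memAs[y yH ->]; apply/memAs.
by exists (x * y^-1)%g; rewrite ?groupM ?groupV // (aM D) ?groupV // aV.
Qed.

Lemma add_Bs : additive_seq Bs.
Proof. exact: additive_seq_group bMB bB_inj. Qed.

Lemma size_Bs : size Bs = #|B|.
Proof. by rewrite size_map -cardE. Qed.

Lemma additive_seq_size3 (s : seq K) x : additive_seq s -> x \in s -> x != 0 ->
  (2 < size s)%N.
Proof.
move=> add_s xs x0; have [us s0 _] := add_s.
apply: (@uniq_leq_size _ [:: 0; x; - x] s).
  rewrite /= !inE andbT negb_or (eq_sym 0 x) x0 eq_sym oppr_eq0 x0 /=.
  rewrite -subr_eq0 opprK -mulr2n -mulr_natr mulf_eq0 (negPf x0).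
  by rewrite (negPf two_neq0).
by move=> y; rewrite !inE => /or3P[] /eqP-> //; apply: additive_seqN.
Qed.

Lemma size_As3 : (2 < size As)%N.
Proof. by apply: additive_seq_size3 add_As _ ah0; apply/memAs; exists h0. Qed.

Lemma card_B3 : (2 < #|B|)%N.
Proof.
rewrite -size_Bs; apply: additive_seq_size3 add_Bs _ bz.
by rewrite map_f // mem_enum memB zH az eqxx.
Qed.

Lemma card_H : #|H| = (size As * #|B|)%N.
Proof.
rewrite -sum1_card.
rewrite (eq_bigr (fun h => \sum_(x <- As | x == a h) 1)%N) => [|h hH]; last first.
  rewrite sum1_count -/(count_mem _ _) count_uniq_mem ?undup_uniq //.
  by have -> : a h \in As by apply/memAs; exists h.
rewrite (exchange_big_dep xpredT) //= -sum1_size big_distrl /=.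
rewrite big_seq [RHS]big_seq; apply: eq_bigr => _ /memAs[k kH ->].
rewrite sum1_card mul1n -[RHS](card_imset _ (mulIg k)); apply: eq_card => h.
apply/andP/imsetP => [[hH /eqP ah]|[x]].
  exists (h * k^-1)%g; rewrite ?mulgKV // memB groupM ?groupV //=.
  by rewrite (aM D) ?groupV // aV // ah subrr.
by rewrite memB => /andP[xH /eqP ax] ->; rewrite groupM // (aM D) // ax add0r.
Qed.

(** [#|B|] is a power of [p], so this is an iterate of the Frobenius map. *)
Lemma expB_inj : injective (fun x : K => x ^+ #|B|).
Proof.
have sBH : B \subset H by apply/subsetP => h; rewrite memB => /andP[].
have nB : [pchar K].-nat #|B|.
  by rewrite (eq_pnat _ (pcharf_eq charK)) -pgroupE (pgroupS sBH).
move=> x y /= Exy; apply/eqP; rewrite -subr_eq0.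
have : (x - y) ^+ #|B| == 0.
  apply/eqP/(addIr (y ^+ #|B|)).
  by rewrite -exprDn_pchar // subrK add0r.
by rewrite expf_eq0 => /andP[].
Qed.

(* On the axis X1 = X2 = 0, invariance under the kernel B of a makes f a polynomial in
   X0 ^ |B|; the plane X2 = 0 then turns the remaining elements of H into translations of
   X0 ^ |B| by (a h X1) ^ |B|. *)
Lemma invariant_axis f : coord_inv f -> exists g : {mpoly K[3]},
  f \mPo [tuple X0; 0; 0] = f \mPo [tuple 0; 0; 0] + X0 ^+ #|H| * g.
Proof.
move=> [fH _]; pose ds := [seq d *: X2 : {mpoly K[3]} | d <- Bs].
have add_ds : additive_seq ds.
  apply: additive_seq_map add_Bs => [x y|x y]; last by rewrite scalerBl.
  move/(congr1 (mcoeff U_(i2))); rewrite !mcoeffZ !mcoeffXU /= !mulr1.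
  by [].
have free_ds : {in ds, forall d, subst i0 0 d = d}.
  by move=> _ /mapP[d _ ->]; rewrite subst_comp3 !comp3E.
have /(translation_invariants add_ds free_ds)[g0 Eg0] :
    {in ds, forall d, subst i0 (X0 + d) f = f}.
  move=> _ /mapP[_ /mapP[k kB ->] ->]; move: kB.
  rewrite mem_enum memB => /andP[kH /eqP ak]; rewrite subst_comp3 -[RHS](fH k kH).
  by rewrite (cE kH) ak mulr0 !scale0r add0r addr0.
have B0 : (0 < #|B|)%N by rewrite cardG_gt0.
pose G := g0 \mPo [tuple X0; X1; 0] : {mpoly K[3]}.
have fG (u v w : {mpoly K[3]}) :
    f \mPo [tuple u; v; 0] = G \mPo [tuple u ^+ #|B|; v; w].
  rewrite /G Eg0 subst_comp3 !comp3A !comp3E raddf0.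
  have -> : orbit_prod i0 ds \mPo [tuple u; v; 0] = u ^+ #|B|.
    rewrite /orbit_prod rmorph_prod /= !big_map big_enum -prodr_const /=.
    by apply: eq_bigr => k _; rewrite !comp3E scaler0 subr0.
  by [].
(* Invariance under [h], evaluated at [(0, X1, 0)], reads [f (a h X1, X1, 0) = f (0, X1, 0)]. *)
have Ga h : h \in H ->
    subst i0 (a h ^+ #|B| *: X1 ^+ #|B|) G = subst i0 0 G.
  move=> hH; rewrite !subst_comp3 -exprZn -fG.
  have := fG 0 X1 X2; rewrite expr0n (gtn_eqF B0) => <-.
  by rewrite -[in RHS](fH h hH) comp3A !comp3E !scaler0 addr0 add0r addr0.
pose es := [seq x ^+ #|B| *: X1 ^+ #|B| : {mpoly K[3]} | x <- As].
have [|||r Er] := @prod_subst_eq0_dvd _ _ i0 es (G - subst i0 0 G).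
- rewrite map_inj_uniq ?undup_uniq // => x y /eqP.
  rewrite -subr_eq0 -scalerBl scaler_eq0 expf_eq0 -(mmeasure_poly_eq0 mdeg) msizeX.
  by rewrite andbF orbF subr_eq0 => /eqP/expB_inj.
- by move=> _ /mapP[x _ ->]; rewrite subst_comp3 !comp3E.
- move=> _ /mapP[_ /memAs[h hH ->] ->].
  by rewrite rmorphB /= subst_idem Ga // subrr.
exists (r \mPo [tuple X0 ^+ #|B|; 0; 0]); apply/eqP; rewrite addrC -subr_eq; apply/eqP.
rewrite (fG _ _ 0) (fG 0 0 0) expr0n (gtn_eqF B0).
have -> : G \mPo [tuple 0; 0; 0] = subst i0 0 G \mPo [tuple X0 ^+ #|B|; 0; 0].
  by rewrite subst_comp3 comp3A !comp3E raddf0.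
(* At [X1 = 0] each of the [size As] factors becomes [X0 ^+ #|B|], and the exponents add up to
   [#|H|]. *)
rewrite -comp_mpolyB Er comp_mpolyM; congr (_ * _).
rewrite rmorph_prod /= big_map card_H mulnC exprM.
under eq_bigr do rewrite !comp3E expr0n (gtn_eqF B0) scaler0 subr0.
by rewrite big_const_seq count_predT iter_mulr_1.
Qed.

(** Without linear terms, every nonconstant monomial of [q] has degree at least 2 and so collects
    [X0 ^+ N] at least twice. *)
Lemma comp_powers_tail (N : nat) (g : 3.-tuple {mpoly K[3]}) (q : {mpoly K[3]}) :
  (forall i, q@_U_(i) = 0) -> exists r,
    q \mPo [tuple X0 ^+ N * tnth g i | i < 3] = (q@_0)%:MP + X0 ^+ (N + N) * r.
Proof.
move=> q1; rewrite comp_mpolyEX.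
have term m : m \in msupp q -> exists r,
    q@_m *: ('X_[m] \mPo [tuple X0 ^+ N * tnth g i | i < 3])
    = ((m == 0%MM)%:R * q@_m)%:MP + X0 ^+ (N + N) * r.
  move=> mq; have [->|m0] := eqVneq m 0%MM.
    by exists 0; rewrite mul1r mulr0 addr0 mpolyX0 comp_mpoly1 -mul_mpolyC mulr1.
  have md : (2 <= mdeg m)%N.
    rewrite ltnNge leq_eqVlt ltnS leqn0 mdeg_eq0 (negPf m0) orbF.
    apply: contraL mq => /mdeg1P[i /eqP mi].
    by rewrite mcoeff_msupp negbK mi q1.
  exists (q@_m *: (X0 ^+ (N * (mdeg m - 2)) * \prod_i tnth g i ^+ m i)).
  rewrite mul0r mpolyC0 add0r -scalerAr mulrA -exprD comp_mpolyX; congr (_ *: _).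
  rewrite [LHS](eq_bigr (fun i => X0 ^+ (N * m i) * tnth g i ^+ m i)) => [|i _]; last first.
    by rewrite tnth_mktuple exprMn -exprM.
  rewrite big_split /= -expr_sum -big_distrr /= -mdegE; congr (X0 ^+ _ * _).
  by rewrite addnn -muln2 -mulnDr subnKC.
have sum_ms (ms : seq 'X_{1..3}) : {subset ms <= msupp q} -> exists r,
    \sum_(m <- ms) q@_m *: ('X_[m] \mPo [tuple X0 ^+ N * tnth g i | i < 3])
    = (\sum_(m <- ms) (m == 0%MM)%:R * q@_m)%:MP + X0 ^+ (N + N) * r.
  elim: ms => [_|m ms IH sub].
    by exists 0; rewrite !big_nil mpolyC0 mulr0 addr0.
  have [|r1 E1] := term m; first by rewrite sub ?mem_head.
  have [|r2 E2] := IH; first by move=> m' mm; rewrite sub // inE mm orbT.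
  exists (r1 + r2); rewrite !big_cons E1 E2 mpolyCD mulrDr; ring.
have [//|r Er] := sum_ms (msupp q); exists r; rewrite Er; congr (_%:MP + _).
rewrite [in RHS](mpolyE q) raddf_sum /=; apply: eq_bigr => m _.
by rewrite mcoeffZ mcoeffX mulrC.
Qed.

(** Compare orders on the axis [X1 = X2 = 0]. There [L] is exactly [X0 ^+ #|H|], and by
    [invariant_axis] each generator is a multiple of it; without linear terms [q \mPo s] would be a
    constant plus a multiple of [X0 ^+ (#|H| + #|H|)]. *)
Lemma orbitX0_linear_part (s : 3.-tuple {mpoly K[3]}) (q : {mpoly K[3]}) :
  (forall i, coord_inv (tnth s i)) -> (forall i, (tnth s i)@_0 = 0) ->
  L = q \mPo s -> exists i, q@_U_(i) != 0.
Proof.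
move=> sI s0 EL; apply/existsP; apply: contraT; rewrite negb_exists => /forallP q1.
have q1' i : q@_U_(i) = 0 by apply/eqP/negbNE/q1.
have /fin_all_exists[g Eg] i : exists g : {mpoly K[3]},
    tnth s i \mPo [tuple X0; 0; 0] = X0 ^+ #|H| * g.
  have [g Eg] := invariant_axis (sI i).
  by exists g; rewrite Eg comp_origin s0 mpolyC0 add0r.
have [r Er] := comp_powers_tail #|H| [tuple g i | i < 3] q1'.
have LX : L \mPo [tuple X0; 0; 0] = X0 ^+ #|H| :> {mpoly K[3]}.
  rewrite rmorph_prod /= -prodr_const; apply: eq_bigr => h _.
  by rewrite !comp3E !scaler0 !addr0.
have LE : X0 ^+ #|H| = (q@_0)%:MP + X0 ^+ (#|H| + #|H|) * r.
  rewrite -Er -[LHS]LX EL comp_mpolyA; apply: comp_mpoly_ext => i.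
  by rewrite !tnth_mktuple Eg.
have H0 : (#|H| == 0%N) = false by rewrite gtn_eqF ?cardG_gt0.
have q0 : (q@_0)%:MP = 0 :> {mpoly K[3]}.
  have /esym := congr1 (subst i0 0) LE.
  by rewrite rmorphD rmorphM !rmorphXn /= substX substC !expr0n addn_eq0 H0 mul0r addr0.
have : X0 ^+ #|H| * (1 - X0 ^+ #|H| * r) = 0.
  by rewrite mulrBr mulr1 mulrA -exprD {1}LE q0 add0r subrr.
move/eqP; rewrite mulf_eq0 expf_eq0 -(mmeasure_poly_eq0 mdeg) msizeX andbF /=.
move/eqP/(congr1 (subst i0 0)); rewrite rmorphB rmorphM rmorphXn rmorph1 /= substX.
by rewrite expr0n H0 mul0r subr0 rmorph0 => /eqP; rewrite oner_eq0.
Qed.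

Notation Q := (quadric l).

Lemma tau_conj h : h \in H ->
  [/\ (h ^ tau)%g \in H, a (h ^ tau)%g = - a h & b (h ^ tau)%g = b h].
Proof.
move=> hH; have [E0 _ E2] := tE tauT; split.
- by rewrite memJ_norm // (subsetP (nHT D)).
- by rewrite -[LHS]mul1r -E0 (aJ D) // t1tau mulN1r.
- by rewrite -[LHS]mul1r -E0 (bJ D) // E2 mul1r.
Qed.

(** The product runs over the translates of [X1], since [c h = l * a h]; it is squared because an
    element of [T] with [t1 x = -1] may change its sign. *)
Definition sqU : {mpoly K[3]} := (\prod_(x <- As) (X1 - (l * x) *: X2)) ^+ 2.
(** [H] no longer fixes [Q], but moves it by some [(l * b k) *: X2 ^+ 2] with [k] in [B]. *)
Definition sqV : {mpoly K[3]} := \prod_(k in B) (Q - (l * b k) *: X2 ^+ 2).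

Lemma sqU_inv : coord_inv sqU.
Proof.
split=> [h hH|x xT]; rewrite /sqU comp_mpoly_exp.
  congr (_ ^+ 2); rewrite rmorph_prod /=.
  have ahA : - a h \in As by apply: (additive_seqN add_As); apply/memAs; exists h.
  rewrite -(perm_big _ (perm_additive_seq add_As ahA)) big_map.
  apply: eq_bigr => y _; rewrite !comp3E (cE hH) opprK mulrDr scalerDl; ring.
have [_ /eqP + E2] := tE xT; rewrite -{1}(expr1n _ 2) eqf_sqr => t1x.
rewrite rmorph_prod /=.
under eq_bigr do rewrite !comp3E E2 scale1r.
case/orP: t1x => /eqP ->; first by under eq_bigr do rewrite scale1r.
have add_ls : additive_seq [seq (l * y) *: X2 : {mpoly K[3]} | y <- As].
  apply: additive_seq_map add_As => [y y'|y y']; last by rewrite mulrBr scalerBl.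
  move/(congr1 (mcoeff U_(i2))); rewrite !mcoeffZ !mcoeffXU /= !mulr1.
  exact: mulfI.
have := prod_additiveN add_ls X1; rewrite !big_map => <-.
rewrite (eq_bigr (fun y => (-1) * (X1 + (l * y) *: X2))) => [|y _]; last first.
  by rewrite scaleN1r mulN1r opprD.
by rewrite big_split /= exprMn big_const_seq iter_mulr_1 -exprM mulnC exprM sqrrN !expr1n mul1r.
Qed.

Lemma sqV_inv : coord_inv sqV.
Proof.
split=> [h hH|x xT]; rewrite rmorph_prod /=; last first.
  apply: eq_bigr => k _; rewrite comp_mpolyB comp_mpolyZ comp_mpoly_exp !comp3X.
  by rewrite (quadric_diag _ tE xT); have [_ _ ->] := tE xT; rewrite scale1r.
(* Since [tau] changes the sign of [a] and keeps [b], the element [k0] lies in [B], and [b k0] is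
   the displacement of [Q] in [quadric_unip]. *)
have [hTH aT bT] := tau_conj hH; pose k0 := (h * h ^ tau)%g.
have k0B : k0 \in B by rewrite memB groupM //= (aM D) // aT subrr.
have bk0 : b k0 = 2%:R * b h - a h * c h.
  by rewrite (bM D) // bT (cE hTH) aT (cE hH); ring.
rewrite [RHS](reindex_inj (mulgI k0)) /=; apply: eq_big => [k|k kB].
  by rewrite (groupMl _ k0B).
rewrite comp_mpolyB comp_mpolyZ comp_mpoly_exp !comp3X.
by rewrite (quadric_unip b cE hH) bMB // -bk0 mulrDr scalerDl opprD addrA.
Qed.

Lemma coord_invC k : coord_inv k%:MP.
Proof. by split=> [h hH|x xT]; rewrite comp_mpolyC. Qed.

(** The row of [X2] is [(0, 0, 1)] and [sqU] is free of [X0], so two partial derivatives remain. On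
    the line they come from [e ^+ 2] and from [v] at the quadric; the derivatives of the additive
    [e] and [v] are constants, so a single factor [e] survives. *)
Lemma jacobian_sq : exists2 k, k != 0 &
  \det (map_mx (eval_line K) (jacobian [tuple X2; sqU; sqV]))
  = k *: \prod_(x <- As) ('X - (l * x)%:P).
Proof.
have add_lA : additive_seq [seq l * x | x <- As].
  by apply: additive_seq_map add_As => [x y /(mulfI l_neq0)|x y] //; rewrite mulrBr.
have add_lB : additive_seq [seq l * x | x <- Bs].
  by apply: additive_seq_map add_Bs => [x y /(mulfI l_neq0)|x y] //; rewrite mulrBr.
have [ka ka0 Eka] := additive_deriv add_lA; have [kb kb0 Ekb] := additive_deriv add_lB.
rewrite big_map in Eka; set e := \prod_(x <- As) _ in Eka *.
set v := \prod_(d <- _) _ in Ekb.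
have lineU : eval_line K sqU = e ^+ 2.
  rewrite rmorphXn rmorph_prod /=; congr (_ ^+ 2); apply: eq_bigr => x _.
  by rewrite rmorphB eval_lineZ !eval_lineE alg_polyC.
have planeU : eval_plane K sqU = (e ^+ 2)%:P.
  rewrite rmorphXn rmorph_prod /= polyC_exp rmorph_prod; congr (_ ^+ 2).
  apply: eq_bigr => x _; rewrite rmorphB eval_planeZ !eval_planeE.
  by rewrite [RHS]rmorphB /= alg_polyC.
pose q : {poly {poly K}} := ('X ^+ 2)%:P - (2%:R * l)%:P *: 'X.
have planeQ : eval_plane K Q = q.
  have E02 : eval_plane K (X0 * X2) = 'X by rewrite rmorphM !eval_planeE mulr1.
  by rewrite rmorphB eval_planeZ E02 rmorphXn eval_planeE -polyC_exp.
have planeV : eval_plane K sqV = map_poly (@polyC K) v \Po q.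
  rewrite /v big_map big_map big_enum /= !rmorph_prod; apply: eq_bigr => k _.
  rewrite rmorphB planeQ eval_planeZ rmorphXn !eval_planeE expr1n alg_polyC.
  rewrite rmorphB /= map_polyX map_polyC /= rmorphB /= comp_polyX comp_polyC.
  by [].
(* [2 ka] comes from the derivative of [e ^+ 2], [kb] from that of [v], and [- 2 l] is the
   derivative of the quadric in [X0]; the sign cancels that of the antitriangular determinant. *)
exists (2%:R * (ka * kb) * (2%:R * l)).
  by rewrite !mulf_neq0.
rewrite det3_antitriangular; first last.
- by rewrite !mxE (tnth_nth 0) /= eval_line_mderiv0 planeU derivC horner0.
- by rewrite !mxE (tnth_nth 0) /= mderiv_X rmorph0.
- by rewrite !mxE (tnth_nth 0) /= mderiv_X rmorph0.
rewrite !mxE !(tnth_nth 0) /= mderiv_X rmorph1 mul1r eval_line_mderiv1 lineU.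
rewrite eval_line_mderiv0 planeV deriv_comp deriv_map Ekb map_polyC /= comp_polyC.
have -> : q^`() = - (2%:R * l)%:P%:P by rewrite derivB derivC sub0r derivZ derivX alg_polyC.
rewrite deriv_exp /= expr1 Eka hornerM hornerN !hornerC -mul_polyC !polyCM.
rewrite [2%:R%:P]rmorph_nat; ring.
Qed.

(* Write L = q(s) in generators s vanishing at the origin. Some partial derivative of q is
   nonzero at the origin, so by Cramer's rule the linear forms a h X1 + b h X2 with
   a h <> 0 divide the Jacobian of s on X0 = 0. They then divide the Jacobian of X2, U, V,
   computed in jacobian_sq to have only |As| factors: too few. *)
Lemma quadric_not_polynomial : ~ polynomial_subring coord_inv.
Proof.
move=> /(polynomial_subring_generators coord_invC (@coord_invB _ _ _ _ _ _ _ _ _ _)).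
case=> s [sI s0 gen].
have [q Lq] := gen L (orbitX0_inv D tE).
have [i qi] := orbitX0_linear_part sI s0 Lq.
pose u := subst i0 0 (q^`M(i) \mPo s).
have u0 : u@_0 != 0.
  have zs j : tnth s j \mPo origin = 0 :> {mpoly K[3]} by rewrite comp_origin s0 mpolyC0.
  have : u \mPo origin = ((q^`M(i))@_0)%:MP :> {mpoly K[3]}.
    rewrite /u subst_comp3 comp3A !comp3E raddf0 comp_mpolyA -comp_origin.
    apply: comp_mpoly_ext => j; rewrite tnth_mktuple zs.
    by elim/ord3P: j; rewrite (tnth_nth 0).
  rewrite comp_origin => /(congr1 (mcoeff 0)); rewrite !mpolyCK => ->.
  by rewrite mcoeff_deriv mnm0E mulr1n add0m.
pose J := \det (jacobian s).
pose N := map_mx (subst i0 0) (jacobian s).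
pose L' := \prod_(h in H | h != 1%g) (X0 + (a h *: X1 + b h *: X2)) : {mpoly K[3]}.
have [a1 b1] : a 1%g = 0 /\ b 1%g = 0.
  split; first by apply: (addrI (a 1%g)); rewrite -(aM D) // mulg1 addr0.
  by apply: (addrI (b 1%g)); rewrite -bMB ?group1 // mulg1 addr0.
have LE : L = X0 * L' by rewrite /orbitX0 (bigD1 1%g) //= a1 b1 !scale0r !addr0.
pose LL := \prod_(h in H | h != 1%g) (a h *: X1 + b h *: X2) : {mpoly K[3]}.
have LLE : subst i0 0 L' = LL.
  rewrite rmorph_prod /=; apply: eq_bigr => h _.
  by rewrite subst_comp3 !comp3E add0r.
(* As [L = X0 * L'], the gradient of [L] on [X0 = 0] is [(LL, 0, 0)]; the left side is the chain
   rule for [q \mPo s]. *)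
have row j : \sum_k subst i0 0 (q^`M(k) \mPo s) * N k j = LL * (j == i0)%:R.
  have := congr1 (fun f => subst i0 0 f^`M(j)) Lq.
  rewrite LE mderivM mderiv_X rmorphD !rmorphM /= substX /= mul0r addr0 LLE.
  rewrite rmorph_nat mulrC eq_sym => ->; rewrite mderiv_comp rmorph_sum /=.
  by apply: eq_bigr => k _; rewrite rmorphM !mxE.
have uJ : u * subst i0 0 J = LL * (\adj N) i0 i.
  pose r : 'rV_3 := \row_k subst i0 0 (q^`M(k) \mPo s).
  have rN : r *m N = LL *: delta_mx 0 i0.
    apply/rowP => j; rewrite !mxE -row; apply: eq_bigr => k _; by rewrite mxE.
  have := congr1 (fun M : 'rV_3 => (M *m \adj N) 0 i) rN.
  rewrite -mulmxA mul_mx_adj mul_mx_scalar -scalemxAl -rowE !mxE mulrC => <-.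
  by rewrite -det_map_mx mulrC.
(* The slopes of the forms with [a h] nonzero, with multiplicity; the scalars [a h] and the
   remaining forms go into [w]. *)
pose ds := [seq - (b h / a h) | h <- enum H & a h != 0].
have [w Ew] : exists w, LL = (\prod_(d <- ds) (X1 - d *: X2)) * w.
  rewrite /LL (bigID (fun h => a h == 0)) /= mulrC.
  rewrite (eq_bigl (fun h => (h \in H) && (a h != 0))); last first.
    move=> h; rewrite -andbA; congr (_ && _); case: eqP => //= ->.
    by rewrite a1 eqxx.
  rewrite (eq_bigr (fun h => (a h)%:MP * (X1 - (- (b h / a h)) *: X2))); last first.
    move=> h /andP[hH ah]; rewrite mul_mpolyC scaleNr opprK scalerDr scalerA.
    by rewrite mulrCA mulfV // mulr1.
  rewrite big_split /= [X in X * _]mulrC -mulrA; eexists.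
  by rewrite /ds big_map big_filter big_enum_cond.
have [w' Jw] : exists w', subst i0 0 J = (\prod_(d <- ds) (X1 - d *: X2)) * w'.
  by apply: (@prime_cancel _ ds u _ (w * (\adj N) i0 i)); rewrite // uJ Ew mulrA.
have [M Mt] : exists M : 3.-tuple {mpoly K[3]},
    [tuple X2; sqU; sqV] = [tuple tnth M k \mPo s | k < 3].
  have [q0 E0] := gen _ (X2_inv _ _ _ _ tE); have [q1 E1] := gen _ sqU_inv.
  have [q2 E2] := gen _ sqV_inv; exists [tuple q0; q1; q2].
  apply/eq_from_tnth; elim/ord3P; by rewrite tnth_mktuple !(tnth_nth 0).
have [k k0 Ek] := jacobian_sq; set e := \prod_(x <- As) _ in Ek.
(* [X2], [sqU] and [sqV] are polynomials in [s], so the Jacobian of [s] divides theirs. *)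
have dvd_e : \prod_(d <- ds) ('X - d%:P) %| k *: e.
  rewrite -Ek Mt jacobian_comp map_mxM det_mulmx [X in _ * X]det_map_mx.
  rewrite -/J -[eval_line K J]eval_line_subst0 Jw rmorphM.
  have -> : eval_line K (\prod_(d <- ds) (X1 - d *: X2)) = \prod_(d <- ds) ('X - d%:P).
    rewrite rmorph_prod; apply: eq_bigr => d _.
    by rewrite rmorphB eval_lineZ !eval_lineE alg_polyC.
  by rewrite dvdp_mull // dvdp_mulIl.
have e0 : e != 0.
  by rewrite prodf_seq_neq0; apply/allP => x _ /=; rewrite polyXsubC_eq0.
have := dvdp_leq _ dvd_e; rewrite scaler_eq0 negb_or k0 e0 => /(_ isT).
rewrite size_scale // !size_prod_XsubC ltnS size_map size_filter.
have := count_predC (fun h => a h == 0) (enum H); rewrite -cardE card_H.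
have -> : count (fun h => a h == 0) (enum H) = #|B|.
  by rewrite -sum1_count big_enum_cond sum1_card; apply: eq_card => h; rewrite memB.
rewrite -[count (predC _) _]/(count (fun h => a h != 0) (enum H)).
by move=> E le; apply: (size_bound card_B3 size_As3 E le).
Qed.

End NonPolynomial.

(** By counting, [phi] maps [H1] onto itself, so all its values on [H] are already taken on [H1]. *)
Lemma inj_in_surj (gT : finGroupType) (H H1 : {set gT}) (phi : gT -> gT) :
  H1 \subset H -> {in H, forall h, phi h \in H1} -> {in H1 &, injective phi} ->
  {in H, forall h, exists2 h1, h1 \in H1 & phi h1 = phi h}.
Proof.
move=> sub phiH1 inj h hH.
have /eqP im : phi @: H1 == H1.
  rewrite eqEcard card_in_imset // leqnn andbT.
  by apply/subsetP => _ /imsetP[k kH ->]; apply/phiH1/(subsetP sub).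
have : phi h \in phi @: H1 by rewrite im phiH1.
by case/imsetP => h1 h1H ->; exists h1.
Qed.

(** * The criterion for an abelian [H] in coordinates *)

Section Cases.

Variables (K : closedFieldType) (p : nat) (gT : finGroupType) (H T : {group gT}).
Variables (a b c t0 t1 t2 : gT -> K).
Hypothesis D : triangular_data H T a b c t0 t1 t2.
Hypothesis charK : p \in [pchar K].
Hypothesis odd_p : odd p.
Hypothesis pH : (p.-group H)%g.
Hypothesis abH : abelian H.
Hypothesis t_inj : {in T, forall x, t0 x = 1 -> t1 x = 1 -> t2 x = 1 -> x = 1%g}.
Definition transv_set := [set h in H | (h != 1%g) && (a h * c h == 0)].
Hypothesis genH : (forall x, x \in T -> x = 1%g) -> <<transv_set>>%g = H.
Notation coord_inv := (coord_inv H T a b c t0 t1 t2).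

Lemma two_neq0 : 2%:R != 0 :> K.
Proof.
rewrite -(dvdn_pcharf charK); apply/negP => p2.
have := dvdn_leq (isT : 0 < 2)%N p2; have := prime_gt1 (pcharf_prime charK).
case: p odd_p => [|[|[|]]] //.
Qed.

Lemma ac_comm x y : x \in H -> y \in H -> a x * c y = a y * c x.
Proof.
move=> xH yH; have := congr1 b (centsP abH _ xH _ yH).
by rewrite !(bM D) // [b y + b x]addrC => /addrI.
Qed.

Lemma abc1 : [/\ a 1%g = 0, b 1%g = 0 & c 1%g = 0].
Proof.
have a1 : a 1%g = 0 by apply: (addrI (a 1%g)); rewrite -(aM D) // mulg1 addr0.
have c1 : c 1%g = 0 by apply: (addrI (c 1%g)); rewrite -(cM D) // mulg1 addr0.
split=> //; apply: (addrI (b 1%g)).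
by have := bM D (group1 H) (group1 H); rewrite mulg1 a1 mul0r !addr0.
Qed.

Lemma conjH x h : x \in T -> h \in H -> (h ^ x)%g \in H.
Proof. by move=> xT hH; rewrite memJ_norm // (subsetP (nHT D)). Qed.

Lemma inv_entries : {in H, forall h, [/\ h^-1%g \in H, a h^-1%g = - a h & c h^-1%g = - c h]}.
Proof.
move=> h hH; have hV : h^-1%g \in H by rewrite groupV.
have [a1 _ c1] := abc1; split=> //.
  by apply: (addrI (a h)); rewrite -(aM D) // mulgV a1 subrr.
by apply: (addrI (c h)); rewrite -(cM D) // mulgV c1 subrr.
Qed.

(** Conjugation by the reflection [x] changes only one of [b] and [c]. The commutator map [phi]
    therefore kills the other one and multiplies this one by a nonzero scalar, so it is injective on
    the subgroup where the other one vanishes, and counting yields the splitting. *)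
Lemma split_coordinate x : {in H, forall h, a h = 0} -> x \in T ->
  coord_refl t0 t1 t2 x -> (t0 x != 1) || (t1 x != 1) ->
  {in H, forall h, exists2 h1, h1 \in H & b h1 = b h /\ c h1 = 0}.
Proof.
move=> a0 xT rx nx h hH; have [n0 n1 n2] := t_neq0 D xT.
have bMa : {in H &, {morph b : x y / (x * y)%g >-> x + y}}.
  by move=> y z yH zH; rewrite (bM D) // a0 // mul0r addr0.
have bV k : k \in H -> b k^-1%g = - b k.
  have [_ b1 _] := abc1.
  by move=> kH; apply: (addrI (b k)); rewrite -bMa ?groupV // mulgV b1 subrr.
have cV k : k \in H -> c k^-1%g = - c k by move=> kH; have [] := inv_entries kH.
pose phi k := (k ^ x * k^-1)%g.
have phiH k : k \in H -> phi k \in H by move=> kH; rewrite groupM ?groupV // conjH.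
have bphi k : k \in H -> t0 x * b (phi k) = (t2 x - t0 x) * b k.
  move=> kH; rewrite bMa ?groupV ?conjH // bV // mulrDr (bJ D) // mulrBl.
  by rewrite mulrN.
have cphi k : k \in H -> t1 x * c (phi k) = (t2 x - t1 x) * c k.
  move=> kH; rewrite (cM D) ?groupV ?conjH // cV // mulrDr (cJ D) // mulrBl.
  by rewrite mulrN.
have [t0x|t0x] := eqVneq (t0 x) 1; last first.
  have [t1x t2x] : t1 x = 1 /\ t2 x = 1.
    by move: rx; rewrite /coord_refl (negPf t0x) /= orbF => /andP[/eqP ? /eqP].
  have d0 : t2 x - t0 x != 0 by rewrite t2x subr_eq0 eq_sym.
  have [|||h1] := @inj_in_surj _ H [set k in H | c k == 0] phi _ _ _ h hH.
  - by apply/subsetP => k; rewrite inE => /andP[].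
  - move=> k kH; rewrite inE phiH //=; apply/eqP/(mulfI n1).
    by rewrite cphi // t1x t2x subrr mul0r mulr0.
  - move=> k k'; rewrite !inE => /andP[kH /eqP ck] /andP[k'H /eqP ck'] E.
    apply: (abc_inj D) => //; rewrite ?a0 ?ck ?ck' //.
    by apply: (mulfI d0); rewrite -!bphi // E.
  rewrite inE => /andP[h1H /eqP ch1] E; exists h1 => //; split=> //.
  by apply: (mulfI d0); rewrite -!bphi // E.
have t1x : t1 x != 1 by move: nx; rewrite t0x eqxx.
have t2x : t2 x = 1.
  by move: rx; rewrite /coord_refl (negPf t1x) t0x eqxx /= orbF => /eqP.
have d1 : t2 x - t1 x != 0 by rewrite t2x subr_eq0 eq_sym.
have [|||h2] := @inj_in_surj _ H [set k in H | b k == 0] phi _ _ _ h hH.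
- by apply/subsetP => k; rewrite inE => /andP[].
- move=> k kH; rewrite inE phiH //=; apply/eqP/(mulfI n0).
  by rewrite bphi // t0x t2x subrr mul0r mulr0.
- move=> k k'; rewrite !inE => /andP[kH /eqP bk] /andP[k'H /eqP bk'] E.
  apply: (abc_inj D) => //; rewrite ?a0 ?bk ?bk' //.
  by apply: (mulfI d1); rewrite -!cphi // E.
rewrite inE => /andP[h2H /eqP bh2] E.
have ch2 : c h2 = c h by apply: (mulfI d1); rewrite -!cphi // E.
exists (h * h2^-1)%g; first by rewrite groupM ?groupV.
by rewrite bMa ?groupV // (cM D) ?groupV // bV // cV // bh2 ch2 subrr oppr0 addr0.
Qed.

(** One nonzero [c h1] forces [a h1 = 0], and then [a = 0] on [H] by [ac_comm]. If no reflection
    moves [X0] or [X1], then neither does [T], which they generate. *)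
Lemma polynomial_of_ac0 : {in H, forall h, a h * c h = 0} -> polynomial_subring coord_inv.
Proof.
move=> ac0; have [c0|/forall_inPn[h1 h1H ch1]] := boolP [forall h in H, c h == 0].
  by apply: (polynomial_c0 D) => h hH; apply/eqP/(forall_inP c0).
have a0 : {in H, forall h, a h = 0}.
  move=> h hH; have /eqP := ac0 h1 h1H; rewrite mulf_eq0 (negPf ch1) orbF => /eqP ah1.
  by apply: (mulIf ch1); rewrite ac_comm // ah1 !mul0r.
have [t01|] := boolP [forall x in T, (t0 x == 1) && (t1 x == 1)].
  apply: (polynomial_a0_nonsplit charK D a0) => x xT.
  by have /andP[/eqP-> /eqP->] := forall_inP t01 x xT.
case/forall_inPn => x xT nx.
have [[y yT /andP[ry ny]]|none] := altP (@exists_inP _ (mem T)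
    (fun x => coord_refl t0 t1 t2 x && ((t0 x != 1) || (t1 x != 1)))).
  exact: (polynomial_a0_split D a0 (split_coordinate a0 yT ry ny)).
case/negP: nx; apply: (genT_ind D (P := fun x => (t0 x == 1) && (t1 x == 1))) xT.
- by rewrite (t0_1 D) (t1_1 D) !eqxx.
- move=> u v uT vT /andP[/eqP u0 /eqP u1] /andP[/eqP v0 /eqP v1].
  by rewrite (t0M D) // (t1M D) // u0 u1 v0 v1 mulr1 eqxx.
- move=> u uT ru; apply: contraNT none => nu; apply/exists_inP; exists u => //.
  by rewrite ru /= -negb_and.
Qed.

Lemma polynomial_coord_invP : polynomial_subring coord_inv <->
  <<transv_set>>%g = H \/ {in H, forall h, a h * c h = 0 -> h = 1%g}.
Proof.
have [ac0|/forall_inPn[h0 h0H ac0]] := boolP [forall h in H, a h * c h == 0].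
  split=> [_|_]; last first.
    by apply: polynomial_of_ac0 => h hH; apply/eqP/(forall_inP ac0).
  left; apply/eqP; rewrite eqEsubset gen_subG; apply/andP; split.
    by apply/subsetP => h; rewrite inE => /andP[].
  apply/subsetP => h hH; have [->|h1] := eqVneq h 1%g; first exact: group1.
  by apply: mem_gen; rewrite inE hH h1 (forall_inP ac0).
have [ah0 ch0] : a h0 != 0 /\ c h0 != 0 by apply/andP; rewrite -negb_or -mulf_eq0.
pose l := c h0 / a h0; have l0 : l != 0 by rewrite mulf_neq0 ?invr_eq0.
have cE : {in H, forall h, c h = l * a h}.
  by move=> h hH; apply: (mulfI ah0); rewrite ac_comm // mulrCA mulrA divfK // mulrC.
have ker : {in H, forall h, a h * c h = 0 -> a h = 0 /\ c h = 0}.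
  move=> h hH; rewrite cE // mulrCA => /eqP; rewrite mulf_eq0 (negPf l0) -expr2 expf_eq0.
  by move=> /eqP ->; rewrite mulr0.
(* Now [a h * c h = 0] means [a h = 0], so [transv_set] lies in the kernel of [a], which misses
   [h0]. *)
have not_gen : <<transv_set>>%g <> H.
  move=> gen; have sub : <<transv_set>>%g \subset Group (ker_a_group_set D).
    rewrite gen_subG; apply/subsetP => h; rewrite !inE => /and3P[hH _ /eqP ac].
    by have [-> _] := ker h hH ac; rewrite hH eqxx.
  rewrite gen in sub; have := subsetP sub h0 h0H.
  by rewrite inE (negPf ah0) andbF.
(* Conjugation by [x] multiplies [a] by [t1 x / t0 x] and [c] by [t2 x / t1 x]; preserving [c = l a]
   makes the two ratios equal. *)
have tsq x : x \in T -> t0 x * t2 x = t1 x ^+ 2.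
  move=> xT; have [n0 n1 n2] := t_neq0 D xT.
  have := cE _ (conjH xT h0H) => E; have Ea := aJ D xT h0H; have Ec := cJ D xT h0H.
  have F : t0 x * (t2 x * c h0) = t1 x * l * (t1 x * a h0) by rewrite -Ec E -Ea; ring.
  rewrite (cE _ h0H) in F; apply: (mulIf (mulf_neq0 l0 ah0)).
  by rewrite -[LHS]mulrA F; ring.
have tE : {in T, forall x, [/\ t0 x = 1, t1 x ^+ 2 = 1 & t2 x = 1]}.
  apply: (genT_ind D) => [|x y xT yT [x0 x1 x2] [y0 y1 y2]|x xT rx].
  - by rewrite (t0_1 D) (t1_1 D) (t2_1 D) expr1n.
  - by rewrite (t0M D) // (t1M D) // (t2M D) // exprMn x0 x1 x2 y0 y1 y2 !mulr1.
  have := tsq x xT; case/or3P: rx => /andP[/eqP E /eqP E']; rewrite E E' ?mulr1 ?mul1r ?expr1n.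
  - by move=> ->.
  - by move=> <-.
  - by move=> ->.
(* If [t1] is trivial then [T] is trivial, and [genH] contradicts [not_gen]. *)
have [[tau tauT t1tau]|none] := altP (@exists_inP _ (mem T) (fun x => t1 x != 1)); last first.
  case: not_gen; apply: genH => x xT; have [x0 _ x2] := tE x xT.
  apply: t_inj => //; apply/eqP; apply: contraNT none => n1.
  by apply/exists_inP; exists x.
have t1N : t1 tau = -1.
  have [_ /eqP + _] := tE tau tauT; rewrite -{1}(expr1n _ 2) eqf_sqr (negPf t1tau) /=.
  by move/eqP.
split=> [poly|].
  right=> z zH /(ker z zH)[az cz]; apply/eqP/negPn/negP => z1.
  have bz : b z != 0.
    apply: contraNneq z1 => bz; have [a1 b1 c1] := abc1.
    by apply/eqP/(abc_inj D); rewrite ?az ?bz ?cz ?a1 ?b1 ?c1.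
  exact: (quadric_not_polynomial D charK pH two_neq0 l0 cE tE tauT t1N zH az bz h0H ah0 poly).
case=> [/not_gen //|notransv].
apply: (polynomial_quadric D two_neq0 cE tE tauT t1N) => h hH.
(* [h * h ^ tau] has [a = 0], so it is trivial in the absence of transvections; the vanishing of its
   entry [b] is the relation [2 b = a c]. *)
have [hTH aT bT] := tau_conj D tE tauT t1N hH.
have kH : (h * h ^ tau)%g \in H by rewrite groupM.
have ak : a (h * h ^ tau)%g = 0 by rewrite (aM D) // aT subrr.
have k1 := notransv _ kH; rewrite ak mul0r in k1.
have [_ b1 _] := abc1; have := b1; rewrite -(k1 erefl) (bM D) // bT (cE _ hTH) aT (cE _ hH).
by move/eqP; rewrite mulrN mulrN subr_eq0 => /eqP <-; rewrite mulr_natl mulr2n.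
Qed.

End Cases.

(** * From linear groups to coordinates *)

(* Kronecker substitution: X_i is sent to a power X^(d^i) with d exceeding all exponents. *)
Lemma mpoly_eval_eq0 (K : closedFieldType) (f : {mpoly K[3]}) :
  (forall v, f.@[v] = 0) -> f = 0.
Proof.
move=> f0; pose d := msize f.
pose e (m : 'X_{1..3}) := (m i0 + (m i1 + m i2 * d) * d)%N.
have e_inj : {in msupp f &, injective e}.
  move=> m m' mf m'f.
  have lt_d (n : 'X_{1..3}) i : n \in msupp f -> (n i < d)%N.
    move=> /msize_mdeg_lt; apply: leq_ltn_trans.
    by rewrite mdegE (bigD1 i) //= leq_addr.
  have d0 : (0 < d)%N by apply: leq_ltn_trans (lt_d m i0 mf).
  rewrite /e => E.
  have E0 : m i0 = m' i0.
    by have := congr1 (modn^~ d) E; rewrite /= !(addnC (_ i0)) !modnMDl !modn_small ?lt_d.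
  have E12 : (m i1 + m i2 * d = m' i1 + m' i2 * d)%N.
    by apply/eqP; rewrite -(eqn_pmul2r d0); apply/eqP/(@addnI (m i0)); rewrite E E0.
  have E1 : m i1 = m' i1.
    by have := congr1 (modn^~ d) E12; rewrite /= !(addnC (_ i1)) !modnMDl !modn_small ?lt_d.
  apply/mnmP; elim/ord3P => //; apply/eqP; rewrite -(eqn_pmul2r d0); apply/eqP.
  by apply: (@addnI (m i1)); rewrite E12 E1.
pose q : {poly K} := \sum_(m <- msupp f) f@_m *: 'X^(e m).
have q0 : q = 0.
  apply/eqP/negPn/negP => /closed_nonrootP[x]; rewrite /root.
  pose v (i : 'I_3) := tnth [tuple x; x ^+ d; x ^+ (d * d)] i.
  have -> : q.[x] = f.@[v].
    rewrite mevalE horner_sum; apply: eq_bigr => m _.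
    rewrite hornerZ hornerXn; congr (_ * _); rewrite big_ord3 /e /v !(tnth_nth 0) /=.
    rewrite -!exprM -!exprD; congr (x ^+ _).
    by rewrite mulnDl addnA (mulnC d) (mulnC (d * d)%N) mulnA.
  by rewrite f0 eqxx.
apply/mpolyP => m; rewrite mcoeff0; apply/eqP; rewrite mcoeff_eq0; apply/negP => mf.
have := congr1 (fun r : {poly K} => r`_(e m)) q0.
rewrite coef0 coef_sum (big_rem m) //= coefZ coefXn eqxx mulr1 big_seq big1 ?addr0.
  by move/eqP; rewrite mcoeff_eq0 mf.
move=> m' m'f; have m'S : m' \in msupp f by apply: mem_rem m'f.
rewrite coefZ coefXn; case: eqP => [/e_inj E|]; last by rewrite mulr0.
by move: m'f; rewrite -E // mem_rem_uniq ?msupp_uniq // inE eqxx.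
Qed.

Lemma polynomial_subring_transport (K : fieldType) (S S' : {mpoly K[3]} -> Prop)
    (s t : 3.-tuple {mpoly K[3]}) :
  (forall f, (f \mPo s) \mPo t = f) -> (forall f, (f \mPo t) \mPo s = f) ->
  (forall f, S f <-> S' (f \mPo s)) -> polynomial_subring S <-> polynomial_subring S'.
Proof.
move=> st ts SS'; split=> [] [m [phi [inj_phi SE]]].
  exists m, (comp_mpoly s \o phi); split.
    by move=> q q' /= /(congr1 (comp_mpoly t)); rewrite !st => /inj_phi.
  move=> f; rewrite -(ts f) -SS' SE; split=> [] [q Eq]; exists q.
    by rewrite /= Eq.
  by rewrite -(st (phi q)) -[(phi q) \mPo s]/((comp_mpoly s \o phi) q) Eq ts.
exists m, (comp_mpoly t \o phi); split.
  by move=> q q' /= /(congr1 (comp_mpoly s)); rewrite !ts => /inj_phi.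
move=> f; rewrite SS' SE; split=> [] [q Eq]; exists q.
  by rewrite /= Eq st.
by rewrite -Eq /= ts.
Qed.

Definition mx_tuple (R : nzRingType) (A : 'M[R]_3) : 3.-tuple {mpoly R[3]} :=
  [tuple \sum_j A i j *: 'X_j | i < 3].

Section CoordMatrix.

Variables (K : fieldType) (W : vectType K) (e : 3.-tuple W).
Hypothesis basis_e : basis_of {:W} e.
Implicit Types (f g : 'End(W)) (w : W).

Definition endmx f : 'M[K]_3 := \matrix_(i, j) coord e i (f e`_j).

Lemma coord_expand w : w = \sum_j coord e j w *: e`_j.
Proof. exact/coord_basis/memvf. Qed.

Lemma coord_lin (k : 'I_3 -> K) i : coord e i (\sum_j k j *: e`_j) = k i.
Proof. exact/coord_sum_free/(basis_free basis_e). Qed.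

Lemma coord_inj w w' : (forall i, coord e i w = coord e i w') -> w = w'.
Proof.
by move=> E; rewrite (coord_expand w) (coord_expand w'); apply: eq_bigr => i _; rewrite E.
Qed.

Lemma coord_endmx f w i : coord e i (f w) = \sum_j endmx f i j * coord e j w.
Proof.
rewrite {1}(coord_expand w) !linear_sum /=; apply: eq_bigr => j _.
by rewrite !linearZ /= mxE mulrC.
Qed.

Lemma endmx_comp f g : endmx (f \o g)%VF = endmx f *m endmx g.
Proof.
apply/matrixP => i j; rewrite !mxE comp_lfunE coord_endmx.
by apply: eq_bigr => k _; rewrite [endmx g k j]mxE.
Qed.

Lemma endmx1 : endmx \1%VF = 1%:M.
Proof. by apply/matrixP => i j; rewrite !mxE id_lfunE coord_free ?(basis_free basis_e) // eq_sym. Qed.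

Lemma endmx_inj : injective endmx.
Proof.
move=> f g E; apply/lfunP => w; apply: coord_inj => i.
by rewrite !coord_endmx E.
Qed.

Lemma regular_fun_end (p : {mpoly K[3]}) f w :
  p.@[fun i => coord e i (f w)] = (p \mPo mx_tuple (endmx f)).@[fun i => coord e i w].
Proof.
rewrite comp_mpoly_meval; apply: meval_eq => i; rewrite tnth_mktuple coord_endmx.
by rewrite raddf_sum /=; apply: eq_bigr => j _; rewrite mevalZ mevalXU.
Qed.

End CoordMatrix.

(** Inverses disappear because [g] runs over a group, and equality of values becomes equality of
    polynomials by [mpoly_eval_eq0]. *)
Lemma invariantP (K : closedFieldType) (W : vectType K) (e : 3.-tuple W)
    (gT : finGroupType) (G : {group gT}) (rho : gT -> 'End(W)) p :
  basis_of {:W} e ->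
  invariant e G rho p <->
  {in G, forall g, p \mPo mx_tuple (endmx e (rho g)) = p}.
Proof.
move=> basis_e; split=> [inv g gG|inv g gG w].
  apply/eqP; rewrite -subr_eq0; apply/eqP/mpoly_eval_eq0 => v.
  pose w := \sum_j v j *: e`_j.
  have vE : v =1 fun i => coord e i w by move=> i; rewrite coord_lin.
  have gV : (g^-1)%g \in G by rewrite groupV.
  have := inv _ gV w; rewrite invgK /regular_fun (regular_fun_end basis_e).
  by rewrite mevalB !(meval_eq _ vE) => ->; rewrite subrr.
have gV : (g^-1)%g \in G by rewrite groupV.
by rewrite /regular_fun (regular_fun_end basis_e) inv.
Qed.

Lemma polynomial_invariants_basis (K : closedFieldType) (W : vectType K) (e v : 3.-tuple W)
    (gT : finGroupType) (G : {group gT}) (rho : gT -> 'End(W)) :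
  basis_of {:W} e -> basis_of {:W} v ->
  polynomial_invariants e G rho <-> polynomial_invariants v G rho.
Proof.
move=> basis_e basis_v.
pose C (x y : 3.-tuple W) := mx_tuple (\matrix_(i < 3, j < 3) coord x i y`_j).
have CE (x y : 3.-tuple W) (p : {mpoly K[3]}) w : basis_of {:W} y ->
    p.@[fun i => coord x i w] = (p \mPo C x y).@[fun i => coord y i w].
  move=> basis_y; rewrite comp_mpoly_meval; apply: meval_eq => i; rewrite tnth_mktuple.
  rewrite {1}(coord_expand basis_y w) !raddf_sum /=; apply: eq_bigr => j _.
  by rewrite linearZ /= mevalZ mevalXU mxE mulrC.
have CK (x y : 3.-tuple W) (p : {mpoly K[3]}) : basis_of {:W} x -> basis_of {:W} y ->
    (p \mPo C x y) \mPo C y x = p.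
  move=> basis_x basis_y; apply/eqP; rewrite -subr_eq0; apply/eqP/mpoly_eval_eq0 => u.
  pose w := \sum_j u j *: x`_j.
  have uE : u =1 fun i => coord x i w by move=> i; rewrite coord_lin.
  by rewrite mevalB !(meval_eq _ uE) -!CE // subrr.
apply: (polynomial_subring_transport (s := C e v) (t := C v e)) => [f|f|f].
- exact: CK.
- exact: CK.
by split=> inv g gG w; have := inv g gG w; rewrite /regular_fun !(CE e v).
Qed.

(** * A single upper triangular endomorphism *)

Section TriangularEndomorphism.

Variables (K : fieldType) (W : vectType K) (e : 3.-tuple W) (f : 'End(W)).
Hypothesis basis_e : basis_of {:W} e.
Hypothesis dimW : \dim {:W} = 3%N.
Hypothesis tri_f : upper_triangular e f.
Notation A := (endmx e f).

Lemma tri_entries : [/\ A i1 i0 = 0, A i2 i0 = 0 & A i2 i1 = 0].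
Proof. by split; rewrite mxE; apply: tri_f. Qed.

Lemma coord_tri w : [/\ coord e i0 (f w) =
    A i0 i0 * coord e i0 w + A i0 i1 * coord e i1 w + A i0 i2 * coord e i2 w,
  coord e i1 (f w) = A i1 i1 * coord e i1 w + A i1 i2 * coord e i2 w
  & coord e i2 (f w) = A i2 i2 * coord e i2 w].
Proof.
have [E10 E20 E21] := tri_entries.
by split; rewrite (coord_endmx basis_e) big_ord3 /= ?E10 ?E20 ?E21 ?mul0r ?add0r.
Qed.

Lemma coord_triB w : [/\ coord e i0 ((f - \1)%VF w) =
    (A i0 i0 - 1) * coord e i0 w + A i0 i1 * coord e i1 w + A i0 i2 * coord e i2 w,
  coord e i1 ((f - \1)%VF w) = (A i1 i1 - 1) * coord e i1 w + A i1 i2 * coord e i2 w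
  & coord e i2 ((f - \1)%VF w) = (A i2 i2 - 1) * coord e i2 w].
Proof.
have [E0 E1 E2] := coord_tri w.
by split; rewrite add_lfunE opp_lfunE id_lfunE !raddfB /= ?E0 ?E1 ?E2; ring.
Qed.

Lemma coord_basisE (i j : 'I_3) : coord e i e`_j = (j == i)%:R.
Proof. by rewrite coord_free // (basis_free basis_e). Qed.

Lemma coord_e : ((coord e i0 e`_0 = 1) * (coord e i1 e`_0 = 0) * (coord e i2 e`_0 = 0)
  * (coord e i0 e`_1 = 0) * (coord e i1 e`_1 = 1) * (coord e i2 e`_1 = 0)
  * (coord e i0 e`_2 = 0) * (coord e i1 e`_2 = 0) * (coord e i2 e`_2 = 1))%type.
Proof.
by do !split; [apply: (coord_basisE i0 i0)|apply: (coord_basisE i1 i0)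
 |apply: (coord_basisE i2 i0)|apply: (coord_basisE i0 i1)|apply: (coord_basisE i1 i1)
 |apply: (coord_basisE i2 i1)|apply: (coord_basisE i0 i2)|apply: (coord_basisE i1 i2)
 |apply: (coord_basisE i2 i2)].
Qed.

(** Applying [f - 1] repeatedly to a basis vector gives powers of a diagonal entry minus 1 as
    leading coordinate; conversely, a strictly triangular matrix of size 3 has cube 0. *)
Lemma unipotent_diag : unipotent f <-> [/\ A i0 i0 = 1, A i1 i1 = 1 & A i2 i2 = 1].
Proof.
split=> [[k nil]|[d0 d1 d2]]; last first.
  set g := (f - \1)%VF.
  have G w : [/\ coord e i0 (g w) = A i0 i1 * coord e i1 w + A i0 i2 * coord e i2 w,
      coord e i1 (g w) = A i1 i2 * coord e i2 w & coord e i2 (g w) = 0].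
    by have [-> -> ->] := coord_triB w; rewrite d0 d1 d2 subrr !mul0r !add0r.
  exists 3%N => w; apply: (coord_inj basis_e) => i; rewrite linear0.
  have [E0 E1 E2] := G (g (g w)); have [F0 F1 F2] := G (g w); have [G0 G1 G2] := G w.
  elim/ord3P: i; first by rewrite E0 F1 F2 G2 !mulr0 addr0.
    by rewrite E1 F2 mulr0.
  by rewrite E2.
have nilX (x : K) : (x - 1) ^+ k = 0 -> x = 1.
  by move/eqP; rewrite expf_eq0 subr_eq0 => /andP[_ /eqP].
split; apply: nilX.
- have it n : [/\ coord e i0 (iter n (f - \1)%VF e`_i0) = (A i0 i0 - 1) ^+ n,
      coord e i1 (iter n (f - \1)%VF e`_i0) = 0 & coord e i2 (iter n (f - \1)%VF e`_i0) = 0].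
    elim: n => [|n [I0 I1 I2]]; first by rewrite /= !coord_e expr0.
    rewrite iterS; have [-> -> ->] := coord_triB (iter n (f - \1)%VF e`_i0).
    by rewrite I0 I1 I2 !mulr0 !addr0 exprS.
  by have [<- _ _] := it k; rewrite nil linear0.
- have it n : coord e i1 (iter n (f - \1)%VF e`_i1) = (A i1 i1 - 1) ^+ n
      /\ coord e i2 (iter n (f - \1)%VF e`_i1) = 0.
    elim: n => [|n [I1 I2]]; first by rewrite /= !coord_e expr0.
    rewrite iterS; have [_ -> ->] := coord_triB (iter n (f - \1)%VF e`_i1).
    by rewrite I1 I2 !mulr0 !addr0 exprS.
  by have [<- _] := it k; rewrite nil linear0.
- have it n : coord e i2 (iter n (f - \1)%VF e`_i2) = (A i2 i2 - 1) ^+ n.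
    elim: n => [|n I2]; first by rewrite /= !coord_e expr0.
    rewrite iterS; have [_ _ ->] := coord_triB (iter n (f - \1)%VF e`_i2).
    by rewrite I2 exprS.
  by have <- := it k; rewrite nil linear0.
Qed.

Lemma pseudoreflection_line : pseudoreflection f ->
  exists u, forall w, exists k, (f - \1)%VF w = k *: u.
Proof.
rewrite /pseudoreflection dimW /= => /eqP dk.
have := limg_ker_dim (f - \1)%VF fullv; rewrite capfv dk dimW => /eqP.
rewrite (eqn_add2l 2 _ 1) => /eqP di; set U := limg _ in di.
exists (vpick U) => w; apply/vlineP.
suff -> : <[vpick U]>%VS = U by apply/memv_img/memvf.
apply/eqP; rewrite eqEdim -memvE memv_pick di dim_vline.
by rewrite vpick0 -dimv_eq0 di.
Qed.

Lemma line_pseudoreflection u : f != \1%VF ->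
  (forall w, exists k, (f - \1)%VF w = k *: u) -> pseudoreflection f.
Proof.
move=> f1 lin; rewrite /pseudoreflection dimW /=.
have := limg_ker_dim (f - \1)%VF fullv; rewrite capfv dimW => E.
suff di : \dim (limg (f - \1)%VF) = 1%N by move: E; rewrite di addn1 => -[->].
apply/eqP; rewrite eqn_leq; apply/andP; split.
  apply: (@leq_trans (\dim <[u]>)); last by rewrite dim_vline leq_b1.
  apply/dimvS/subvP => _ /memv_imgP[w _ ->]; have [k ->] := lin w.
  by rewrite memvZ ?memv_line.
rewrite lt0n dimv_eq0; apply: contra f1 => /eqP im0.
rewrite -subr_eq0; apply/eqP/lfunP => w; rewrite zero_lfunE; apply/eqP.
by rewrite -memv0 -im0 memv_img ?memvf.
Qed.

Lemma pseudoreflection_minor : pseudoreflection f -> forall i j k l : 'I_3,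
  (A i j - (i == j)%:R) * (A k l - (k == l)%:R)
  = (A i l - (i == l)%:R) * (A k j - (k == j)%:R).
Proof.
move=> /pseudoreflection_line[u lin] i j k l.
have Aij (x y : 'I_3) : A x y - (x == y)%:R = coord e x ((f - \1)%VF e`_y).
  by rewrite add_lfunE opp_lfunE id_lfunE raddfB /= coord_basisE mxE eq_sym.
rewrite !Aij; have [a ->] := lin e`_j; have [b ->] := lin e`_l.
by rewrite !linearZ /=; ring.
Qed.

(** [f - 1] has rank one, and its principal 2 by 2 minors are products of two diagonal entries. *)
Lemma pseudoreflection_diag : pseudoreflection f ->
  [|| (A i1 i1 == 1) && (A i2 i2 == 1), (A i0 i0 == 1) && (A i2 i2 == 1)
   | (A i0 i0 == 1) && (A i1 i1 == 1)].
Proof.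
move=> /pseudoreflection_minor mi; have [E10 E20 E21] := tri_entries.
have := mi i0 i0 i1 i1; have := mi i0 i0 i2 i2; have := mi i1 i1 i2 i2.
rewrite /= E10 E20 E21 !subr0 !mulr0.
have dd (x y : K) : (x - 1) * (y - 1) = 0 -> (x == 1) || (y == 1).
  by move/eqP; rewrite mulf_eq0 !subr_eq0.
move=> /dd d12 /dd d02 /dd d01; move: d12 d02 d01.
by case: (A i0 i0 == 1); case: (A i1 i1 == 1); case: (A i2 i2 == 1).
Qed.

(** The minor of [f - 1] on rows 0, 1 and columns 1, 2 is [A i0 i1 * A i1 i2]; when it vanishes, the
    image lies on an explicit line. *)
Lemma unipotent_pseudoreflection : unipotent f ->
  pseudoreflection f = (f != \1%VF) && (A i0 i1 * A i1 i2 == 0).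
Proof.
move=> /unipotent_diag[d0 d1 d2]; have [E10 E20 E21] := tri_entries.
apply/idP/andP => [ps|[f1 ac0]].
  split.
    apply: contraTneq ps => ->; rewrite /pseudoreflection subrr.
    have -> : lker (0 : 'End(W)) = fullv.
      by apply/vspaceP => w; rewrite memv_ker zero_lfunE eqxx memvf.
    by rewrite dimW.
  have := pseudoreflection_minor ps i0 i1 i1 i2.
  by rewrite /= d1 subrr mulr0 !subr0 => ->.
move: ac0; rewrite mulf_eq0 => /orP[a0|c0].
  apply: (@line_pseudoreflection (A i0 i2 *: e`_i0 + A i1 i2 *: e`_i1)) => // w.
  exists (coord e i2 w); apply: (coord_inj basis_e).
  have [E0 E1 E2] := coord_triB w; rewrite d0 d1 d2 (eqP a0) in E0 E1 E2.
  apply: ord3P; rewrite ?E0 ?E1 ?E2 linearZ linearD !linearZ /= !coord_e; ring.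
apply: (@line_pseudoreflection e`_i0) => // w.
exists (A i0 i1 * coord e i1 w + A i0 i2 * coord e i2 w); apply: (coord_inj basis_e).
have [E0 E1 E2] := coord_triB w; rewrite d0 d1 d2 (eqP c0) in E0 E1 E2.
apply: ord3P; rewrite ?E0 ?E1 ?E2 linearZ /= !coord_e; ring.
Qed.

Lemma unipotent_not_diagonalizable : unipotent f -> pseudoreflection f -> transvection f.
Proof.
move=> [k nil] ps; split=> // -[s basis_s eig].
have f1 : f = \1%VF.
  apply/lfunP => w; rewrite id_lfunE.
  rewrite (coord_basis basis_s (memvf w)) linear_sum /=; apply: eq_bigr => i _.
  rewrite linearZ /=; congr (_ *: _); have [|x Ex] := eig s`_i.
    by rewrite mem_nth // size_tuple.
  have s0 : s`_i != 0.
    by apply: (basis_not0 basis_s); rewrite mem_nth // size_tuple.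
  have it n : iter n (f - \1)%VF s`_i = (x - 1) ^+ n *: s`_i.
    elim: n => [|n IH]; first by rewrite expr0 scale1r.
    rewrite iterS IH linearZ /= add_lfunE opp_lfunE id_lfunE Ex -{2}[s`_i]scale1r.
    by rewrite -scalerBl scalerA exprSr.
  have := nil s`_i; rewrite it => /eqP; rewrite scaler_eq0 (negPf s0) orbF expf_eq0.
  by rewrite subr_eq0 Ex => /andP[_ /eqP->]; rewrite scale1r.
move: ps; rewrite unipotent_pseudoreflection; last by exists k.
by rewrite {1}f1 eqxx.
Qed.

End TriangularEndomorphism.

(** * The unipotent subgroup and a complement of order prime to [p] *)

Section TriangularGroup.

Variables (K : fieldType) (p : nat) (W : vectType K) (gT : finGroupType).
Variables (G H : {group gT}) (rho : gT -> 'End(W)) (e : 3.-tuple W).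
Hypothesis charK : p \in [pchar K].
Hypothesis rhoG : faithful_linear_action G rho.
Hypothesis basis_e : basis_of {:W} e.
Hypothesis triG : forall g, g \in G -> upper_triangular e (rho g).
Hypothesis defH : forall g, g \in H <-> g \in G /\ unipotent (rho g).
Notation en g := (endmx e (rho g)).

Lemma entries1 i j : en 1%g i j = (i == j)%:R.
Proof. by have [-> _ _] := rhoG; rewrite endmx1 // mxE. Qed.

Lemma entries_inj : {in G &, forall x y, en x = en y -> x = y}.
Proof.
have [_ _ inj] := rhoG => x y xG yG /(endmx_inj basis_e); exact: inj.
Qed.

Lemma entriesM : {in G &, forall x y,
  [/\ en (x * y)%g i0 i0 = en x i0 i0 * en y i0 i0,
      en (x * y)%g i1 i1 = en x i1 i1 * en y i1 i1,
      en (x * y)%g i2 i2 = en x i2 i2 * en y i2 i2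
    & [/\ en (x * y)%g i0 i1 = en x i0 i0 * en y i0 i1 + en x i0 i1 * en y i1 i1,
          en (x * y)%g i1 i2 = en x i1 i1 * en y i1 i2 + en x i1 i2 * en y i2 i2
        & en (x * y)%g i0 i2 = en x i0 i0 * en y i0 i2 + en x i0 i1 * en y i1 i2
                               + en x i0 i2 * en y i2 i2]]}.
Proof.
move=> x y xG yG; have [_ rM _] := rhoG.
have [x10 x20 x21] := tri_entries (triG xG); have [y10 y20 y21] := tri_entries (triG yG).
have E i j : en (x * y)%g i j =
    en x i i0 * en y i0 j + en x i i1 * en y i1 j + en x i i2 * en y i2 j.
  by rewrite rM // endmx_comp // mxE big_ord3.
by split; [..|split]; rewrite E ?x10 ?x20 ?x21 ?y10 ?y20 ?y21;
  rewrite ?(mulr0, mul0r, addr0, add0r).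
Qed.

Lemma mem_unipotent g : g \in H <-> g \in G /\ [/\ en g i0 i0 = 1, en g i1 i1 = 1 & en g i2 i2 = 1].
Proof.
rewrite defH; split=> [] [gG u]; split=> //; first exact/(unipotent_diag basis_e (triG gG)).
exact/(unipotent_diag basis_e (triG gG)).
Qed.

Lemma sub_unipotent : H \subset G.
Proof. by apply/subsetP => h /defH[]. Qed.

Lemma diag_neq0 g : g \in G -> [/\ en g i0 i0 != 0, en g i1 i1 != 0 & en g i2 i2 != 0].
Proof.
move=> gG; have gV : (g^-1)%g \in G by rewrite groupV.
have [E0 E1 E2 _] := entriesM gG gV; rewrite mulgV !entries1 /= in E0 E1 E2.
have n0 (x y : K) : 1 = x * y -> x != 0.
  by move=> E; apply/eqP => x0; move/eqP: E; rewrite x0 mul0r oner_eq0.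
by split; [apply: n0 E0|apply: n0 E1|apply: n0 E2].
Qed.

Lemma normal_unipotent : (H <| G)%g.
Proof.
apply/andP; split; first exact: sub_unipotent.
apply/subsetP => g gG; rewrite inE; apply/subsetP => _ /imsetP[h hH ->].
have [hG [h0 h1 h2]] := (mem_unipotent h).1 hH; have gV : (g^-1)%g \in G by rewrite groupV.
apply/mem_unipotent; split; first by rewrite groupJ.
have [E0 E1 E2 _] := entriesM gV (groupM hG gG); have [F0 F1 F2 _] := entriesM hG gG.
have [I0 I1 I2 _] := entriesM gV gG; rewrite mulVg !entries1 /= in I0 I1 I2.
by rewrite conjgE E0 E1 E2 F0 F1 F2 h0 h1 h2 !mul1r -I0 -I1 -I2.
Qed.

Lemma unipotent_entriesM : {in H &, forall x y,
  [/\ en (x * y)%g i0 i1 = en x i0 i1 + en y i0 i1,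
      en (x * y)%g i1 i2 = en x i1 i2 + en y i1 i2
    & en (x * y)%g i0 i2 = en x i0 i2 + en y i0 i2 + en x i0 i1 * en y i1 i2]}.
Proof.
move=> x y /mem_unipotent[xG [x0 x1 x2]] /mem_unipotent[yG [y0 y1 y2]].
have [_ _ _ [-> -> ->]] := entriesM xG yG; rewrite x0 x1 y1 y2 !mul1r !mulr1.
by split; ring.
Qed.

Lemma unipotent_entries_inj : {in H &, forall x y, en x i0 i1 = en y i0 i1 -> en x i0 i2 = en y i0 i2 ->
  en x i1 i2 = en y i1 i2 -> x = y}.
Proof.
move=> x y /mem_unipotent[xG [x0 x1 x2]] /mem_unipotent[yG [y0 y1 y2]] a b c; apply: entries_inj => //.
have [x10 x20 x21] := tri_entries (triG xG); have [y10 y20 y21] := tri_entries (triG yG).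
by apply/matrixP; apply: ord3P; apply: ord3P;
  rewrite ?x10 ?x20 ?x21 ?y10 ?y20 ?y21 ?x0 ?x1 ?x2 ?y0 ?y1 ?y2.
Qed.

(** For [x] of prime order [q] other than [p], the entries (0, 1) and (1, 2) are additive and so
    vanish; then the entry (0, 2) is additive on powers of [x] and vanishes too. *)
Lemma pgroup_unipotent : (p.-group H)%g.
Proof.
apply/pgroupP => q pr_q /Cauchy[//|x xH ox]; rewrite inE /=.
apply/negPn/negP => qp.
have q0 : q%:R != 0 :> K.
  rewrite -(dvdn_pcharf charK) dvdn_prime2 // ?(pcharf_prime charK) //.
  by rewrite eq_sym.
have xn n : en (x ^+ n)%g i0 i1 = n%:R * en x i0 i1 /\ en (x ^+ n)%g i1 i2 = n%:R * en x i1 i2.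
  elim: n => [|n [IH1 IH2]]; first by rewrite expg0 !entries1 /= !mul0r.
  have [E1 E2 _] := unipotent_entriesM xH (groupX n xH).
  by rewrite expgS E1 E2 IH1 IH2 -[n.+1]add1n natrD !mulrDl !mul1r.
have xq : (x ^+ q = 1)%g by rewrite -ox expg_order.
have [a0 c0] : en x i0 i1 = 0 /\ en x i1 i2 = 0.
  have [E1 E2] := xn q; rewrite xq !entries1 /= in E1 E2.
  by split; apply: (mulfI q0); rewrite mulr0.
have bn n : en (x ^+ n)%g i0 i2 = n%:R * en x i0 i2.
  elim: n => [|n IH]; first by rewrite expg0 !entries1 /= !mul0r.
  have [_ _ E] := unipotent_entriesM xH (groupX n xH).
  by rewrite expgS E IH a0 mul0r addr0 -[n.+1]add1n natrD !mulrDl !mul1r.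
have b0 : en x i0 i2 = 0.
  by have E := bn q; rewrite xq !entries1 /= in E; apply: (mulfI q0); rewrite mulr0.
have x1 : x = 1%g by apply: unipotent_entries_inj => //; rewrite entries1.
by move: ox pr_q; rewrite x1 order1 => <-.
Qed.

(** In characteristic [p] the only [p]-th root of 1 is 1; apply this to the diagonal entries. *)
Lemma root_unipotent g : g \in G -> (g ^+ p)%g \in H -> g \in H.
Proof.
move=> gG /mem_unipotent[_ [p0 p1 p2]].
have en_exp n : [/\ en (g ^+ n)%g i0 i0 = en g i0 i0 ^+ n,
    en (g ^+ n)%g i1 i1 = en g i1 i1 ^+ n & en (g ^+ n)%g i2 i2 = en g i2 i2 ^+ n].
  elim: n => [|n [IH0 IH1 IH2]]; first by rewrite expg0 !entries1.
  have [E0 E1 E2 _] := entriesM gG (groupX n gG).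
  by rewrite expgS E0 E1 E2 IH0 IH1 IH2 !exprS.
have prp := pcharf_prime charK.
have root1 (x : K) : x ^+ p = 1 -> x = 1.
  move=> xp; have pn : [pchar K].-nat p.
    by rewrite (eq_pnat _ (pcharf_eq charK)) pnat_id.
  have : (x - 1) ^+ p = 0.
    by apply: (addIr (1 ^+ p)); rewrite -exprDn_pchar // subrK expr1n add0r.
  by move/eqP; rewrite expf_eq0 subr_eq0 => /andP[_ /eqP].
have [E0 E1 E2] := en_exp p; apply/mem_unipotent; split=> //.
by split; apply: root1; rewrite -?E0 -?E1 -?E2.
Qed.

Lemma Hall_unipotent : Hall G H.
Proof.
apply/andP; split; first exact: sub_unipotent.
have pn : p.-nat #|H| by exact: pgroup_unipotent.
have nHG := normal_norm normal_unipotent.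
apply: (pnat_coprime pn); rewrite -(card_quotient nHG).
apply/pgroupP => q pr_q /Cauchy[//|X XQ oX]; rewrite !inE /=; apply/eqP => qp.
have /morphimP[g Ng gG EX] := XQ.
have gp : (g ^+ p)%g \in H.
  apply: coset_idr; first by rewrite groupX.
  by rewrite morphX // -EX -qp -oX expg_order.
have X1 : X = 1%g by rewrite EX; apply: coset_id; apply: root_unipotent gp.
by move: oX pr_q; rewrite X1 order1 => <-.
Qed.

Lemma complement_exists : exists T : {group gT},
  [/\ T \subset G, H :&: T = 1%g, (H * T)%g = G & #|T|%:R != 0 :> K].
Proof.
have /splitsP[T /complP[tiHT defG]] := SchurZassenhaus_split Hall_unipotent normal_unipotent.
have sTG : T \subset G by rewrite -defG mulG_subr.
exists T; split=> //; rewrite -(dvdn_pcharf charK); apply/negP => /Cauchy.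
case; first exact: pcharf_prime charK.
move=> x xT ox; have : x \in H :&: T.
  rewrite inE xT andbT root_unipotent ?(subsetP sTG) // -ox expg_order.
  exact: group1.
rewrite tiHT => /set1P x1; have := prime_gt1 (pcharf_prime charK).
by rewrite -ox x1 order1.
Qed.

End TriangularGroup.

(** * An eigenbasis of the complement compatible with the flag *)

Section Eigenbasis.

Variables (K : fieldType) (W : vectType K) (gT : finGroupType).
Variables (G T : {group gT}) (rho : gT -> 'End(W)) (e : 3.-tuple W).
Hypothesis rhoG : faithful_linear_action G rho.
Hypothesis basis_e : basis_of {:W} e.
Hypothesis dimW : \dim {:W} = 3%N.
Hypothesis triG : forall g, g \in G -> upper_triangular e (rho g).
Hypothesis sTG : T \subset G.
Hypothesis T_neq0 : #|T|%:R != 0 :> K.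
Notation en g := (endmx e (rho g)).

Definition eigvec (j : 'I_3) : W :=
  #|T|%:R^-1 *: \sum_(t in T) (en t j j)^-1 *: rho t e`_j.

Lemma diagM (j : 'I_3) : {in G &, {morph (fun g => en g j j) : x y / (x * y)%g >-> x * y}}.
Proof.
move=> x y xG yG; have [E0 E1 E2 _] := entriesM rhoG basis_e triG xG yG.
by elim/ord3P: j.
Qed.

Lemma diag_entry_neq0 (j : 'I_3) g : g \in G -> en g j j != 0.
Proof. by move=> gG; have [] := diag_neq0 rhoG basis_e triG gG; elim/ord3P: j. Qed.

Lemma eigvecP j s : s \in T -> rho s (eigvec j) = en s j j *: eigvec j.
Proof.
move=> sT; have sG := subsetP sTG _ sT; have [_ rM _] := rhoG.
rewrite /eigvec linearZ scalerA mulrC -scalerA; congr (_ *: _).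
rewrite linear_sum scaler_sumr /= [RHS](reindex_inj (mulgI s)) /=.
apply: eq_big => [t|t tT]; first by rewrite groupMl.
have tG := subsetP sTG _ tT.
rewrite linearZ /= scalerA diagM // invfM mulrA divff ?diag_entry_neq0 // mul1r.
by rewrite rM // comp_lfunE.
Qed.

(** The normalization by [(en t j j)^-1] makes the change of basis unitriangular, so it preserves
    the flag. *)
Lemma coord_eigvec (i j : 'I_3) : (j <= i)%N -> coord e i (eigvec j) = (i == j)%:R.
Proof.
move=> ji; rewrite linearZ linear_sum /=.
rewrite (eq_bigr (fun=> (i == j)%:R)) => [|t tT].
  by rewrite sumr_const -[X in _ * X](mulr_natl _ #|T|) mulKf.
have tG := subsetP sTG _ tT; rewrite linearZ /=.
have [ij|ij] := eqVneq i j.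
  by rewrite -ij; have := diag_entry_neq0 i tG; rewrite mxE => n0; rewrite mulVf.
rewrite (triG tG) ?mulr0 // ltn_neqAle ji andbT.
by apply: contra ij => /eqP E; apply/eqP/val_inj; rewrite /= E.
Qed.

Definition eigbasis := [tuple eigvec j | j < 3].

Lemma eigbasisE (j : 'I_3) : eigbasis`_j = eigvec j.
Proof. by rewrite -tnth_nth tnth_mktuple. Qed.

Lemma eigbasis_basis : basis_of {:W} eigbasis.
Proof.
have vE j : eigvec j \in <<eigbasis>>%VS.
  by rewrite -eigbasisE memv_span // mem_nth // size_tuple.
have c (i j : 'I_3) := coord_eigvec (i := i) (j := j).
have exp (j : 'I_3) : eigvec j = coord e i0 (eigvec j) *: e`_0 + coord e i1 (eigvec j) *: e`_1
    + coord e i2 (eigvec j) *: e`_2.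
  by rewrite {1}(coord_expand basis_e (eigvec j)) big_ord3.
have e0 : e`_0 \in <<eigbasis>>%VS.
  by have := vE i0; rewrite exp !c //= !scale0r !addr0 scale1r.
have e1 : e`_1 \in <<eigbasis>>%VS.
  have := vE i1; rewrite exp (c i1 i1) // (c i2 i1) //= scale0r addr0 scale1r.
  by rewrite rpredDl // rpredZ.
have e2 : e`_2 \in <<eigbasis>>%VS.
  have := vE i2; rewrite exp (c i2 i2) //= scale1r.
  by rewrite rpredDl // rpredD // rpredZ.
rewrite basisEdim size_tuple dimW leqnn andbT.
apply/subvP => w _; rewrite (coord_expand basis_e w) rpred_sum // => j _.
by rewrite rpredZ //; elim/ord3P: j.
Qed.

Lemma eigbasis_tri g : g \in G -> upper_triangular eigbasis (rho g).
Proof.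
move=> gG; have c (i j : 'I_3) := coord_eigvec (i := i) (j := j).
have exp i w : coord e i w = coord eigbasis i0 w * coord e i (eigvec i0)
    + coord eigbasis i1 w * coord e i (eigvec i1) + coord eigbasis i2 w * coord e i (eigvec i2).
  by rewrite -!eigbasisE {1}(coord_expand eigbasis_basis w) linear_sum big_ord3 !linearZ.
have c2 w : coord e i2 w = 0 -> coord eigbasis i2 w = 0.
  by rewrite exp !c //= !mulr0 !add0r mulr1.
have c1 w : coord e i1 w = 0 -> coord e i2 w = 0 -> coord eigbasis i1 w = 0.
  move=> E1 /c2 E2; move: E1; rewrite exp E2 (c i1 i0) // (c i1 i1) //=.
  by rewrite mulr0 add0r mulr1 mul0r addr0.
have [_ E01 E02] := coord_tri basis_e (triG gG) (eigvec i0).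
have [_ _ E12] := coord_tri basis_e (triG gG) (eigvec i1).
rewrite !c //= !mulr0 ?addr0 in E01 E02 E12.
move=> i j; rewrite eigbasisE; elim/ord3P: i; elim/ord3P: j => //= _.
- exact: c1.
- exact: c2.
- exact: c2.
Qed.

End Eigenbasis.

Lemma comp_mx_tuple (R : comNzRingType) (A B : 'M[R]_3) (f : {mpoly R[3]}) :
  (f \mPo mx_tuple A) \mPo mx_tuple B = f \mPo mx_tuple (A *m B).
Proof.
rewrite comp_mpolyA; apply: comp_mpoly_ext => i; rewrite !tnth_mktuple raddf_sum /=.
under eq_bigr do rewrite comp_mpolyZ comp_mpolyX_tnth tnth_mktuple scaler_sumr.
rewrite exchange_big; apply: eq_bigr => k _ /=; rewrite mxE scaler_suml.
by apply: eq_bigr => j _; rewrite scalerA.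
Qed.

(** * The linear group in the adapted basis *)

Section SplitGroup.

Variables (K : closedFieldType) (p : nat) (W : vectType K) (gT : finGroupType).
Variables (G H T : {group gT}) (rho : gT -> 'End(W)) (v : 3.-tuple W).
Hypothesis charK : p \in [pchar K].
Hypothesis odd_p : odd p.
Hypothesis dimW : \dim {:W} = 3%N.
Hypothesis rhoG : faithful_linear_action G rho.
Hypothesis basis_v : basis_of {:W} v.
Hypothesis triG : forall g, g \in G -> upper_triangular v (rho g).
Hypothesis genG : generated_by_pseudoreflections G rho.
Hypothesis defH : forall g, g \in H <-> g \in G /\ unipotent (rho g).
Hypothesis abH : abelian H.
Hypothesis sTG : T \subset G.
Hypothesis tiHT : H :&: T = 1%g.
Hypothesis defG : (H * T)%g = G.
Hypothesis diagT : {in T, forall x (j : 'I_3), exists k, rho x v`_j = k *: v`_j}.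
Notation en g := (endmx v (rho g)).
Let a h := en h i0 i1.
Let b h := en h i0 i2.
Let c h := en h i1 i2.
Let t0 x := en x i0 i0.
Let t1 x := en x i1 i1.
Let t2 x := en x i2 i2.

Lemma T_offdiag x i j : x \in T -> i != j -> en x i j = 0.
Proof.
move=> xT ij; have [k Ek] := diagT xT j.
by rewrite mxE Ek linearZ /= coord_basisE // eq_sym (negPf ij) mulr0.
Qed.

Lemma T_normal : T \subset 'N(H)%g.
Proof. exact: subset_trans sTG (normal_norm (normal_unipotent rhoG basis_v triG defH)). Qed.

Lemma H_sub : {subset H <= G}.
Proof. exact/subsetP/sub_unipotent. Qed.

Lemma T_sub : {subset T <= G}.
Proof. exact/subsetP. Qed.

Lemma conj_entries x h : x \in T -> h \in H ->
  [/\ t0 x * a (h ^ x)%g = t1 x * a h, t0 x * b (h ^ x)%g = t2 x * b h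
    & t1 x * c (h ^ x)%g = t2 x * c h].
Proof.
move=> xT hH; have xG := T_sub xT; have hG := H_sub hH.
have hxG : (h ^ x)%g \in G by rewrite groupJ.
have [_ [h0 h1 h2]] := (mem_unipotent basis_v triG defH h).1 hH.
have [_ _ _ [E01 E12 E02]] := entriesM rhoG basis_v triG xG hxG.
have [_ _ _ [F01 F12 F02]] := entriesM rhoG basis_v triG hG xG.
rewrite -conjgC in E01 E12 E02.
rewrite F01 h0 (T_offdiag xT (_ : i0 != i1)) // mulr0 mul0r add0r addr0 in E01.
rewrite F12 h1 (T_offdiag xT (_ : i1 != i2)) // mulr0 mul0r add0r addr0 in E12.
rewrite F02 h0 (T_offdiag xT (_ : i0 != i2)) // (T_offdiag xT (_ : i0 != i1)) // in E02.
rewrite (T_offdiag xT (_ : i1 != i2)) // !mulr0 !mul0r !add0r !addr0 in E02.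
by rewrite /a /b /c /t0 /t1 /t2 -E01 -E12 -E02 ![en h _ _ * _]mulrC.
Qed.

Lemma T_inj : {in T, forall x, t0 x = 1 -> t1 x = 1 -> t2 x = 1 -> x = 1%g}.
Proof.
move=> x xT x0 x1 x2; apply/set1gP; rewrite -tiHT inE xT andbT.
by apply/(mem_unipotent basis_v triG defH); split; [apply: T_sub|].
Qed.

(** A pseudoreflection [h t] has the same diagonal as [t], so [t] is a [coord_refl]. Hence [G] is
    [H] times the group these generate, and trivial intersection with [H] gives all of [T]. *)
Lemma T_gen : <<[set x in T | coord_refl t0 t1 t2 x]>>%g = T.
Proof.
set R := [set x in T | _]; have sRT : <<R>>%g \subset T.
  by rewrite gen_subG; apply/subsetP => x; rewrite inE => /andP[].
apply/eqP; rewrite eqEsubset sRT /=; apply/subsetP => x xT.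
have sG : G \subset (H <*> <<R>>)%g.
  suff : <<[set g in G | pseudoreflection (rho g)]>>%g \subset (H <*> <<R>>)%g.
    by rewrite genG.
  rewrite gen_subG; apply/subsetP => g.
  rewrite inE => /andP[gG ps].
  have /mulsgP[h t hH tT gE] : g \in (H * T)%g by rewrite defG.
  have hG := H_sub hH; have tG := T_sub tT.
  have [_ [h0 h1 h2]] := (mem_unipotent basis_v triG defH h).1 hH.
  have [E0 E1 E2 _] := entriesM rhoG basis_v triG hG tG.
  rewrite gE groupM ?(subsetP (joing_subl _ _) _ hH) //.
  apply/(subsetP (joing_subr _ _))/mem_gen; rewrite inE tT /=.
  have := pseudoreflection_diag basis_v dimW (triG gG) ps.
  by rewrite gE E0 E1 E2 h0 h1 h2 !mul1r.
have nRH : <<R>>%g \subset 'N(H)%g := subset_trans sRT T_normal.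
have := subsetP sG x (T_sub xT); rewrite norm_joinEr // => /mulsgP[h t hH tR xE].
have tT := subsetP sRT t tR.
have h1 : h = 1%g.
  apply/set1gP; rewrite -tiHT inE hH /=.
  by rewrite (_ : h = (x * t^-1)%g) ?groupM ?groupV // xE mulgK.
by rewrite xE h1 mul1g.
Qed.

Lemma split_triangular_data : triangular_data H T a b c t0 t1 t2.
Proof.
have hm := unipotent_entriesM rhoG basis_v triG defH.
have dm (j : 'I_3) : {in T &, {morph (fun g => en g j j) : x y / (x * y)%g >-> x * y}}.
  by move=> x y xT yT; apply: (diagM rhoG basis_v triG); apply: T_sub.
split.
- by move=> x y xH yH; have [] := hm x y xH yH.
- by move=> x y xH yH; have [] := hm x y xH yH.
- by move=> x y xH yH; have [] := hm x y xH yH.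
- exact: (unipotent_entries_inj rhoG basis_v triG defH).
- exact: dm.
- exact: dm.
- exact: dm.
- by move=> x xT; apply: (diag_neq0 rhoG basis_v triG); apply: T_sub.
- exact: T_normal.
- by move=> x h xT hH; have [] := conj_entries xT hH.
- by move=> x h xT hH; have [] := conj_entries xT hH.
- by move=> x h xT hH; have [] := conj_entries xT hH.
- exact: T_gen.
Qed.

Lemma invariant_coord f : invariant v G rho f <-> coord_inv H T a b c t0 t1 t2 f.
Proof.
have tupH h : h \in H -> f \mPo mx_tuple (en h) = f \mPo unip (a h) (b h) (c h).
  move=> hH; have [hG [h0 h1 h2]] := (mem_unipotent basis_v triG defH h).1 hH.
  have [E10 E20 E21] := tri_entries (triG hG).
  apply: comp_mpoly_ext; apply: ord3P; rewrite tnth_mktuple big_ord3 (tnth_nth 0) /=.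
  - by rewrite h0 scale1r addrA.
  - by rewrite E10 h1 scale0r add0r scale1r.
  - by rewrite E20 E21 h2 !scale0r !add0r scale1r.
have tupT x : x \in T -> f \mPo mx_tuple (en x) = f \mPo diag3 (t0 x) (t1 x) (t2 x).
  move=> xT; apply: comp_mpoly_ext; apply: ord3P; rewrite tnth_mktuple big_ord3 (tnth_nth 0) /=.
  - by rewrite (T_offdiag xT (_ : i0 != i1)) // (T_offdiag xT (_ : i0 != i2)) // !scale0r !addr0.
  - by rewrite (T_offdiag xT (_ : i1 != i0)) // (T_offdiag xT (_ : i1 != i2)) // !scale0r add0r addr0.
  - by rewrite (T_offdiag xT (_ : i2 != i0)) // (T_offdiag xT (_ : i2 != i1)) // !scale0r !add0r.
rewrite invariantP //; split=> [inv|[invH invT] g].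
  by split=> [h hH|x xT]; [rewrite -tupH // inv // H_sub | rewrite -tupT // inv // T_sub].
rewrite -[in g \in _]defG => /mulsgP[h x hH xT ->].
have [_ rM _] := rhoG; rewrite (rM _ _ (H_sub hH) (T_sub xT)) (endmx_comp basis_v) -comp_mx_tuple.
by rewrite (tupH h hH) (invH h hH) (tupT x xT) (invT x xT).
Qed.

Lemma polynomial_invariants_split :
  polynomial_invariants v G rho <->
  generated_by_pseudoreflections H rho \/ (forall h, h \in H -> ~ transvection (rho h)).
Proof.
have rho1 h : h \in G -> (rho h == \1%VF) = (h == 1%g).
  move=> hG; have [r1 _ inj] := rhoG; apply/eqP/eqP => [E|->] //.
  by apply: inj => //; rewrite E r1.
have psE h : h \in H -> pseudoreflection (rho h) = (h != 1%g) && (a h * c h == 0).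
  move=> hH; have [hG uh] := (defH h).1 hH.
  by rewrite (unipotent_pseudoreflection basis_v dimW (triG hG) uh) rho1.
have psH : [set h in H | pseudoreflection (rho h)] = transv_set H a c.
  by apply/setP => h; rewrite !inE; case hH: (h \in H) => //=; rewrite psE.
have genH : (forall x, x \in T -> x = 1%g) -> <<transv_set H a c>>%g = H.
  move=> T1; have HG : H :=: G.
    rewrite -defG; have -> : T :=: 1%g; last by rewrite mulg1.
    apply/trivgP/subsetP => x /T1 ->; exact: group1.
  by rewrite -psH HG.
(* A unipotent pseudoreflection is never diagonalizable, so the transvections in [H] are exactly its
   pseudoreflections. *)
have tr_iff : (forall h, h \in H -> ~ transvection (rho h)) <->
    {in H, forall h, a h * c h = 0 -> h = 1%g}.
  split=> [no h hH ac|no h hH [+ _]].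
    apply/eqP/negPn/negP => h1; have [hG uh] := (defH h).1 hH; apply: (no h hH).
    apply: (unipotent_not_diagonalizable basis_v dimW (triG hG) uh).
    by rewrite psE // h1 ac eqxx.
  by rewrite psE // => /andP[/negP h1 /eqP/(no h hH)/eqP].
rewrite tr_iff /generated_by_pseudoreflections psH.
rewrite -(polynomial_coord_invP split_triangular_data charK odd_p
  (pgroup_unipotent charK rhoG basis_v triG defH) abH T_inj genH).
apply: (polynomial_subring_transport (s := [tuple X0; X1; X2]) (t := [tuple X0; X1; X2])).
- by move=> f; rewrite !comp3_id.
- by move=> f; rewrite !comp3_id.
- by move=> f; rewrite comp3_id; apply: invariant_coord.
Qed.

End SplitGroup.

Theorem theorem4 (K : closedFieldType) (p : nat)
  (charK : p \in [pchar K]) (odd_p : odd p)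
  (W : vectType K) (dimW : \dim {:W} = 3%N)
  (gT : finGroupType) (G : {group gT}) (rho : gT -> 'End(W))
  (rhoG : faithful_linear_action G rho)
  (e : 3.-tuple W) (basis_e : basis_of {:W} e)
  (triG : forall g, g \in G -> upper_triangular e (rho g))
  (genG : generated_by_pseudoreflections G rho)
  (H : {group gT})
  (defH : forall g, g \in H <-> g \in G /\ unipotent (rho g))
  (abH : abelian H) :
  polynomial_invariants e G rho <->
  generated_by_pseudoreflections H rho \/
  (forall h, h \in H -> ~ transvection (rho h)).
Proof.
have [T [sTG tiHT defG T0]] := complement_exists charK rhoG basis_e triG defH.
have basis_v := eigbasis_basis rhoG basis_e dimW triG sTG T0.
rewrite (polynomial_invariants_basis G rho basis_e basis_v).
apply: (polynomial_invariants_split charK odd_p dimW rhoG basis_v _ genG defH abH sTG tiHT defG).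
  by move=> g gG; apply: (eigbasis_tri rhoG basis_e dimW triG sTG T0 gG).
move=> x xT j; exists (endmx e (rho x) j j).
by rewrite eigbasisE; apply: (eigvecP rhoG basis_e triG sTG).
Qed.
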